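(* Let $f(\mathbf{x})=\frac1n\sum_{i=1}^nf_i(\mathbf{x})$ (or $f(\mathbf{x})=\mathrm{E}_\xi[f(\mathbf{x};\xi)]$, writing $f_i(\mathbf{x})=f(\mathbf{x};\xi_i)$) on $\mathbb{R}^d$, where every $f_i$ is twice differentiable, has $L_1$-Lipschitz gradient and has $L_2$-Lipschitz Hessian (in spectral norm), $L_1,L_2>0$, and is not necessarily convex. Let $\mathbf{x}_0\in\mathbb{R}^d$ satisfy $f(\mathbf{x}_0)-f(\mathbf{x}_* )\le\Delta<\infty$, where $\mathbf{x}_*$ is a global minimizer of $f$. Assume that for some $G>0$, $\mathrm{E}[\exp(\|\nabla f_i(\mathbf{x})-\nabla f(\mathbf{x})\|/G)]\le\exp(1)$ for any $\mathbf{x}\in\mathbb{R}^d$ (expectation over the random index $i$). Let $\delta\in(0,1)$, $\epsilon_1\in(0,1)$, $\epsilon_2=\epsilon_1^\alpha$ with $\alpha\in(0,1]$, and $\delta'=\delta/\bigl(1+\max(\frac{48L_2^2}{\epsilon_2^3},\frac{8L_1}{\epsilon_1^2})\Delta\bigr)$. Set (rounding up to integers) $$|\mathcal S_1|=\max\left(\frac{32G^2}{\epsilon_1^2},\frac{2304G^2L_2^2}{\epsilon_2^4}\right)\left(1+3\log^2\frac2{\delta'}\right),\qquad|\mathcal S_2|=\frac{9216L_1^2}{\epsilon_2^2}\log\frac{4d}{\delta'}.$$ Then with probability at least $1-\delta$ the algorithm SNCG$(\mathbf{x}_0,\epsilon_1,\alpha,\delta)$ (defined in the context) terminates at some iteration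 $j_*$ with $$j_*\le1+\max\left(\frac{48L_2^2}{\epsilon_2^3},\frac{8L_1}{\epsilon_1^2}\right)\Delta,$$ and upon termination it holds that $\|\nabla f(\mathbf{x}_{j_*})\|\le2\epsilon_1$ and $\lambda_{\min}(\nabla^2f(\mathbf{x}_{j_*}))\ge-2\epsilon_2$ with probability at least $1-3\delta$. Furthermore, the worst-case time complexity of SNCG is $$\widetilde O\left(T_h^1\max\left(\frac1{\epsilon_1^2\epsilon_2^2},\frac1{\epsilon_2^5}\right)+T_g^1\max\left(\frac1{\epsilon_1^4},\frac1{\epsilon_1^2\epsilon_2^3},\frac1{\epsilon_2^7},\frac1{\epsilon_1^2\epsilon_2^4}\right)\right).$$
   Context: $\|\cdot\|$ is the Euclidean norm, $\|\cdot\|_2$ the spectral norm, $\lambda_{\min}$ the smallest eigenvalue; $\mathrm{sign}(t)=1$ if $t\ge0$ and $-1$ otherwise. $T_g^1$ is the time of computing one $\nabla f_i(\mathbf{x})$, $T_h^1$ that of one product $\nabla^2f_i(\mathbf{x})\mathbf{u}$. $\widetilde O$ suppresses factors logarithmic in $d,1/\delta,1/\epsilon_1,1/\epsilon_2$; in the final complexity $L_1,L_2,G,\Delta$ are treated as constants. Sub-sampling: $\mathcal S_1,\mathcal S_2$ are random index sets with elements drawn uniformly from $\{1,\dots,n\}$ (or i.i.d. from the distribution of $\xi$), drawn afresh at each iteration, and $\mathbf{g}(\mathbf{x})=\frac1{|\mathcal S_1|}\sum_{i\in\mathcal S_1}\nabla f_i(\mathbf{x})$, $H(\mathbf{x})=\frac1{|\mathcal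 S_2|}\sum_{i\in\mathcal S_2}\nabla^2f_i(\mathbf{x})$. Randomized algorithm $\mathcal A$ (approximate PCA): given $H=\frac1m\sum_{i=1}^mH_i$ with symmetric $H_i$, $\|H_i\|_2\le L_1$, $\varepsilon>0$ and $\delta\in(0,1)$, using fresh randomness it returns a unit $\mathbf{v}$ such that with probability at least $1-\delta$, $\lambda_{\min}(H)\ge\mathbf{v}^\top H\mathbf{v}-\varepsilon$, in time $\widetilde O(T_h^1\max\{m,m^{3/4}\sqrt{L_1/\varepsilon}\})$. Stochastic NCG step, $(\mathbf{x}^+,\mathbf{v})=\text{NCG-S}(\mathbf{x},\varepsilon,\delta,\epsilon_2)$: (1) compute $\mathbf{g}(\mathbf{x})$ and $H(\mathbf{x})$; (2) use $\mathcal A$ to find a unit $\mathbf{v}$ with $\lambda_{\min}(H(\mathbf{x}))\ge\mathbf{v}^\top H(\mathbf{x})\mathbf{v}-\varepsilon$ with probability at least $1-\delta$; (3) if $-\frac{\epsilon_2^2}{2L_2^2}\mathbf{v}^\top H(\mathbf{x})\mathbf{v}-\frac{11\epsilon_2^3}{48L_2^2}>\frac{\|\mathbf{g}(\mathbf{x})\|^2}{4L_1}-\frac{\epsilon_1^2}{8L_1}$, set $\mathbf{x}^+=\mathbf{x}-\frac{\epsilon_2}{L_2}\mathrm{sign}(\mathbf{v}^\top\mathbf{g}(\mathbf{x}))\mathbf{v}$; otherwise set $\mathbf{x}^+=\mathbf{x}-\frac1{L_1}\mathbf{g}(\mathbf{x})$; (4) return $(\mathbf{x}^+,\mathbf{v})$.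 Algorithm SNCG$(\mathbf{x}_0,\epsilon_1,\alpha,\delta)$: set $\mathbf{x}_1=\mathbf{x}_0$, $\epsilon_2=\epsilon_1^\alpha$, and $\delta'$ as in the claim. For $j=1,2,\dots$: let $\mathbf{g}(\mathbf{x}_j)$ be the sub-sampled gradient (the same one used inside the step); $(\mathbf{x}_{j+1},\mathbf{v}_j)=\text{NCG-S}(\mathbf{x}_j,\max(\epsilon_2,\|\mathbf{g}(\mathbf{x}_j)\|^\alpha)/2,\delta',\epsilon_2)$; if $\mathbf{v}_j^\top H(\mathbf{x}_j)\mathbf{v}_j>-\epsilon_2/2$ and $\|\mathbf{g}(\mathbf{x}_j)\|\le\epsilon_1$, terminate and return $\mathbf{x}_j$ (then $j_*=j$). *)

(* Defs.v *)
From HB Require Import structures.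
From mathcomp Require Import all_boot all_order all_algebra.
From mathcomp Require Import all_classical all_reals all_analysis.

Set Implicit Arguments.
Unset Strict Implicit.
Unset Printing Implicit Defensive.

Import Order.TTheory GRing.Theory Num.Theory.
Import numFieldNormedType.Exports.

Local Open Scope classical_set_scope.
Local Open Scope ring_scope.

Definition dotv (R : realType) (d : nat) (u v : 'cV[R]_d) : R :=
  (u^T *m v) 0 0.

(* The norm that the library puts on matrices is the max norm, hence this
   separate Euclidean norm; both induce the same topology, so [differentiable]
   is unaffected. *)
Definition enorm (R : realType) (d : nat) (v : 'cV[R]_d) : R :=
  Num.sqrt (dotv v v).

Definition quadf (R : realType) (d : nat) (H : 'M[R]_d) (v : 'cV[R]_d) : R :=
  dotv v (H *m v).

Definition spectral_norm (R : realType) (d : nat) (H : 'M[R]_d) : R :=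
  sup [set enorm (H *m v) | v in [set v : 'cV[R]_d | enorm v = 1]].

(* Only used on symmetric H with 0 < d: the set of real eigenvalues is then
   finite and nonempty, so that its infimum is its smallest element. *)
Definition lambda_min (R : realType) (d : nat) (H : 'M[R]_d) : R :=
  inf [set a : R | eigenvalue H a].

Definition grad (R : realType) (d : nat) (h : 'cV[R]_d -> R) (x : 'cV[R]_d)
  : 'cV[R]_d :=
  \col_i 'D_(delta_mx i 0) h x.

Definition hess (R : realType) (d : nat) (h : 'cV[R]_d -> R) (x : 'cV[R]_d)
  : 'M[R]_d :=
  \matrix_(i, j) 'D_(delta_mx j 0) (fun y => grad h y i 0) x.

Definition smooth_component (R : realType) (d : nat) (L1 L2 : R)
    (h : 'cV[R]_d -> R) : Prop :=
  [/\ forall x, differentiable h x,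
      forall x, differentiable (grad h) x,
      forall x y, enorm (grad h x - grad h y) <= L1 * enorm (x - y) &
      forall x y, spectral_norm (hess h x - hess h y) <= L2 * enorm (x - y)].

Inductive sampling_model (R : realType) : Type :=
| FiniteSum (n : nat) of (0 < n)%N
| Expectation (dX : measure_display) (Xi : measurableType dX)
    of probability Xi R.

Definition sample (R : realType) (M : sampling_model R) : Type :=
  match M with
  | FiniteSum n _ => 'I_n
  | Expectation _ Xi _ => Xi
  end.

Definition sample_events (R : realType) (M : sampling_model R)
  : set (set (sample M)) :=
  match M with
  | FiniteSum _ _ => setT
  | Expectation _ _ _ => measurable
  end.

Definition sample_law (R : realType) (M : sampling_model R)
  : set (sample M) -> \bar R :=
  match M with
  | FiniteSum n _ => fun B => (\sum_(i < n | i \in B) n%:R^-1)%:E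
  | Expectation _ _ mu => fun B => mu B
  end.

Definition mean_exists (R : realType) (M : sampling_model R)
  : (sample M -> R) -> Prop :=
  match M with
  | FiniteSum _ _ => fun _ => True
  | Expectation _ _ mu => fun X => mu.-integrable setT (EFin \o X)
  end.

Definition mean (R : realType) (M : sampling_model R)
  : (sample M -> R) -> \bar R :=
  match M with
  | FiniteSum n _ => fun X => (n%:R^-1 * \sum_i X i)%:E
  | Expectation _ _ mu => fun X => ('E_mu[X])%E
  end.

Definition mean_mx (R : realType) (d m : nat) (Hs : 'I_m -> 'M[R]_d)
  : 'M[R]_d :=
  m%:R^-1 *: \sum_i Hs i.

(* The arguments are the H_i, the accuracy, the failure probability and the
   random seed, the only source of randomness of the algorithm. *)
Definition pca_algorithm (R : realType) (S : Type) : Type :=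
  forall d m : nat, ('I_m -> 'M[R]_d) -> R -> R -> S -> 'cV[R]_d.

(* The first argument is the time of one product H_i u. *)
Definition pca_runtime (R : realType) (S : Type) : Type :=
  R -> forall d m : nat, ('I_m -> 'M[R]_d) -> R -> R -> S -> R.

Definition pca_input (R : realType) (L1 : R) (d m : nat)
    (Hs : 'I_m -> 'M[R]_d) (eps delta : R) : Prop :=
  [/\ (0 < d)%N, (0 < m)%N,
      forall i, (Hs i)^T = Hs i /\ spectral_norm (Hs i) <= L1,
      0 < eps & 0 < delta < 1].

(* Joint measurability of the output in (H_1, ..., H_m, eps, seed), phrased by
   composing with an arbitrary measurable family of admissible inputs. *)
Definition pca_measurable (R : realType) (L1 : R) (dS : measure_display)
    (S : measurableType dS) (A : pca_algorithm R S) : Prop :=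
  forall (d m : nat) (delta : R) (dT : measure_display)
         (T : measurableType dT) (Hs : T -> 'I_m -> 'M[R]_d) (eps : T -> R),
    (forall t, pca_input L1 (Hs t) (eps t) delta) ->
    (forall k i j, measurable_fun setT (fun t => Hs t k i j)) ->
    measurable_fun setT eps ->
    forall i, measurable_fun setT
      (fun ts : T * S => A d m (Hs ts.1) (eps ts.1) delta ts.2 i 0).

Definition approximate_pca (R : realType) (L1 : R) (dS : measure_display)
    (S : measurableType dS) (PS : probability S R) (A : pca_algorithm R S)
  : Prop :=
  pca_measurable L1 A /\
  forall (d m : nat) (Hs : 'I_m -> 'M[R]_d) (eps delta : R),
    pca_input L1 Hs eps delta ->
    (forall s, enorm (A d m Hs eps delta s) = 1) /\
    ((1 - delta)%:E <=
      PS [set s | (quadf (mean_mx Hs) (A d m Hs eps delta s) - eps <=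
                   lambda_min (mean_mx Hs))%R])%E.

(* The soft-O of the running time: constant CA and exponent pA of the
   logarithmic factor. The logarithm of 1/eps is truncated at 0, as eps may
   exceed 1. *)
Definition pca_time_bound (R : realType) (L1 : R) (S : Type)
    (tA : pca_runtime R S) (CA : R) (pA : nat) : Prop :=
  forall (Th : R) (d m : nat) (Hs : 'I_m -> 'M[R]_d) (eps delta : R) (s : S),
    0 <= Th -> pca_input L1 Hs eps delta ->
    tA Th d m Hs eps delta s <=
      CA * (1 + ln d%:R + ln delta^-1 + Num.max 0 (ln eps^-1)) ^+ pA *
      (Th * Num.max m%:R (m%:R `^ (3 / 4) * Num.sqrt (L1 / eps))).

Definition sub_grad (R : realType) (d m : nat) (X : Type)
    (F : X -> 'cV[R]_d -> R) (z : 'I_m -> X) (x : 'cV[R]_d) : 'cV[R]_d :=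
  m%:R^-1 *: \sum_k grad (F (z k)) x.

Definition sub_hess (R : realType) (d m : nat) (X : Type)
    (F : X -> 'cV[R]_d -> R) (z : 'I_m -> X) (x : 'cV[R]_d) : 'M[R]_d :=
  mean_mx (fun k => hess (F (z k)) x).

Definition sign (R : realType) (t : R) : R := if 0 <= t then 1 else -1.

(* z1 and z2 are the draws of S_1 and S_2, and s is the seed given to A. *)
Definition NCG_S (R : realType) (S : Type) (A : pca_algorithm R S)
    (L1 L2 eps1 : R) (d m1 m2 : nat) (X : Type) (F : X -> 'cV[R]_d -> R)
    (z1 : 'I_m1 -> X) (z2 : 'I_m2 -> X) (s : S)
    (x : 'cV[R]_d) (eps delta eps2 : R) : 'cV[R]_d * 'cV[R]_d :=
  let g := sub_grad F z1 x in
  let H := sub_hess F z2 x in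
  let v := A d m2 (fun k => hess (F (z2 k)) x) eps delta s in
  let xplus :=
    if - (eps2 ^+ 2 / (2 * L2 ^+ 2)) * quadf H v
         - 11 * eps2 ^+ 3 / (48 * L2 ^+ 2)
       > enorm g ^+ 2 / (4 * L1) - eps1 ^+ 2 / (8 * L1)
    then x - (eps2 / L2 * sign (dotv v g)) *: v
    else x - L1^-1 *: g in
  (xplus, v).

Definition sncg_accuracy (R : realType) (alpha eps2 : R) (d : nat)
    (g : 'cV[R]_d) : R :=
  Num.max eps2 (enorm g `^ alpha) / 2.

(* In the run, z1 j, z2 j and s j are the draws and the seed of iteration j;
   iterations are numbered from 1, so that the values at 0 are not used. The
   iterates x_j and directions v_j are defined for all j; the run is cut at the
   stopping time [sncg_stops] below. *)
Fixpoint sncg_x (R : realType) (S : Type) (A : pca_algorithm R S)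
    (L1 L2 eps1 alpha eps2 delta' : R) (d m1 m2 : nat) (X : Type)
    (F : X -> 'cV[R]_d -> R) (x0 : 'cV[R]_d)
    (z1 : nat -> 'I_m1 -> X) (z2 : nat -> 'I_m2 -> X) (s : nat -> S)
    (j : nat) {struct j} : 'cV[R]_d :=
  if j is (_.+1 as i).+1 then
    let x := sncg_x A L1 L2 eps1 alpha eps2 delta' F x0 z1 z2 s i in
    (NCG_S A L1 L2 eps1 F (z1 i) (z2 i) (s i) x
       (sncg_accuracy alpha eps2 (sub_grad F (z1 i) x)) delta' eps2).1
  else x0.

Definition sncg_v (R : realType) (S : Type) (A : pca_algorithm R S)
    (L1 L2 eps1 alpha eps2 delta' : R) (d m1 m2 : nat) (X : Type)
    (F : X -> 'cV[R]_d -> R) (x0 : 'cV[R]_d)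
    (z1 : nat -> 'I_m1 -> X) (z2 : nat -> 'I_m2 -> X) (s : nat -> S)
    (j : nat) : 'cV[R]_d :=
  let x := sncg_x A L1 L2 eps1 alpha eps2 delta' F x0 z1 z2 s j in
  (NCG_S A L1 L2 eps1 F (z1 j) (z2 j) (s j) x
     (sncg_accuracy alpha eps2 (sub_grad F (z1 j) x)) delta' eps2).2.

Definition sncg_test (R : realType) (S : Type) (A : pca_algorithm R S)
    (L1 L2 eps1 alpha eps2 delta' : R) (d m1 m2 : nat) (X : Type)
    (F : X -> 'cV[R]_d -> R) (x0 : 'cV[R]_d)
    (z1 : nat -> 'I_m1 -> X) (z2 : nat -> 'I_m2 -> X) (s : nat -> S)
    (j : nat) : bool :=
  let x := sncg_x A L1 L2 eps1 alpha eps2 delta' F x0 z1 z2 s j in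
  let v := sncg_v A L1 L2 eps1 alpha eps2 delta' F x0 z1 z2 s j in
  (quadf (sub_hess F (z2 j) x) v > - (eps2 / 2)) &&
  (enorm (sub_grad F (z1 j) x) <= eps1).

(* j is the terminating iteration j_*. *)
Definition sncg_stops (R : realType) (S : Type) (A : pca_algorithm R S)
    (L1 L2 eps1 alpha eps2 delta' : R) (d m1 m2 : nat) (X : Type)
    (F : X -> 'cV[R]_d -> R) (x0 : 'cV[R]_d)
    (z1 : nat -> 'I_m1 -> X) (z2 : nat -> 'I_m2 -> X) (s : nat -> S)
    (j : nat) : Prop :=
  let test := sncg_test A L1 L2 eps1 alpha eps2 delta' F x0 z1 z2 s in
  [/\ (0 < j)%N, test j & forall i, (0 < i < j)%N -> ~~ test i].

(* Time of the first j iterations. An iteration computes m1 gradients, runs A,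
   and evaluates v^T H v with m2 Hessian-vector products. *)
Definition sncg_time (R : realType) (S : Type) (A : pca_algorithm R S)
    (tA : pca_runtime R S) (Tg Th : R)
    (L1 L2 eps1 alpha eps2 delta' : R) (d m1 m2 : nat) (X : Type)
    (F : X -> 'cV[R]_d -> R) (x0 : 'cV[R]_d)
    (z1 : nat -> 'I_m1 -> X) (z2 : nat -> 'I_m2 -> X) (s : nat -> S)
    (j : nat) : R :=
  \sum_(1 <= i < j.+1)
    let x := sncg_x A L1 L2 eps1 alpha eps2 delta' F x0 z1 z2 s i in
    m1%:R * Tg
    + tA Th d m2 (fun k => hess (F (z2 i k)) x)
        (sncg_accuracy alpha eps2 (sub_grad F (z1 i) x)) delta' (s i)
    + m2%:R * Th.

Definition sncg_rate (R : realType) (L1 L2 eps1 eps2 : R) : R :=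
  Num.max (48 * L2 ^+ 2 / eps2 ^+ 3) (8 * L1 / eps1 ^+ 2).

Definition size_S1 (R : realType) (G L2 eps1 eps2 delta' : R) : nat :=
  `|Num.ceil (Num.max (32 * G ^+ 2 / eps1 ^+ 2)
                      (2304 * G ^+ 2 * L2 ^+ 2 / eps2 ^+ 4)
              * (1 + 3 * ln (2 / delta') ^+ 2))|%N.

Definition size_S2 (R : realType) (L1 eps2 : R) (d : nat) (delta' : R) : nat :=
  `|Num.ceil (9216 * L1 ^+ 2 / eps2 ^+ 2 * ln (4 * d%:R / delta'))|%N.

Definition has_law (R : realType) (dO : measure_display)
    (Omega : measurableType dO) (P : probability Omega R) (T : Type)
    (events : set (set T)) (law : set T -> \bar R) (Y : Omega -> T) : Prop :=
  forall B, events B -> measurable (Y @^-1` B) /\ P (Y @^-1` B) = law B.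

Definition mutually_independent (R : realType) (dO : measure_display)
    (Omega : measurableType dO) (P : probability Omega R) (I : eqType)
    (E : I -> set (set Omega)) : Prop :=
  forall (J : seq I) (B : I -> set Omega), uniq J ->
    (forall i, i \in J -> E i (B i)) ->
    P (\big[setI/setT]_(i <- J) B i) = (\prod_(i <- J) P (B i))%E.

Definition draw_events (R : realType) (M : sampling_model R)
    (dS : measure_display) (S : measurableType dS) (Omega : Type)
    (m1 m2 : nat) (xi1 : nat -> 'I_m1 -> Omega -> sample M)
    (xi2 : nat -> 'I_m2 -> Omega -> sample M) (seed : nat -> Omega -> S)
    (i : (nat * 'I_m1 + nat * 'I_m2) + nat) : set (set Omega) :=
  match i with
  | inl (inl (j, k)) => preimage_set_system setT (xi1 j k) (@sample_events R M)
  | inl (inr (j, k)) => preimage_set_system setT (xi2 j k) (@sample_events R M)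
  | inr j => preimage_set_system setT (seed j) measurable
  end.

(* Sampling is i.i.d., hence with replacement in the finite-sum case. *)
Definition fresh_draws (R : realType) (M : sampling_model R)
    (dS : measure_display) (S : measurableType dS) (PS : probability S R)
    (dO : measure_display) (Omega : measurableType dO)
    (P : probability Omega R) (m1 m2 : nat)
    (xi1 : nat -> 'I_m1 -> Omega -> sample M)
    (xi2 : nat -> 'I_m2 -> Omega -> sample M)
    (seed : nat -> Omega -> S) : Prop :=
  [/\ forall j k, has_law P (@sample_events R M) (@sample_law R M) (xi1 j k),
      forall j k, has_law P (@sample_events R M) (@sample_law R M) (xi2 j k),
      forall j, has_law P measurable PS (seed j) &
      mutually_independent P (draw_events xi1 xi2 seed)].

(* Main.v *)
Require Import Defs.
From HB Require Import structures.
From mathcomp Require Import all_boot all_order all_algebra.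
From mathcomp Require Import all_classical all_reals all_analysis.
From mathcomp Require Import measurable_realfun.
From mathcomp Require Import ring lra zify.
Import Order.TTheory GRing.Theory Num.Theory.
Import numFieldNormedType.Exports.
Local Open Scope classical_set_scope.
Local Open Scope ring_scope.

Set Implicit Arguments.
Unset Strict Implicit.
Unset Printing Implicit Defensive.

(** Call the sampling of an iteration accurate if the sampled gradient is within
    [eps1 / sqrt 8] and [eps2 ^+ 2 / (24 * L2)] of the gradient of [f], and the
    quadratic form of the sampled Hessian within [eps2 / 24] of that of the
    Hessian of [f] on unit vectors. By the first- and second-order Taylor bounds
    the gradient step then decreases [f] by at least [gradient_gain], and the
    step along [v] by at least [curvature_gain], for any unit vector [v]. The
    algorithm takes the step with the larger guarantee, and one of the two is at
    least [1 / sncg_rate] when the termination test fails ([step_gain]). As [f]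
    cannot drop by more than [Delta], the test passes within
    [N = 1 + sncg_rate * Delta] iterations if they are all accurate
    ([run_stops_by]). If moreover the oracle succeeds where the test passes,
    that point has the required quality ([run_stop_quality]). Sampling fails
    with probability at most [delta' = delta / N] at each iteration, and so does
    the oracle; the union bound gives [delta], respectively [2 * delta].

    The failure probability of one iteration is computed by conditioning on the
    past: the current point is a function of earlier draws, and a fresh draw can
    be integrated with that point held fixed ([freezing]).

    - For the gradient ([vector_concentration]), the expectation of
      [cosh (l * |S|)] grows by a factor at most [1 + (l G)^2 (e - 1)] with each
      independent centred summand of [S]. The reason is that [cosh |s + y|] is
      convex in the inner product of [s] and [y] for fixed norms, hence lies
      below a chord whose linear part has mean zero ([cosh_add_le]).
    - For the Hessian ([matrix_concentration]), the trace of [S ^+ 2p] dominates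
      the [2p]-th power of the quadratic form in every direction. Its expectation
      satisfies the recursion of Gaussian moments, through a trace inequality
      for the increment of a power ([mxtrace_increment_le]); [p] is chosen close
      to the logarithm of [4 d / delta'].
    - For the oracle ([oracle_failure]), conditioning is on all draws but its
      seed.

    These events have to be measurable. The derivatives of the components are
    measurable in the sample and Lipschitz in the point, hence jointly measurable
    ([measurable_caratheodory]), and a lower bound on the smallest eigenvalue is
    a countable conjunction over rational test vectors ([quadf_ge_rational]).
    The expansions of [f] are the integrals of those of its components, whose
    remainders are uniform in the sample ([derive_expectation]). A finite sum is
    the expectation over the uniform law on a discrete space.

    The running time is at most [N] times the largest cost of an iteration;
    the logarithm of [1 / delta'] is bounded by the other logarithms
    ([ln_delta'_le]). *)

(** * Euclidean and spectral norms *)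

Section EuclideanSpace.
Context {R : realType} {d : nat}.
Implicit Types (u v w : 'cV[R]_d) (A H : 'M[R]_d) (a : R).

Lemma dotvE u v : dotv u v = \sum_i u i 0 * v i 0.
Proof. by rewrite /dotv mxE; apply: eq_bigr => i _; rewrite mxE. Qed.

Lemma dotvC u v : dotv u v = dotv v u.
Proof. by rewrite !dotvE; apply: eq_bigr => i _; rewrite mulrC. Qed.

Lemma dotvDr u v w : dotv u (v + w) = dotv u v + dotv u w.
Proof. by rewrite /dotv mulmxDr mxE. Qed.

Lemma dotvDl u v w : dotv (u + v) w = dotv u w + dotv v w.
Proof. by rewrite dotvC dotvDr !(dotvC w). Qed.

Lemma dotvZr u a v : dotv u (a *: v) = a * dotv u v.
Proof. by rewrite /dotv -scalemxAr mxE. Qed.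

Lemma dotvZl u a v : dotv (a *: u) v = a * dotv u v.
Proof. by rewrite dotvC dotvZr dotvC. Qed.

Lemma dotvNr u v : dotv u (- v) = - dotv u v.
Proof. by rewrite -scaleN1r dotvZr mulN1r. Qed.

Lemma dotvNl u v : dotv (- u) v = - dotv u v.
Proof. by rewrite dotvC dotvNr dotvC. Qed.

Lemma dotvBr u v w : dotv u (v - w) = dotv u v - dotv u w.
Proof. by rewrite dotvDr dotvNr. Qed.

Lemma dotvBl u v w : dotv (u - v) w = dotv u w - dotv v w.
Proof. by rewrite dotvDl dotvNl. Qed.

Lemma dotv0r u : dotv u 0 = 0.
Proof. by rewrite -(scale0r u) dotvZr mul0r. Qed.

Lemma dotv_delta u (i : 'I_d) : dotv (delta_mx i 0) u = u i 0.
Proof.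
rewrite dotvE (bigD1 i) //= big1 ?addr0 ?mxE ?eqxx ?mul1r// => j ji.
by rewrite !mxE (negbTE ji) mul0r.
Qed.

Lemma dotv_mulmx u v A : dotv u (A *m v) = dotv (A^T *m u) v.
Proof. by rewrite /dotv trmx_mul trmxK mulmxA. Qed.

Lemma dotvv_ge0 u : 0 <= dotv u u.
Proof. by rewrite dotvE sumr_ge0// => i _; rewrite -expr2 sqr_ge0. Qed.

Lemma enorm_ge0 u : 0 <= enorm u.
Proof. exact: sqrtr_ge0. Qed.

Lemma enorm_sqr u : enorm u ^+ 2 = dotv u u.
Proof. by rewrite sqr_sqrtr ?dotvv_ge0. Qed.

Lemma dotvv_eq0 u : (dotv u u == 0) = (u == 0).
Proof.
apply/eqP/eqP => [|->]; last by rewrite dotv0r.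
rewrite dotvE => /eqP; rewrite psumr_eq0 => [/allP u0|i _]; last first.
  by rewrite -expr2 sqr_ge0.
apply/colP => i; rewrite mxE.
by have := u0 i (mem_index_enum _); rewrite -expr2 sqrf_eq0 => /eqP.
Qed.

Lemma enorm_eq0 u : (enorm u == 0) = (u == 0).
Proof. by rewrite -dotvv_eq0 -enorm_sqr sqrf_eq0. Qed.

Lemma enorm0 : enorm (0 : 'cV[R]_d) = 0.
Proof. by apply/eqP; rewrite enorm_eq0. Qed.

Lemma enormZ a u : enorm (a *: u) = `|a| * enorm u.
Proof.
apply/eqP; rewrite -(@eqrXn2 _ 2)// ?mulr_ge0 ?enorm_ge0//.
by rewrite exprMn !enorm_sqr dotvZl dotvZr real_normK ?num_real// expr2 mulrA.
Qed.

Lemma enormN u : enorm (- u) = enorm u.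
Proof. by rewrite -scaleN1r enormZ normrN1 mul1r. Qed.

Lemma enormB u v : enorm (u - v) = enorm (v - u).
Proof. by rewrite -enormN opprB. Qed.

Lemma cauchy_schwarz u v : `|dotv u v| <= enorm u * enorm v.
Proof.
rewrite -(@ler_pXn2r _ 2) ?nnegrE ?mulr_ge0 ?enorm_ge0//.
rewrite exprMn !enorm_sqr real_normK ?num_real//.
have := dotvv_ge0 (dotv v v *: u - dotv u v *: v).
rewrite !(dotvBl, dotvBr, dotvZl, dotvZr) (dotvC v u).
set a := dotv u u; set b := dotv v v; set c := dotv u v.
have [b0|b_neq0] := eqVneq b 0.
  have /eqP v0 : v == 0 by rewrite -dotvv_eq0; apply/eqP.
  by rewrite /c v0 dotv0r expr0n/= mulr_ge0 ?dotvv_ge0.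
have b_gt0 : 0 < b by rewrite lt_neqAle eq_sym b_neq0 dotvv_ge0.
rewrite (_ : _ - _ = b * (a * b - c ^+ 2)); last by ring.
by rewrite pmulr_rge0// subr_ge0.
Qed.

Lemma dotv_le u v : dotv u v <= enorm u * enorm v.
Proof. exact: le_trans (ler_norm _) (cauchy_schwarz _ _). Qed.

Lemma ler_enormD u v : enorm (u + v) <= enorm u + enorm v.
Proof.
rewrite -(@ler_pXn2r _ 2) ?nnegrE ?addr_ge0 ?enorm_ge0//.
rewrite sqrrD !enorm_sqr !(dotvDl, dotvDr) (dotvC v u).
have := dotv_le u v; lra.
Qed.

Lemma ler_enorm_sum (I : Type) (r : seq I) (P : pred I) (F : I -> 'cV[R]_d) :
  enorm (\sum_(i <- r | P i) F i) <= \sum_(i <- r | P i) enorm (F i).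
Proof.
elim/big_rec2 : _ => [|i y x _ le]; first by rewrite enorm0.
by apply: le_trans (ler_enormD _ _) _; rewrite lerD2l.
Qed.

Lemma enorm_delta (i : 'I_d) : enorm (delta_mx i 0 : 'cV[R]_d) = 1.
Proof. by rewrite /enorm dotv_delta mxE !eqxx sqrtr1. Qed.

Lemma coord_le_enorm u i : `|u i 0| <= enorm u.
Proof.
by rewrite -dotv_delta (le_trans (cauchy_schwarz _ _))// enorm_delta mul1r.
Qed.

Lemma enorm_le_sum u : enorm u <= \sum_i `|u i 0|.
Proof.
rewrite {1}(matrix_sum_delta u).
apply: le_trans (ler_enorm_sum _ _ _) _; apply: ler_sum => i _.
by rewrite big_ord1 enormZ enorm_delta mulr1.
Qed.

Lemma enorm_le_of_dotv u a :
  (forall v, enorm v = 1 -> dotv u v <= a) -> 0 <= a -> enorm u <= a.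
Proof.
move=> ua a0; have [->|u0] := eqVneq u 0; first by rewrite enorm0.
have nu : enorm u != 0 by rewrite enorm_eq0.
have := ua ((enorm u)^-1 *: u).
rewrite enormZ ger0_norm ?invr_ge0 ?enorm_ge0// mulVf// => /(_ erefl).
by rewrite dotvZr -enorm_sqr expr2 mulrA mulVf// mul1r.
Qed.

Lemma unit_vector_exists : (0 < d)%N -> exists v, enorm v = 1.
Proof. by move=> d0; exists (delta_mx (Ordinal d0) 0); rewrite enorm_delta. Qed.

Lemma normalize u : u != 0 ->
  exists2 v, enorm v = 1 & u = enorm u *: v.
Proof.
move=> u0; have nu : enorm u != 0 by rewrite enorm_eq0.
exists ((enorm u)^-1 *: u); last by rewrite scalerA mulfV// scale1r.
by rewrite enormZ ger0_norm ?invr_ge0 ?enorm_ge0// mulVf.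
Qed.

(** The Frobenius norm squared, used as a finite a priori bound on operator
    norms and as the inner product square in the trace moment method. *)
Definition frob A : R := \sum_i \sum_j A i j ^+ 2.

Lemma frob_ge0 A : 0 <= frob A.
Proof. by apply: sumr_ge0 => i _; apply: sumr_ge0 => j _; exact: sqr_ge0. Qed.

Lemma dotv_mulmx_frob A v : dotv (A *m v) (A *m v) <= frob A * dotv v v.
Proof.
rewrite dotvE /frob big_distrl /=; apply: ler_sum => i _.
have -> : (A *m v) i 0 = dotv (row i A)^T v.
  by rewrite dotvE mxE; apply: eq_bigr => j _; rewrite !mxE.
rewrite -expr2.
have -> : \sum_j A i j ^+ 2 = dotv (row i A)^T (row i A)^T.
  by rewrite dotvE; apply: eq_bigr => j _; rewrite !mxE expr2.
rewrite -!enorm_sqr -exprMn -real_normK ?num_real// ler_pXn2r ?nnegrE//.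
  exact: cauchy_schwarz.
by rewrite mulr_ge0 ?enorm_ge0.
Qed.

Lemma enorm_mulmx_frob A v : enorm (A *m v) <= Num.sqrt (frob A) * enorm v.
Proof. by rewrite /enorm -sqrtrM ?frob_ge0// ler_wsqrtr// dotv_mulmx_frob. Qed.

Lemma enorm_mulmx_le H v : enorm (H *m v) <= spectral_norm H * enorm v.
Proof.
have [->|/normalize[u u1 ->]] := eqVneq v 0.
  by rewrite mulmx0 enorm0 mulr0.
rewrite -scalemxAr !enormZ u1 mulr1 mulrC ler_wpM2r ?normr_ge0//.
apply: sup_ubound; last by exists u.
exists (Num.sqrt (frob H)) => _ [w /= w1 <-].
by rewrite (le_trans (enorm_mulmx_frob _ _))// w1 mulr1.
Qed.

Lemma spectral_norm_le H a : 0 <= a ->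
  (forall v, enorm v = 1 -> enorm (H *m v) <= a) -> spectral_norm H <= a.
Proof.
move=> a0 Ha; rewrite /spectral_norm; set X := [set _ | _ in _].
have [X0|/set0P X0] := eqVneq X set0; first by rewrite X0 sup0.
by apply: ge_sup => // _ [v /= v1 <-]; exact: Ha.
Qed.

Lemma coord_le_spectral_norm H i j : `|H i j| <= spectral_norm H.
Proof.
have -> : H i j = (H *m (delta_mx j 0 : 'cV_d)) i 0.
  by rewrite -colE mxE.
by rewrite (le_trans (coord_le_enorm _ _))// (le_trans (enorm_mulmx_le _ _))//
   enorm_delta mulr1.
Qed.

Lemma quadfZ H a v : quadf H (a *: v) = a ^+ 2 * quadf H v.
Proof. by rewrite /quadf -scalemxAr dotvZl dotvZr mulrA -expr2. Qed.

Lemma quadfBl H A v : quadf (H - A) v = quadf H v - quadf A v.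
Proof. by rewrite /quadf mulmxBl dotvBr. Qed.

End EuclideanSpace.

(** * Trace inequalities *)

Section TraceInequalities.
Context {R : realType}.

Lemma sum_even_odd (F : nat -> R) h :
  \sum_(q < h.*2.+1) F q = \sum_(a < h.+1) F a.*2 + \sum_(a < h) F a.*2.+1.
Proof.
elim: h => [|h IH]; first by rewrite double0 !big_ord_recl !big_ord0 /= !addr0.
rewrite doubleS 2!big_ord_recr /= IH [X in _ = X + _]big_ord_recr.
rewrite [X in _ = _ + X]big_ord_recr /= doubleS; ring.
Qed.

Lemma midconvex_end_le (e : nat -> R) h :
  (forall a, (0 < a < h)%N -> 2 * e a <= e a.-1 + e a.+1) ->
  forall a, (a <= h)%N -> e a + e (h - a)%N <= e 0%N + e h.
Proof.
move=> convex a ah.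
have slope i j : (i <= j)%N -> (j < h)%N -> e i.+1 - e i <= e j.+1 - e j.
  elim: j => [|j IH]; first by rewrite leqn0 => /eqP->.
  rewrite leq_eqVlt => /predU1P[->//|]; rewrite ltnS => ij jh.
  apply: le_trans (IH ij (ltnW jh)) _.
  by have := convex j.+1 jh; rewrite /=; lra.
have tele (f : nat -> R) m : f m - f 0%N = \sum_(i < m) (f i.+1 - f i).
  elim: m => [|m IH]; first by rewrite big_ord0 subrr.
  by rewrite big_ord_recr /= -IH; ring.
have /(_ e a) ea := tele.
have /(_ (fun i => e (i + (h - a))%N) a) /= := tele.
rewrite subnKC// add0n => eh.
suff : e a - e 0%N <= e h - e (h - a)%N by lra.
rewrite ea eh; apply: ler_sum => i _; rewrite addSn; apply: slope.
  exact: leq_addr.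
by rewrite -{2}(subnKC ah) ltn_add2r.
Qed.

Lemma midconvex_sum_le (e : nat -> R) h :
  (forall a, (0 < a < h)%N -> 2 * e a <= e a.-1 + e a.+1) ->
  2 * \sum_(a < h.+1) e a <= h.+1%:R * (e 0%N + e h).
Proof.
move=> convex; rewrite mulr_natl mulr2n.
rewrite [X in _ + X](reindex_inj rev_ord_inj) /= -big_split /=.
apply: (@le_trans _ _ (\sum_(a < h.+1) (e 0%N + e h))); last first.
  by rewrite sumr_const card_ord mulr_natl.
apply: ler_sum => a _; rewrite subSS.
by apply: midconvex_end_le => //; rewrite -ltnS.
Qed.

Context {d : nat}.
Implicit Types (S T X U V A B : 'M[R]_d).

Lemma trmxX S n : (S ^+ n)^T = (S^T) ^+ n.
Proof.
elim: n => [|n IH]; first by rewrite !expr0 trmx1.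
by rewrite exprS -mulmxE trmx_mul IH mulmxE exprSr.
Qed.

Lemma mxtrace_mulrC A B : \tr (A * B) = \tr (B * A).
Proof. exact: mxtrace_mulC. Qed.

Lemma frob_col A : frob A = \sum_j dotv (col j A) (col j A).
Proof.
rewrite /frob exchange_big /=; apply: eq_bigr => j _.
by rewrite dotvE; apply: eq_bigr => i _; rewrite !mxE expr2.
Qed.

Lemma mxtrace_frob A : \tr (A^T * A) = frob A.
Proof.
rewrite /mxtrace /frob exchange_big /=; apply: eq_bigr => j _.
by rewrite mxE; apply: eq_bigr => i _; rewrite mxE expr2.
Qed.

Lemma mxtrace_amgm U V : 2 * \tr (U^T * V) <= \tr (U^T * U) + \tr (V^T * V).
Proof.
have := frob_ge0 (U - V).
rewrite -mxtrace_frob raddfB /= mulrBl !mulrBr !raddfB /=.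
have -> : \tr (V^T * U) = \tr (U^T * V).
  by rewrite -mxtrace_tr -mulmxE trmx_mul trmxK.
lra.
Qed.

Lemma mxtrace_sandwich_amgm S T X a a' b b' :
  S^T = S -> T^T = T -> X^T = X ->
  2 * \tr (X * S ^+ (a + a') * X * T ^+ (b + b')) <=
  \tr (X * S ^+ a.*2 * X * T ^+ b.*2) + \tr (X * S ^+ a'.*2 * X * T ^+ b'.*2).
Proof.
move=> ST TT XT.
have E i j k l : \tr ((S ^+ i * X * T ^+ j)^T * (S ^+ k * X * T ^+ l)) =
    \tr (X * S ^+ (i + k) * X * T ^+ (j + l)).
  have -> : (S ^+ i * X * T ^+ j)^T = T ^+ j * (X * S ^+ i).
    by rewrite -!mulmxE !trmx_mul !trmxX ST TT XT.
  by rewrite -mulrA mxtrace_mulrC (exprD S i k) (addnC j l) (exprD T l j) !mulrA.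
by have := mxtrace_amgm (S ^+ a * X * T ^+ b) (S ^+ a' * X * T ^+ b');
  rewrite !E !addnn.
Qed.

(** The noncommutative replacement of the scalar inequality
    [\sum_q s^q t^(2h-q) <= (2h+1)/2 (s^2h + t^2h)]. The even-indexed terms
    form a midpoint-convex sequence, and each odd-indexed term is at most the
    mean of its two neighbours; both facts are the arithmetic-geometric mean
    inequality for the trace. *)
Lemma mxtrace_sum_sandwich S T X h : S^T = S -> T^T = T -> X^T = X ->
  2 * \sum_(q < h.*2.+1) \tr (X * S ^+ q * X * T ^+ (h.*2 - q)) <=
  h.*2.+1%:R * (\tr (X * X * T ^+ h.*2) + \tr (X * S ^+ h.*2 * X)).
Proof.
move=> ST TT XT.
pose c q := \tr (X * S ^+ q * X * T ^+ (h.*2 - q)).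
pose e a := c a.*2.
have convex a : (0 < a < h)%N -> 2 * e a <= e a.-1 + e a.+1.
  case: a => // a /= ah.
  have := @mxtrace_sandwich_amgm S T X a a.+2 (h - a) (h - a.+2) ST TT XT.
  rewrite /e /c !doubleB.
  rewrite (_ : (a + a.+2 = a.+1.*2)%N); last by rewrite -addnn addnS addSn.
  rewrite (_ : (h - a + (h - a.+2) = h.*2 - a.+1.*2)%N) //; lia.
have odd_le a : (a < h)%N -> 2 * c a.*2.+1 <= e a + e a.+1.
  move=> ah.
  have := @mxtrace_sandwich_amgm S T X a a.+1 (h - a) (h - a.+1) ST TT XT.
  rewrite /e /c !doubleB.
  rewrite (_ : (a + a.+1 = a.*2.+1)%N); last by rewrite addnS addnn.
  rewrite (_ : (h - a + (h - a.+1) = h.*2 - a.*2.+1)%N) //; lia.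
have e0 : e 0%N = \tr (X * X * T ^+ h.*2).
  by rewrite /e /c double0 expr0 mulr1 subn0.
have eh : e h = \tr (X * S ^+ h.*2 * X) by rewrite /e /c subnn expr0 mulr1.
rewrite -e0 -eh -/(c _) (@sum_even_odd c).
have := midconvex_sum_le convex.
have : 2 * \sum_(a < h) c a.*2.+1 <= \sum_(a < h) (e a + e a.+1).
  by rewrite mulr_sumr; apply: ler_sum => a _; exact: odd_le.
rewrite big_split /=.
have := big_ord_recr h (fun a : 'I_h.+1 => e a) (op := +%R) (idx := 0).
have := big_ord_recl h (fun a : 'I_h.+1 => e a) (op := +%R) (idx := 0).
rewrite -/e (_ : \sum_(a < h.+1) c a.*2 = \sum_(a < h.+1) e a)//.
rewrite (_ : \sum_(i < h) e (lift ord0 i) = \sum_(i < h) e i.+1)//.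
rewrite (_ : \sum_(i < h) e (widen_ord _ i) = \sum_(i < h) e i)//= => -> E1.
have -> : h.*2.+1%:R = 2 * h%:R + 1 :> R by rewrite -addn1 natrD -mul2n natrM.
have -> : h.+1%:R = h%:R + 1 :> R by rewrite -addn1 natrD.
move: E1; set s1 := \sum_(i < h) e i; set s2 := \sum_(i < h) e i.+1; nra.
Qed.

Lemma subr_exprS S T n :
  S ^+ n.+1 - T ^+ n.+1 = \sum_(q < n.+1) S ^+ q * (S - T) * T ^+ (n - q).
Proof.
elim: n => [|n IH].
  by rewrite big_ord_recl big_ord0 !expr0 mul1r mulr1 addr0 !expr1.
rewrite big_ord_recr /= subnn expr0 mulr1.
under eq_bigr => i _ do rewrite subSn ?leq_ord// exprSr mulrA.
by rewrite -mulr_suml -IH mulrBl mulrBr -!exprSr addrC addrA subrK.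
Qed.

Lemma mxtrace_sandwich_ge S X K h : S^T = S -> X^T = X ->
  (forall v, enorm (X *m v) <= K * enorm v) ->
  \tr (X * S ^+ h.*2 * X) <= K ^+ 2 * \tr (S ^+ h.*2).
Proof.
move=> ST XT XK.
have -> : \tr (X * S ^+ h.*2 * X) = frob (X *m S ^+ h).
  rewrite -mxtrace_frob trmx_mul trmxX ST XT mulmxE -addnn exprD.
  by rewrite [RHS]mxtrace_mulrC !mulrA.
have -> : \tr (S ^+ h.*2) = frob (S ^+ h).
  by rewrite -mxtrace_frob trmxX ST -addnn exprD.
rewrite !frob_col mulr_sumr; apply: ler_sum => j _.
rewrite colE -mulmxA -colE -!enorm_sqr -exprMn ler_pXn2r ?nnegrE ?enorm_ge0//.
by rewrite (le_trans (enorm_ge0 _) (XK _)).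
Qed.

Lemma mxtrace_even_ge0 S h : S^T = S -> 0 <= \tr (S ^+ h.*2).
Proof.
move=> ST; rewrite -addnn exprD -{1}ST -trmxX mxtrace_frob; exact: frob_ge0.
Qed.

(** Applied with [S - T] the contribution of one independent summand, this is
    the only inequality behind the recursion on trace moments. *)
Lemma mxtrace_increment_le S T K h : S^T = S -> T^T = T ->
  (forall v, enorm ((S - T) *m v) <= K * enorm v) ->
  2 * (\tr ((S - T) * S ^+ h.*2.+1) - \tr ((S - T) * T ^+ h.*2.+1)) <=
  h.*2.+1%:R * (K ^+ 2 * (\tr (S ^+ h.*2) + \tr (T ^+ h.*2))).
Proof.
move=> ST TT XK; have XT : (S - T)^T = S - T by rewrite raddfB /= ST TT.
rewrite -raddfB /= -mulrBr subr_exprS.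
rewrite [(S - T) * _]mulr_sumr raddf_sum /=.
under eq_bigr => q _ do rewrite !mulrA.
apply: le_trans (mxtrace_sum_sandwich h ST TT XT) _.
rewrite ler_wpM2l ?ler0n// [leRHS]mulrDr [leLHS]addrC lerD//; first exact: mxtrace_sandwich_ge.
have -> : \tr ((S - T) * (S - T) * T ^+ h.*2) =
    \tr ((S - T) * T ^+ h.*2 * (S - T)) by rewrite [RHS]mxtrace_mulrC mulrA.
exact: mxtrace_sandwich_ge.
Qed.

(** The even moments [|S^k v|^2 = v^T S^2k v] of a unit vector are log-convex,
    so that they dominate the powers of the first one. *)
Lemma quadf_pow_le_mxtrace S v p : S^T = S -> enorm v = 1 ->
  quadf S v ^+ p.*2 <= \tr (S ^+ p.*2).
Proof.
move=> ST v1; pose m k := dotv (S ^+ k *m v) (S ^+ k *m v).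
have m_ge0 k : 0 <= m k by exact: dotvv_ge0.
have m0 : m 0%N = 1.
  by rewrite /m expr0 mul1mx -enorm_sqr v1 expr1n.
have shift k : S ^+ k.+1 *m v = S *m (S ^+ k *m v).
  by rewrite exprS -mulmxE mulmxA.
have logconvex k : m k.+1 ^+ 2 <= m k * m k.+2.
  have -> : m k.+1 = dotv (S ^+ k *m v) (S ^+ k.+2 *m v).
    by rewrite /m !shift [RHS]dotv_mulmx ST.
  rewrite /m -!enorm_sqr -exprMn -real_normK ?num_real// ler_pXn2r ?nnegrE//.
    exact: cauchy_schwarz.
  by rewrite mulr_ge0 ?enorm_ge0.
have growth k : m 1%N * m k <= m k.+1.
  elim: k => [|k IH]; first by rewrite m0 mulr1.
  have [mk0|mk0] := eqVneq (m k) 0.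
    have := logconvex k; rewrite mk0 mul0r => le0.
    have /eqP : m k.+1 ^+ 2 = 0 by apply/le_anti; rewrite le0 sqr_ge0.
    by rewrite sqrf_eq0 => /eqP ->; rewrite mulr0.
  have mk : 0 < m k by rewrite lt_neqAle eq_sym mk0 m_ge0.
  rewrite -(ler_pM2l mk); apply: le_trans (logconvex k).
  by rewrite expr2 mulrA ler_wpM2r// mulrC.
have power k : m 1%N ^+ k <= m k.
  elim: k => [|k IH]; first by rewrite m0.
  by rewrite exprS; apply: le_trans (growth k); rewrite ler_wpM2l.
have -> : \tr (S ^+ p.*2) = frob (S ^+ p).
  by rewrite -mxtrace_frob trmxX ST -addnn exprD.
rewrite -mul2n exprM; apply: (@le_trans _ _ (m 1%N ^+ p)).
  apply: lerXn2r; rewrite ?nnegrE ?sqr_ge0//.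
  rewrite /quadf /m expr1 -real_normK ?num_real// -enorm_sqr.
  rewrite ler_pXn2r ?nnegrE ?enorm_ge0//.
  by rewrite (le_trans (cauchy_schwarz _ _))// v1 mul1r.
apply: le_trans (power p) _; apply: le_trans (dotv_mulmx_frob _ _) _.
by rewrite -enorm_sqr v1 expr1n mulr1.
Qed.

End TraceInequalities.

(** * Taylor expansions and symmetry of the Hessian *)

Section Taylor.
Context {R : realType}.

Lemma increment_le (f g f' g' : R -> R) (b : R) : 0 <= b ->
  (forall t : R, is_derive t 1 f (f' t)) -> (forall t : R, is_derive t 1 g (g' t)) ->
  (forall t, 0 <= t <= b -> f' t <= g' t) -> f b - f 0 <= g b - g 0.
Proof.
move=> b0 df dg le.
have dgf (t : R) : is_derive t 1 (g - f) (g' t - f' t) by exact: is_deriveB.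
have [|c /[!in_itv]/= cb E] := MVT_segment b0 (fun t _ => dgf t).
  apply: derivable_within_continuous => t _; exact: ex_derive.
have : 0 <= (g - f) b - (g - f) 0.
  by rewrite E mulr_ge0 ?subr0// subr_ge0 le.
by rewrite !fctE; lra.
Qed.

Lemma taylor_lipschitz1 (f f' : R -> R) (K : R) :
  (forall t : R, is_derive t 1 f (f' t)) ->
  (forall t, 0 <= t <= 1 -> `|f' t - f' 0| <= K * t) ->
  `|f 1 - f 0 - f' 0| <= K / 2.
Proof.
move=> df lip.
have dq (s t : R) : is_derive t 1 (fun t => f' 0 * t + s * (K / 2 * t ^+ 2))
    (f' 0 + s * (K * t)).
  apply: is_derive_eq; rewrite /GRing.scale /=; lra.
rewrite ler_norml; apply/andP; split.
  have := increment_le ler01 (dq (-1)) df.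
  rewrite expr0n expr1n /= => le.
  suff /le : forall t, 0 <= t <= 1 -> f' 0 + -1 * (K * t) <= f' t by lra.
  by move=> t /lip; rewrite ler_norml; lra.
have := increment_le ler01 df (dq 1).
rewrite expr0n expr1n /= => le.
suff /le : forall t, 0 <= t <= 1 -> f' t <= f' 0 + 1 * (K * t) by lra.
by move=> t /lip; rewrite ler_norml; lra.
Qed.

Lemma taylor_lipschitz2 (f f' f'' : R -> R) (K : R) :
  (forall t : R, is_derive t 1 f (f' t)) -> (forall t : R, is_derive t 1 f' (f'' t)) ->
  (forall t, 0 <= t <= 1 -> `|f'' t - f'' 0| <= K * t) ->
  `|f 1 - f 0 - f' 0 - f'' 0 / 2| <= K / 6.
Proof.
move=> df df' lip.
have dq (s t : R) : is_derive t 1 (fun t => f'' 0 * t + s * (K / 2 * t ^+ 2))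
    (f'' 0 + s * (K * t)).
  apply: is_derive_eq; rewrite /GRing.scale /=; lra.
have dc (s t : R) : is_derive t 1
    (fun t => f' 0 * t + f'' 0 / 2 * t ^+ 2 + s * (K / 6 * t ^+ 3))
    (f' 0 + (f'' 0 * t + s * (K / 2 * t ^+ 2))).
  apply: is_derive_eq; rewrite /GRing.scale /=; lra.
have up t : 0 <= t <= 1 -> f' t - f' 0 <= f'' 0 * t + 1 * (K / 2 * t ^+ 2).
  move=> /andP[t0 t1]; have := increment_le t0 df' (dq 1).
  rewrite mulr0 expr0n/= !mulr0 addr0 subr0; apply=> s /andP[s0 st].
  have /lip : 0 <= s <= 1 by rewrite s0 (le_trans st).
  by rewrite ler_norml; lra.
have lo t : 0 <= t <= 1 -> f'' 0 * t + -1 * (K / 2 * t ^+ 2) <= f' t - f' 0.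
  move=> /andP[t0 t1]; have := increment_le t0 (dq (-1)) df'.
  rewrite mulr0 expr0n/= !mulr0 addr0 subr0; apply=> s /andP[s0 st].
  have /lip : 0 <= s <= 1 by rewrite s0 (le_trans st).
  by rewrite ler_norml; lra.
rewrite ler_norml; apply/andP; split.
  have := increment_le ler01 (dc (-1)) df.
  rewrite !expr0n !expr1n /= => le.
  suff /le : forall t, 0 <= t <= 1 ->
    f' 0 + (f'' 0 * t + -1 * (K / 2 * t ^+ 2)) <= f' t by lra.
  by move=> t /lo; lra.
have := increment_le ler01 df (dc 1).
rewrite !expr0n !expr1n /= => le.
suff /le : forall t, 0 <= t <= 1 ->
  f' t <= f' 0 + (f'' 0 * t + 1 * (K / 2 * t ^+ 2)) by lra.
by move=> t /up; lra.
Qed.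

Lemma second_difference_bound (K t q1 q2 g1 g2 m h1 h2 h3 h4 : R) :
  0 < t -> 0 <= K ->
  `|h1 - h2 - t * g1 - t ^+ 2 * q1 / 2| <= K / 6 * t ^+ 3 ->
  `|h3 - h4 - t * g2 - t ^+ 2 * q2 / 2| <= K / 6 * t ^+ 3 ->
  `|g1 - g2 - t * m| <= K / 2 * t ^+ 2 -> `|q1 - q2| <= K * t ->
  `|(h1 - h2 - h3 + h4) - t ^+ 2 * m| <= 2 * K * t ^+ 3.
Proof.
move=> t0 K0; rewrite !ler_norml.
move=> /andP[a1 a2] /andP[b1 b2] /andP[c1 c2] /andP[d1 d2].
have t2 : 0 <= t ^+ 2 by rewrite sqr_ge0.
have L3 : 0 <= K * t ^+ 3 by rewrite mulr_ge0// exprn_ge0// ltW.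
move: (ler_wpM2l (ltW t0) c1) (ler_wpM2l (ltW t0) c2).
move: (ler_wpM2l t2 d1) (ler_wpM2l t2 d2).
by clear c1 c2 d1 d2 => *; apply/andP; split; lra.
Qed.

Context {d : nat}.
Implicit Types (h : 'cV[R]_d -> R) (x y u v w : 'cV[R]_d).

Lemma is_derive_line (f : 'cV[R]_d -> R) x u (t : R) : derivable f (x + t *: u) u ->
  is_derive t 1 (fun s => f (x + s *: u)) ('D_u f (x + t *: u)).
Proof.
move=> df; have E : (fun s : R => s^-1 *:
      (((fun s => f (x + s *: u)) \o shift t) (s *: (1 : R^o)) - f (x + t *: u)))
    = (fun s => s^-1 *: ((f \o shift (x + t *: u)) (s *: u) - f (x + t *: u))).
  apply/funext => s /=; congr (_ *: (f _ - _)).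
  by rewrite (_ : s *: (1 : R^o) = s) ?[_ *: _]mulr1// scalerDl addrCA.
by apply: DeriveDef; rewrite /derivable /derive E.
Qed.

Lemma derive_dotv_partial h x u : differentiable h x ->
  'D_u h x = \sum_i u i 0 * 'D_(delta_mx i 0) h x.
Proof.
move=> dh; rewrite deriveE// {1}(matrix_sum_delta u) linear_sum.
apply: eq_bigr => i _.
by rewrite big_ord1 linearZ /= deriveE.
Qed.

Lemma derive_grad h x u : differentiable h x -> 'D_u h x = dotv (grad h x) u.
Proof.
move=> dh; rewrite derive_dotv_partial// dotvE.
by apply: eq_bigr => i _; rewrite mxE mulrC.
Qed.

Lemma differentiable_grad_coord h x i : differentiable (grad h) x ->
  differentiable (fun y => grad h y i 0) x.
Proof.
move=> dh; apply: (@differentiable_comp _ _ _ _ (grad h)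
  (fun M : 'cV[R]_d => M i 0)) => //; exact: differentiable_coord.
Qed.

Lemma derive_grad_coord h x u i : differentiable (grad h) x ->
  'D_u (fun y => grad h y i 0) x = (hess h x *m u) i 0.
Proof.
move=> /(@differentiable_grad_coord _ _ i) dh; rewrite derive_dotv_partial//.
by rewrite mxE; apply: eq_bigr => j _; rewrite mxE mulrC.
Qed.

Section SmoothComponent.
Context {L1 L2 : R} {h : 'cV[R]_d -> R}.
Hypothesis smooth : smooth_component L1 L2 h.
Hypotheses (L1_ge0 : 0 <= L1) (L2_ge0 : 0 <= L2).

Lemma smooth_line x u (t : R) :
  is_derive t 1 (fun s => h (x + s *: u)) (dotv (grad h (x + t *: u)) u).
Proof.
case: smooth => dh _ _ _; rewrite -derive_grad//.
by apply: is_derive_line; exact: diff_derivable.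
Qed.

Lemma smooth_grad_line x u w (t : R) :
  is_derive t 1 (fun s => dotv w (grad h (x + s *: u)))
    (dotv w (hess h (x + t *: u) *m u)).
Proof.
case: smooth => _ dg _ _; rewrite dotvE.
rewrite (_ : (fun s => _) =
    \sum_i (fun s => w i 0 * grad h (x + s *: u) i 0)); last first.
  by apply/funext => s; rewrite dotvE fct_sumE.
apply: is_derive_sum => i; rewrite -derive_grad_coord//.
apply: is_deriveZ; apply: (@is_derive_line (fun y => grad h y i 0)).
by apply: diff_derivable; exact: differentiable_grad_coord.
Qed.

Lemma smooth_hess_lip x y v :
  enorm ((hess h x - hess h y) *m v) <= L2 * enorm (x - y) * enorm v.
Proof.
case: smooth => _ _ _ lip; apply: le_trans (enorm_mulmx_le _ _) _.
by rewrite ler_wpM2r ?enorm_ge0.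
Qed.

Lemma smooth_taylor1 x u :
  `|h (x + u) - h x - dotv (grad h x) u| <= L1 / 2 * enorm u ^+ 2.
Proof.
have := @taylor_lipschitz1 _ _ (L1 * enorm u ^+ 2) (smooth_line x u).
rewrite scale1r scale0r addr0 mulrAC; apply=> t /andP[t0 t1].
rewrite -dotvBl; apply: le_trans (cauchy_schwarz _ _) _.
case: smooth => _ _ /(_ (x + t *: u) x) lip _.
apply: (@le_trans _ _ (L1 * enorm (t *: u) * enorm u)).
  by rewrite ler_wpM2r ?enorm_ge0//; move: lip; rewrite addrAC subrr add0r.
by rewrite enormZ ger0_norm// le_eqVlt; apply/orP; left; apply/eqP; ring.
Qed.

Lemma smooth_taylor_grad x u :
  enorm (grad h (x + u) - grad h x - hess h x *m u) <= L2 / 2 * enorm u ^+ 2.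
Proof.
apply: enorm_le_of_dotv => [w w1|]; last first.
  by rewrite mulr_ge0 ?sqr_ge0// divr_ge0.
rewrite dotvC !dotvBr; apply: le_trans (ler_norm _) _.
have := @taylor_lipschitz1 _ _ (L2 * enorm u ^+ 2) (smooth_grad_line x u w).
rewrite scale1r scale0r addr0 mulrAC; apply=> t /andP[t0 t1].
rewrite -dotvBr -mulmxBl; apply: le_trans (cauchy_schwarz _ _) _.
rewrite w1 mul1r; apply: le_trans (smooth_hess_lip _ _ _) _.
rewrite addrAC subrr add0r enormZ ger0_norm//.
by rewrite le_eqVlt; apply/orP; left; apply/eqP; ring.
Qed.

Lemma smooth_taylor2 x u :
  `|h (x + u) - h x - dotv (grad h x) u - quadf (hess h x) u / 2| <=
  L2 / 6 * enorm u ^+ 3.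
Proof.
have dl (t : R) : is_derive t 1 (fun s => dotv (grad h (x + s *: u)) u)
    (quadf (hess h (x + t *: u)) u).
  under eq_fun do rewrite dotvC; exact: smooth_grad_line.
have := @taylor_lipschitz2 _ _ _ (L2 * enorm u ^+ 3) (smooth_line x u) dl.
rewrite scale1r scale0r addr0 mulrAC; apply=> t /andP[t0 t1].
rewrite -quadfBl; apply: le_trans (cauchy_schwarz _ _) _.
apply: le_trans (ler_wpM2l (enorm_ge0 _) (smooth_hess_lip _ _ _)) _.
rewrite addrAC subrr add0r enormZ ger0_norm//.
by rewrite le_eqVlt; apply/orP; left; apply/eqP; ring.
Qed.

(** A Lipschitz gradient bounds the Hessian: compare [hess h x *m u] with the
    difference quotient of the gradient along [t *: u] and let [t] tend to 0. *)
Lemma smooth_hess_bound x u : enorm (hess h x *m u) <= L1 * enorm u.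
Proof.
apply/ler_addgt0Pl => e e0.
pose t := e / (1 + L2 * enorm u ^+ 2).
have D0 : 0 < 1 + L2 * enorm u ^+ 2.
  by rewrite ltr_pwDl// mulr_ge0 ?sqr_ge0.
have t0 : 0 < t by rewrite divr_gt0.
rewrite -(ler_pM2l t0) -{1}(gtr0_norm t0) -enormZ scalemxAr.
have := smooth_taylor_grad x (t *: u).
case: smooth => _ _ /(_ (x + t *: u) x) lip _.
move: lip; rewrite addrAC subrr add0r enormZ gtr0_norm// => lip tay.
have := ler_enormD (grad h (x + t *: u) - grad h x)
  (- (grad h (x + t *: u) - grad h x - hess h x *m (t *: u))).
rewrite enormN opprB addrCA subrr addr0 => le.
apply: le_trans le _; apply: le_trans (lerD lip tay) _.
have tD : t * (1 + L2 * enorm u ^+ 2) = e by rewrite /t divfK ?gt_eqF.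
clearbody t; rewrite -tD; have : 0 <= t ^+ 2 * (1 + L2 * enorm u ^+ 2 / 2).
  rewrite mulr_ge0 ?sqr_ge0// addr_ge0// divr_ge0// mulr_ge0 ?sqr_ge0//.
rewrite exprMn; lra.
Qed.

Lemma smooth_spectral_norm_hess x : spectral_norm (hess h x) <= L1.
Proof.
apply: spectral_norm_le => // v v1.
by have := smooth_hess_bound x v; rewrite v1 mulr1.
Qed.

Lemma smooth_hess_coord_lip x y i j :
  `|hess h x i j - hess h y i j| <= L2 * enorm (x - y).
Proof.
case: smooth => _ _ _ lip.
have := coord_le_spectral_norm (hess h x - hess h y) i j.
rewrite mxE [(- hess h y) i j]mxE => le.
exact: le_trans le (lip x y).
Qed.

Lemma smooth_grad_coord_lip x y i :
  `|grad h x i 0 - grad h y i 0| <= L1 * enorm (x - y).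
Proof.
case: smooth => _ _ lip _.
have := coord_le_enorm (grad h x - grad h y) i.
by rewrite [(_ - _ : 'cV_d) i 0]mxE [(- _ : 'cV_d) i 0]mxE => /le_trans; apply.
Qed.

(** Both mixed partial derivatives are the limit of the same symmetric second
    difference [h (x+te+te') - h (x+te) - h (x+te') + h x] over [t^2]; the
    Taylor remainders make its distance to each of them [O(t)]. *)
Lemma smooth_hess_sym x : (hess h x)^T = hess h x.
Proof.
apply/matrixP => i j; rewrite mxE; apply/eqP; rewrite -subr_eq0.
pose e1 : 'cV[R]_d := delta_mx i 0; pose e2 : 'cV[R]_d := delta_mx j 0.
have n1 : enorm e1 = 1 by exact: enorm_delta.
have n2 : enorm e2 = 1 by exact: enorm_delta.
have half (a b : 'cV[R]_d) t : enorm a = 1 -> enorm b = 1 -> 0 < t ->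
    `|(h (x + t *: a + t *: b) - h (x + t *: a) - h (x + t *: b) + h x)
      - t ^+ 2 * dotv b (hess h x *m a)| <= 2 * L2 * t ^+ 3.
  move=> a1 b1 t0.
  have tn (c : 'cV[R]_d) : enorm c = 1 -> enorm (t *: c) = t.
    by move=> c1; rewrite enormZ c1 mulr1 gtr0_norm.
  have T1 := smooth_taylor2 (x + t *: a) (t *: b).
  have T2 := smooth_taylor2 x (t *: b).
  rewrite (tn _ b1) in T1. rewrite (tn _ b1) in T2.
  rewrite quadfZ in T1. rewrite quadfZ in T2.
  rewrite dotvZr in T1. rewrite dotvZr in T2.
  have T3 : `|dotv b (grad h (x + t *: a)) - dotv b (grad h x)
              - t * dotv b (hess h x *m a)| <= L2 / 2 * t ^+ 2.
    rewrite -dotvZr scalemxAr -!dotvBr; apply: le_trans (cauchy_schwarz _ _) _.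
    by rewrite b1 mul1r -[X in _ * X ^+ 2](tn _ a1) smooth_taylor_grad.
  have T4 : `|quadf (hess h (x + t *: a)) b - quadf (hess h x) b| <= L2 * t.
    rewrite -quadfBl; apply: le_trans (cauchy_schwarz _ _) _.
    rewrite b1 mul1r; apply: le_trans (smooth_hess_lip _ _ _) _.
    by rewrite b1 mulr1 addrAC subrr add0r (tn _ a1).
  rewrite ![dotv (grad h _) b]dotvC in T1 T2.
  exact: second_difference_bound t0 L2_ge0 T1 T2 T3 T4.
apply/eqP/normr0_eq0/le_anti; rewrite normr_ge0 andbT.
apply/ler_addgt0Pl => e e0; rewrite addr0.
pose t := e / (1 + 4 * L2); have D0 : 0 < 1 + 4 * L2 by rewrite ltr_pwDl// mulr_ge0.
have t0 : 0 < t by rewrite divr_gt0.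
have tE : t * (1 + 4 * L2) = e by rewrite /t divfK ?gt_eqF.
clearbody t; have := half e1 e2 t n1 n2 t0; have := half e2 e1 t n2 n1 t0.
rewrite !dotv_delta -!colE ![col _ _ _ _]mxE.
rewrite (addrAC x (t *: e2)) => q1 q2.
have : t ^+ 2 * `|hess h x j i - hess h x i j| <= t ^+ 2 * (4 * L2 * t).
  rewrite -[X in X * _](ger0_norm (sqr_ge0 t)) -normrM.
  move: q1 q2; rewrite !ler_norml => /andP[u1 u2] /andP[v1 v2].
  apply/andP; split; lra.
rewrite ler_pM2l ?exprn_gt0// => /le_trans; apply.
rewrite -tE; have := ltW t0; lra.
Qed.

End SmoothComponent.

End Taylor.

(** * The smallest eigenvalue *)

Section SmallestEigenvalue.
Context {R : realType} {d : nat}.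
Implicit Types (H : 'M[R]_d) (u v w : 'cV[R]_d).

Lemma continuous_dotv (T : topologicalType) (f g : T -> 'cV[R]_d) :
  (forall i, continuous (fun t => f t i 0)) ->
  (forall i, continuous (fun t => g t i 0)) ->
  continuous (fun t => dotv (f t) (g t)).
Proof.
move=> cf cg; under eq_fun do rewrite dotvE.
apply: (continuous_big (op := +%R)) => [|i _]; first exact: add_continuous.
by move=> t; apply: cvgM; [exact: cf|exact: cg].
Qed.

Lemma continuous_mulmx_coord (T : topologicalType) H (g : T -> 'cV[R]_d) i :
  (forall i, continuous (fun t => g t i 0)) ->
  continuous (fun t => (H *m g t) i 0).
Proof.
move=> cg; under eq_fun do rewrite mxE.
apply: (continuous_big (op := +%R)) => [|j _]; first exact: add_continuous.
by move=> t; apply: cvgM; [exact: cvg_cst|exact: cg].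
Qed.

Lemma continuous_quadf (T : topologicalType) H (g : T -> 'cV[R]_d) :
  (forall i, continuous (fun t => g t i 0)) ->
  continuous (fun t => quadf H (g t)).
Proof.
by move=> cg; apply: continuous_dotv => // i; exact: continuous_mulmx_coord.
Qed.

Lemma quadf_minimizer H : (0 < d)%N ->
  exists2 u, enorm u = 1 & forall v, quadf H u * dotv v v <= quadf H v.
Proof.
move=> /(@unit_vector_exists R)[v0 v01].
pose A := [set v : 'rV[R]_d | dotv v^T v^T = 1].
have tr_cont i : continuous (fun t : 'rV[R]_d => t^T i 0).
  by under eq_fun do rewrite mxE; exact: coord_continuous.
have cA : compact A.
  apply: bounded_closed_compact.
    exists 1; split => // M M1 v /= v1.
    rewrite [leLHS]/Num.norm /= mx_normrE; apply: bigmax_le => [|[i j] _ /=].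
      by rewrite (le_trans _ (ltW M1)).
    have := coord_le_enorm v^T j; rewrite mxE ord1 /enorm v1 sqrtr1.
    by move/le_trans; apply; exact: ltW.
  rewrite (_ : A = (fun v : 'rV[R]_d => dotv v^T v^T) @^-1` [set 1])//.
  by apply: preimage_closed => //= v _; apply: continuous_dotv.
have A0 : A !=set0 by exists v0^T; rewrite /A /= trmxK -enorm_sqr v01 expr1n.
have [|c cA1 cmin] := @EVT_min_rV _ _ (fun v : 'rV_d => quadf H v^T) _ A0 cA.
  by apply: continuous_subspaceT; exact: continuous_quadf.
move: cA1; rewrite inE /A /= => c1.
exists c^T; first by rewrite /enorm c1 sqrtr1.
move=> v; have [->|/normalize[w w1 ->]] := eqVneq v 0.
  by rewrite dotv0r mulr0 /quadf mulmx0 dotv0r.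
rewrite quadfZ -enorm_sqr enormZ w1 mulr1 real_normK ?num_real// mulrC.
rewrite ler_wpM2l ?sqr_ge0//.
by have := cmin w^T; rewrite trmxK; apply; rewrite inE /A /= trmxK -enorm_sqr w1 expr1n.
Qed.

Lemma linear_term_eq0 (b c : R) :
  (forall t, 0 <= t * b + t ^+ 2 * c) -> b = 0.
Proof.
move=> ge0; apply/eqP; apply/negPn/negP => b0.
pose K := 1 + `|c|; have K0 : 0 < K by rewrite ltr_pwDl.
have := ge0 (- b / K).
have Kn0 : K != 0 by rewrite gt_eqF.
rewrite (_ : _ + _ = (b / K) ^+ 2 * (c - K)); last by field.
rewrite pmulr_rge0 ?exprn_even_gt0//; last by rewrite mulf_neq0// invr_eq0 gt_eqF.
by rewrite /K; have := ler_norm c; lra.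
Qed.

(** A minimizer of the Rayleigh quotient is a critical point, hence an
    eigenvector, and no eigenvalue can be smaller. *)
Lemma lambda_min_attained H : (0 < d)%N -> H^T = H ->
  [/\ exists2 u, enorm u = 1 & quadf H u = lambda_min H,
      eigenvalue H (lambda_min H) &
      forall v, lambda_min H * dotv v v <= quadf H v].
Proof.
move=> d0 HT; have [m m1 mmin] := quadf_minimizer H d0.
suff [ev <-] : eigenvalue H (quadf H m) /\ quadf H m = lambda_min H.
  by split=> //; exists m.
set l := quadf H m in mmin *.
have crit w : dotv w (H *m m - l *: m) = 0.
  apply: (mulfI (_ : 2 != 0 :> R)); first by rewrite pnatr_eq0.
  rewrite mulr0.
  apply: (@linear_term_eq0 _ (quadf H w - l * dotv w w)) => t.
  have E : quadf H (m + t *: w) =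
      l + 2 * t * dotv w (H *m m) + t ^+ 2 * quadf H w.
    rewrite /l /quadf mulmxDr -scalemxAr !(dotvDl, dotvDr, dotvZl, dotvZr).
    by rewrite (dotv_mulmx m w) HT (dotvC (H *m m)); ring.
  have := mmin (m + t *: w); rewrite E.
  rewrite !(dotvDl, dotvDr, dotvNr, dotvZl, dotvZr) -(enorm_sqr m) m1 expr1n.
  rewrite (dotvC m w); lra.
have Hm : H *m m = l *: m.
  by apply/eqP; rewrite -subr_eq0 -dotvv_eq0 crit.
have ev : eigenvalue H l.
  apply/eigenvalueP; exists m^T.
    by rewrite -{1}HT -trmx_mul Hm linearZ.
  by rewrite trmx_eq0 -enorm_eq0 m1 oner_eq0.
have lbl a : eigenvalue H a -> l <= a.
  move=> /eigenvalueP[v va v0].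
  have vT0 : 0 < dotv v^T v^T.
    by rewrite lt_neqAle dotvv_ge0 eq_sym dotvv_eq0 trmx_eq0 v0.
  have := mmin v^T; rewrite /quadf.
  by rewrite -{1}HT -trmx_mul va linearZ dotvZr ler_pM2r.
split=> //; apply/le_anti/andP; split; last by apply: ge_inf => //; exists l.
by apply: lb_le_inf => //; exists l.
Qed.

(** Rational test vectors turn a lower bound on [lambda_min] into countably many
    conditions, each of them measurable in the matrix. *)
Lemma quadf_ge_rational H c :
  (forall q : 'cV[rat]_d, c * dotv (map_mx ratr q) (map_mx ratr q) <=
     quadf H (map_mx ratr q)) ->
  forall u, c * dotv u u <= quadf H u.
Proof.
move=> rat_ge u; rewrite leNgt; apply/negP => lt.
pose g (v : 'cV[R]_d) := c * dotv v v - quadf H v.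
have cg : continuous g.
  have cc (i : 'I_d) : continuous (fun v : 'cV[R]_d => v i 0).
    exact: coord_continuous.
  have cd : continuous (fun v : 'cV[R]_d => c * dotv v v).
    move=> v; apply: (@continuousM _ _ (cst c) (fun v => dotv v v)).
      exact: cst_continuous.
    exact: continuous_dotv.
  have cq : continuous (fun v : 'cV[R]_d => quadf H v).
    exact: continuous_quadf.
  by move=> v; exact: (continuousB (cd v) (cq v)).
have : nbhs u [set v | 0 < g v].
  by have /cvgr_gt := cg u; apply; rewrite subr_gt0.
move=> /nbhs_ballP[e /= e0 ball_e].
have near_rat (x : R) : exists q : rat, `|x - ratr q| < e.
  have /rat_in_itvoo[q] : x < x + e by rewrite ltrDl.
  rewrite in_itv /= => /andP[xq qx]; exists q.
  by rewrite ltr_distlC; apply/andP; split; lra.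
pose q : 'cV[rat]_d := \col_i projT1 (cid (near_rat (u i 0))).
have /ball_e : ball u e (map_mx ratr q).
  split=> // i j; rewrite ord1 !mxE -ball_normE /=.
  exact: projT2 (cid (near_rat (u i 0))).
by rewrite /= /g subr_gt0 ltNge rat_ge.
Qed.

End SmallestEigenvalue.

(** * Measurability *)

Section VectorMeasurability.
Context {R : realType} {d : nat} {dT : measure_display} {T : measurableType dT}.
Implicit Types (X Y : T -> 'cV[R]_d) (H : T -> 'M[R]_d).

(** Coordinatewise, as in the measurability hypothesis on the oracle. *)
Definition measurable_vec X : Prop :=
  forall i, measurable_fun setT (fun t => X t i 0).

Definition measurable_mx H : Prop :=
  forall i j, measurable_fun setT (fun t => H t i j).

Lemma measurable_dotv X Y : measurable_vec X -> measurable_vec Y ->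
  measurable_fun setT (fun t => dotv (X t) (Y t)).
Proof.
move=> mX mY; under eq_fun do rewrite dotvE.
by apply: measurable_sum => i; apply: measurable_funM.
Qed.

Lemma measurable_vec_mulmx H X : measurable_mx H -> measurable_vec X ->
  measurable_vec (fun t => H t *m X t).
Proof.
move=> mH mX i; under eq_fun do rewrite mxE.
by apply: measurable_sum => j; apply: measurable_funM.
Qed.

Lemma measurable_quadf H X : measurable_mx H -> measurable_vec X ->
  measurable_fun setT (fun t => quadf (H t) (X t)).
Proof. by move=> mH mX; apply: measurable_dotv => //; exact: measurable_vec_mulmx. Qed.

Lemma measurable_enorm X : measurable_vec X ->
  measurable_fun setT (fun t => enorm (X t)).
Proof.
move=> mX; have ms : measurable_fun setT (@Num.sqrt R).
  by apply: continuous_measurable_fun; exact: sqrt_continuous.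
exact: (measurableT_comp ms (measurable_dotv mX mX)).
Qed.

Lemma measurable_vecZ (c : T -> R) X : measurable_fun setT c ->
  measurable_vec X -> measurable_vec (fun t => c t *: X t).
Proof.
move=> mc mX i; under eq_fun do rewrite mxE; exact: measurable_funM.
Qed.

Lemma measurable_vecB X Y : measurable_vec X -> measurable_vec Y ->
  measurable_vec (fun t => X t - Y t).
Proof.
move=> mX mY i; under eq_fun do rewrite !mxE; exact: measurable_funB.
Qed.

Lemma measurable_funT_preimage d' (U : measurableType d') (f : T -> U) B :
  measurable_fun setT f -> measurable B -> measurable (f @^-1` B).
Proof. by move=> mf mB; rewrite -[X in measurable X]setTI; exact: mf. Qed.

Lemma measurable_bool_set (b : T -> bool) :
  measurable_fun setT b -> measurable [set t | b t].
Proof. by move=> mb; have : measurable [set true] by []; exact: measurable_funT_preimage. Qed.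

Lemma measurable_le_set (f g : T -> R) :
  measurable_fun setT f -> measurable_fun setT g ->
  measurable [set t | f t <= g t].
Proof. by move=> mf mg; apply: measurable_bool_set; exact: measurable_fun_ler. Qed.

Lemma measurable_lt_set (f g : T -> R) :
  measurable_fun setT f -> measurable_fun setT g ->
  measurable [set t | f t < g t].
Proof. by move=> mf mg; apply: measurable_bool_set; exact: measurable_fun_ltr. Qed.

Lemma measurable_forall (U : countType) (Q : U -> T -> Prop) :
  (forall u, measurable [set t | Q u t]) -> measurable [set t | forall u, Q u t].
Proof.
move=> mQ; rewrite (_ : [set t | _] = ~` \bigcup_u ~` [set t | Q u t]).
  apply: measurableC; apply: countable_bigcupT_measurable => [|u]; last first.
    exact: measurableC.
  exact: countableP.
rewrite setC_bigcup; apply/seteqP; split => t /= Qt u; first by rewrite setCK => _; exact: Qt.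
by have := Qt u I; rewrite setCK.
Qed.

Lemma measurable_lambda_min_ge H (c : T -> R) : (0 < d)%N ->
  measurable_mx H -> (forall t, (H t)^T = H t) -> measurable_fun setT c ->
  measurable [set t | c t <= lambda_min (H t)].
Proof.
move=> d0 mH HT mc; pose vq (q : 'cV[rat]_d) : 'cV[R]_d := map_mx ratr q.
rewrite (_ : [set t | _] =
    [set t | forall q, c t * dotv (vq q) (vq q) <= quadf (H t) (vq q)]).
  apply: measurable_forall => q; apply: measurable_le_set.
    by apply: measurable_funM => //; exact: measurable_cst.
  by apply: measurable_quadf => // i; exact: measurable_cst.
apply/seteqP; split => t /= => [le q|le].
  have [_ _ /(_ (vq q))] := lambda_min_attained d0 (HT t).
  by apply: le_trans; rewrite ler_wpM2r ?dotvv_ge0.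
have [[u u1 <-] _ _] := lambda_min_attained d0 (HT t).
have := @quadf_ge_rational _ _ (H t) (c t) _ u.
rewrite -[dotv u u]enorm_sqr u1 expr1n mulr1; exact.
Qed.

End VectorMeasurability.

Section Caratheodory.
Context {R : realType} {d : nat} {dT dX : measure_display}.
Context {T : measurableType dT} {Xi : measurableType dX}.

Definition grid_floor (n : nat) (x : 'cV[R]_d) : 'cV[int]_d :=
  \col_i Num.floor (n.+1%:R * x i 0).

Definition grid_point (n : nat) (c : 'cV[int]_d) : 'cV[R]_d :=
  n.+1%:R^-1 *: map_mx intr c.

Lemma enorm_grid n x :
  enorm (grid_point n (grid_floor n x) - x) <= d%:R * n.+1%:R^-1.
Proof.
apply: le_trans (enorm_le_sum _) _.
rewrite -[X in X%:R]card_ord -sum1_card natr_sum mulr_suml.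
apply: ler_sum => i _; rewrite !mxE mul1r.
have n0 : 0 < n.+1%:R :> R by rewrite ltr0n.
have /andP[lo hi] := floor_itv (n.+1%:R * x i 0).
set y := Num.floor _ in lo hi *.
have -> : n.+1%:R^-1 * y%:~R - x i 0 = n.+1%:R^-1 * (y%:~R - n.+1%:R * x i 0).
  by rewrite mulrBr mulKf// gt_eqF.
rewrite normrM gtr0_norm ?invr_gt0// ler_piMr ?invr_ge0 ?(ltW n0)//.
by move: hi; rewrite intrD ler_norml => hi; apply/andP; split; lra.
Qed.

(** Joint measurability of a function that is measurable in the sample and
    Lipschitz in the point, along a measurable curve of samples and points:
    on the countably many grid points the point can be frozen, and the values
    at grid points converge. *)
Lemma measurable_caratheodory (phi : Xi -> 'cV[R]_d -> R) (K : R)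
    (z : T -> Xi) (X : T -> 'cV[R]_d) :
  (forall x, measurable_fun setT (phi ^~ x)) ->
  (forall i x y, `|phi i x - phi i y| <= K * enorm (x - y)) ->
  measurable_fun setT z -> measurable_vec X ->
  measurable_fun setT (fun t => phi (z t) (X t)).
Proof.
move=> mphi lip mz mX.
pose Xn n t := grid_point n (grid_floor n (X t)).
apply: (@measurable_fun_cvg _ _ _ _ (fun n t => phi (z t) (Xn n t))) => [n|t _].
  move=> _ B mB; rewrite setTI.
  rewrite (_ : _ @^-1` B = \bigcup_c ([set t | grid_floor n (X t) = c] `&`
      [set t | phi (z t) (grid_point n c) \in B])); last first.
    apply/seteqP; split => [t Bt|t [c _ [/= <-]]]; last by rewrite inE.
    by exists (grid_floor n (X t)) => //; split=> //=; rewrite inE.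
  apply: countable_bigcupT_measurable => [|c]; first exact: countableP.
  apply: measurableI.
    rewrite (_ : [set t | _] =
        [set t | forall i, Num.floor (n.+1%:R * X t i 0) = c i 0]); last first.
      apply/seteqP; split => [t /= <- i|t /= E]; first by rewrite mxE.
      by apply/colP => i; rewrite mxE E.
    apply: measurable_forall => i.
    rewrite (_ : [set t | _] = [set t | (c i 0)%:~R <= n.+1%:R * X t i 0] `&`
        [set t | n.+1%:R * X t i 0 < (c i 0 + 1)%:~R]); last first.
      apply/seteqP; split => t /=; last first.
        by move=> [le lt]; apply/eqP; rewrite floor_eq le lt.
      by move=> /eqP; rewrite floor_eq => /andP[].
    have mnX : measurable_fun setT (fun t => n.+1%:R * X t i 0).
      by apply: measurable_funM => //; exact: measurable_cst.
    by apply: measurableI; [apply: measurable_le_set|apply: measurable_lt_set].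
  rewrite (_ : [set t | _] = (phi ^~ (grid_point n c) \o z) @^-1` B); last first.
    by apply/seteqP; split => t /=; rewrite inE.
  by apply: measurable_funT_preimage => //; apply: measurableT_comp.
apply/cvgrPdist_le => e e0.
pose C := `|K| * d%:R; have C0 : 0 <= C by rewrite mulr_ge0.
near=> n.
apply: (@le_trans _ _ (C * n.+1%:R^-1)).
  apply: le_trans (lip _ _ _) _; rewrite enormB.
  apply: (@le_trans _ _ (`|K| * enorm (Xn n t - X t))).
    by rewrite ler_wpM2r ?enorm_ge0// ler_norm.
  by rewrite -mulrA ler_wpM2l// enorm_grid.
rewrite ler_pdivrMr ?ltr0n// -ler_pdivrMl//.
apply: le_trans (_ : n%:R <= _); last by rewrite ler_nat.
near: n; exact: nbhs_infty_ger.
Unshelve. all: by end_near. Qed.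

End Caratheodory.

(** * Independent draws and conditioning on the past *)

Lemma bigsetI_seqP (T : Type) (I : eqType) (s : seq I) (C : I -> set T) (w : T) :
  (\big[setI/setT]_(i <- s) C i) w <-> forall i, i \in s -> C i w.
Proof.
elim: s => [|j s IH]; first by rewrite big_nil.
rewrite big_cons; split=> [[Cj /IH Cs] i|Cs].
  by rewrite inE => /predU1P[->|/Cs].
by split; [apply: Cs; rewrite mem_head|apply/IH => i si; apply: Cs; rewrite inE si orbT].
Qed.

(** [E i] stands for the events that depend on the draw [i] only. It need not be
    a sigma-algebra: stability under intersection suffices to extend
    independence to the generated ones. *)
Definition independent_draws (R : realType) dO (Omega : measurableType dO)
    (P : probability Omega R) (I : eqType) (E : I -> set (set Omega)) : Prop :=
  [/\ mutually_independent P E, forall i, E i `<=` measurable,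
      forall i, E i setT & forall i, setI_closed (E i)].

Definition is_draw (R : realType) dO (Omega : measurableType dO)
    (P : probability Omega R) (I : eqType) (E : I -> set (set Omega)) d2
    (T2 : measurableType d2) (nu : probability T2 R) (i : I)
    (xi : Omega -> T2) : Prop :=
  [/\ measurable_fun setT xi,
      forall B, measurable B -> P (xi @^-1` B) = nu B &
      forall B, measurable B -> E i (xi @^-1` B)].

Section IndependentDraws.
Context {R : realType} {dO : measure_display} {Omega : measurableType dO}.
Context {P : probability Omega R} {I : eqType} {E : I -> set (set Omega)}.
Hypothesis sys : independent_draws P E.

Let indep : mutually_independent P E. Proof. by case: sys. Qed.
Let E_measurable i : E i `<=` measurable. Proof. by case: sys. Qed.
Let E_setT i : E i setT. Proof. by case: sys. Qed.
Let E_setI i : setI_closed (E i). Proof. by case: sys. Qed.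

(** An intersection-stable system generating the history of the draws in [J], on
    which the independence of a further draw is part of the hypothesis. *)
Definition cylinders (J : pred I) : set (set Omega) :=
  [set A | exists s B, [/\ uniq s, all J s, forall i, i \in s -> E i (B i) &
                          A = \big[setI/setT]_(i <- s) B i]].

Definition history (J : pred I) : Type := g_sigma_algebraType (cylinders J).

HB.instance Definition _ J := Measurable.on (history J).

Lemma cylinders_measurable J : cylinders J `<=` measurable.
Proof.
move=> _ [s [B [_ _ EB ->]]]; rewrite big_seq.
by apply: bigsetI_measurable => i /EB /E_measurable.
Qed.

Lemma history_measurable J (A : set Omega) :
  measurable (A : set (history J)) -> measurable A.
Proof.
move=> /(_ measurable); apply; split; first exact: sigma_algebra_measurable.
exact: cylinders_measurable.
Qed.

Definition to_history J (w : Omega) : history J := w.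

Lemma measurable_to_history J : measurable_fun setT (to_history J).
Proof. by move=> _ B mB; rewrite setTI; exact: (@history_measurable J). Qed.

Lemma measurable_fun_history J d' (U : measurableType d') (f : history J -> U) :
  measurable_fun setT f -> measurable_fun setT (f \o to_history J).
Proof. by move=> mf; exact: (measurableT_comp mf (@measurable_to_history J)). Qed.

Lemma cylinders_setI J : setI_closed (cylinders J).
Proof.
move=> _ _ [s [B [us Js EB ->]]] [t [C [ut Jt EC ->]]].
pose D i := (if i \in s then B i else setT) `&` (if i \in t then C i else setT).
exists (undup (s ++ t)), D; split.
- exact: undup_uniq.
- apply/allP => i; rewrite mem_undup mem_cat => /orP[]; [exact: (allP Js)|
    exact: (allP Jt)].
- by move=> i _; apply: E_setI; case: ifP => // /[dup] h; [move/EB|move/EC].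
- apply/seteqP; split => w.
    move=> [/bigsetI_seqP Bw /bigsetI_seqP Cw]; apply/bigsetI_seqP => i _.
    by split; case: ifP => // it; [exact: Bw|exact: Cw].
  move=> /bigsetI_seqP Dw; split; apply/bigsetI_seqP => i it.
    have : D i w by apply: Dw; rewrite mem_undup mem_cat it.
    by rewrite /D it => -[].
  have : D i w by apply: Dw; rewrite mem_undup mem_cat it orbT.
  by rewrite /D it => -[].
Qed.

Lemma cylinders_draw (J : pred I) i A : J i -> E i A -> cylinders J A.
Proof.
move=> Ji EA; exists [:: i], (fun=> A); split=> //=; rewrite ?andbT//.
  by move=> j; rewrite inE => /eqP ->.
by rewrite big_seq1.
Qed.

Lemma cylinders_indep (J : pred I) i A B : ~~ J i -> cylinders J A -> E i B ->
  P (A `&` B) = (P A * P B)%E.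
Proof.
move=> Ji [s [C [us Js EC ->]]] EB.
have is_ : i \notin s by apply/negP => /(allP Js); exact/negP.
pose D j := if j == i then B else C j.
have DC j : j \in s -> D j = C j.
  by move=> js; rewrite /D; case: eqP => // ji; rewrite -ji js in is_.
have Di : D i = B by rewrite /D eqxx.
have := @indep (i :: s) D.
rewrite /= is_ us !big_cons Di => /(_ isT) H.
have bigD : \big[setI/setT]_(j <- s) D j = \big[setI/setT]_(j <- s) C j.
  by apply: eq_big_seq => j /DC.
rewrite bigD in H; rewrite setIC H; last first.
  by move=> j; rewrite inE => /predU1P[->|js]; rewrite ?Di// DC//; exact: EC.
rewrite muleC; congr (_ * _)%E.
rewrite (indep us EC); apply: eq_big_seq => j /DC ->//.
Qed.

Section Freezing.
Context {d2 : measure_display} {T2 : measurableType d2}.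
Context {nu : probability T2 R} {xi : Omega -> T2} {J : pred I} {i : I}.
Hypothesis draw_xi : is_draw P E nu i xi.

Let xi_meas : measurable_fun setT xi. Proof. by case: draw_xi. Qed.
Let xi_law B : measurable B -> P (xi @^-1` B) = nu B.
Proof. by case: draw_xi => _ + _; apply. Qed.
Let xi_event B : measurable B -> E i (xi @^-1` B).
Proof. by case: draw_xi => _ _; apply. Qed.

Lemma measurable_draw : J i -> @measurable_fun _ _ (history J) _ setT xi.
Proof.
move=> Ji _ B mB; rewrite setTI; apply: sub_sigma_algebra.
by apply: (cylinders_draw Ji); exact: xi_event.
Qed.

Hypothesis J_i : ~~ J i.

Lemma history_indep (A : set (history J)) (B : set T2) :
  measurable A -> measurable B -> P (A `&` xi @^-1` B) = (P A * nu B)%E.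
Proof.
move=> mA mB; have mXB := measurable_funT_preimage xi_meas mB.
have nuB : nu B \is a fin_num by exact: fin_num_measure.
have c0 : 0 <= fine (nu B) by rewrite fine_ge0.
pose m1 : {measure set Omega -> \bar R} := mrestr P mXB.
pose m2 : {measure set Omega -> \bar R} := mscale (NngNum c0) P.
have m2E C : m2 C = (P C * nu B)%E by rewrite /m2 /= /mscale /= fineK// muleC.
rewrite -m2E -[LHS]/(m1 A).
apply: (g_sigma_algebra_measure_unique (cylinders J) _ (fun=> setT)) => //.
- exact: cylinders_measurable.
- by move=> _; exists [::], (fun=> setT); split=> //; rewrite big_nil.
- by rewrite bigcup_const.
- exact: cylinders_setI.
- move=> C cC; rewrite m2E /m1 /= /mrestr -xi_law//.
  by apply: (cylinders_indep J_i cC); exact: xi_event.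
- by move=> _; rewrite /m1 /= /mrestr setTI ltey_eq fin_num_measure.
Qed.

(** Conditioning on the history [J] freezes every [J]-measurable quantity while
    the draw [i] is integrated against its law: the joint law of the history
    and the draw is a product measure. *)
Lemma freezing (Phi : history J * T2 -> \bar R) :
  measurable_fun setT Phi -> (forall p, (0 <= Phi p)%E) ->
  (\int[P]_w Phi (to_history J w, xi w) =
   \int[P]_w \int[nu]_y Phi (to_history J w, y))%E.
Proof.
move=> mPhi Phi0.
pose h : {mfun Omega >-> history J} := mfun_Sub (mem_set (@measurable_to_history J)).
pose p w : history J * T2 := (to_history J w, xi w).
have mp : measurable_fun setT p.
  exact: (measurable_fun_pair (@measurable_to_history J) xi_meas).
pose p' : {mfun Omega >-> (history J * T2)%type} := mfun_Sub (mem_set mp).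
transitivity (\int[distribution P p']_z Phi z)%E.
  by rewrite ge0_integral_pushforward//= preimage_setT.
transitivity (\int[distribution P h \x nu]_z Phi z)%E.
  apply: eq_measure_integral => X mX _; apply/esym.
  apply: (@product_measure_unique _ _ _ _ _ (distribution P h) nu) => //.
  move=> A B mA mB.
  exact: history_indep.
rewrite fubini_tonelli1//.
rewrite ge0_integral_pushforward//=.
- exact: measurable_to_history.
- exact: measurable_fun_fubini_tonelli_F.
- by move=> z _; apply: integral_ge0.
Qed.

End Freezing.
End IndependentDraws.

(** * Numerical bounds and the hyperbolic cosine *)

Section HyperbolicCosine.
Context {R : realType}.
Implicit Types (a b c x y t u : R).

Definition cosh x : R := (expR x + expR (- x)) / 2.
Definition sinh x : R := (expR x - expR (- x)) / 2.

Lemma cosh_ge x : expR x / 2 <= cosh x.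
Proof. by rewrite /cosh; have := expR_ge0 (- x); lra. Qed.

Lemma cosh_gt0 x : 0 < cosh x.
Proof. by apply: lt_le_trans (cosh_ge x); rewrite divr_gt0 ?expR_gt0. Qed.

Lemma sinh_le_cosh x : sinh x <= cosh x.
Proof. by rewrite /sinh /cosh; have := expR_ge0 (- x); lra. Qed.

Lemma le_cosh x y : 0 <= x <= y -> cosh x <= cosh y.
Proof.
move=> /andP[x0 xy]; rewrite /cosh ler_pM2r ?invr_gt0// !expRN.
have ex : 1 <= expR x by rewrite -expR0 ler_expR.
have ey : expR x <= expR y by rewrite ler_expR.
have ex0 := expR_gt0 x; have ey0 := expR_gt0 y.
rewrite -subr_ge0.
have -> : expR y + (expR y)^-1 - (expR x + (expR x)^-1) =
    (expR y - expR x) * (1 - (expR x * expR y)^-1).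
  by field; rewrite !gt_eqF.
rewrite mulr_ge0 ?subr_ge0// invf_le1 ?mulr_gt0//.
by rewrite -[1]mulr1 ler_pM// (le_trans ex).
Qed.

Lemma sinh_ge x : 0 <= x -> x <= sinh x.
Proof.
move=> x0; have d2 (t : R) : is_derive t 1 (fun t : R => 2 * t) 2.
  by apply: is_derive_eq; rewrite /GRing.scale /= mulr1.
have ds (t : R) : is_derive t 1 (fun t : R => expR t - expR (- t)) (expR t + expR (- t)).
  by apply: is_derive_eq; rewrite /GRing.scale /=; lra.
have := increment_le x0 d2 ds; rewrite oppr0 subrr mulr0 !subr0 /sinh => le.
rewrite ler_pdivlMr// mulrC; apply: le => t _.
rewrite expRN; have e0 := expR_gt0 t.
rewrite -subr_ge0 (_ : _ - 2 = (expR t - 1) ^+ 2 / expR t).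
  by rewrite divr_ge0 ?sqr_ge0// ltW.
by field; rewrite gt_eqF.
Qed.

Lemma exprn_convex t x y k : 0 <= t <= 1 -> 0 <= x -> 0 <= y ->
  ((1 - t) * x + t * y) ^+ k <= (1 - t) * x ^+ k + t * y ^+ k.
Proof.
move=> /andP[t0 t1] x0 y0; have t1' : 0 <= 1 - t by rewrite subr_ge0.
elim: k => [|k IH]; first by rewrite !expr0 !mulr1 subrK.
rewrite exprS; apply: le_trans (ler_wpM2l _ IH) _.
  by rewrite addr_ge0 ?mulr_ge0.
rewrite -subr_ge0.
have -> : (1 - t) * x ^+ k.+1 + t * y ^+ k.+1 -
    ((1 - t) * x + t * y) * ((1 - t) * x ^+ k + t * y ^+ k) =
    t * (1 - t) * ((x - y) * (x ^+ k - y ^+ k)) by rewrite !exprS; ring.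
apply: mulr_ge0; first exact: mulr_ge0.
have [xy|/ltW yx] := leP x y; last by rewrite mulr_ge0 ?subr_ge0 ?lerXn2r.
by rewrite -mulrNN !opprB mulr_ge0 ?subr_ge0 ?lerXn2r.
Qed.

(** Partial sums of the power series of [cosh (sqrt u)], which has nonnegative
    coefficients; this is where its convexity in [u] comes from. *)
Definition cosh_sqrt_series u n : R := \sum_(k < n) u ^+ k / (k.*2)`!%:R.

Lemma cosh_series x : cosh_sqrt_series (x ^+ 2) @ \oo --> cosh x.
Proof.
have dbl : (fun n : nat => n.*2) @ \oo --> \oo.
  apply/cvgnyPge => A; near=> n.
  by rewrite -addnn (@leq_trans n) ?leq_addr//; near: n; exact: nbhs_infty_ge.
have E (z : R) : series (exp_coeff z) n.*2 @[n --> \oo] --> expR z.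
  apply: (cvg_comp (fun n => n.*2) (series (exp_coeff z)) dbl).
  exact: is_cvg_series_exp_coeff.
have -> : cosh_sqrt_series (x ^+ 2) =
    (fun n => (series (exp_coeff x) n.*2 + series (exp_coeff (- x)) n.*2) / 2).
  apply/funext => n; rewrite /cosh_sqrt_series /series /= !big_mkord.
  elim: n => [|n IH]; first by rewrite double0 !big_ord0 addr0 mul0r.
  rewrite big_ord_recr /= IH doubleS !big_ord_recr /= /exp_coeff /=.
  rewrite /exp_coeff /= ![_ ^+ _.*2.+1]exprS -!mul2n !exprM sqrrN; lra.
by apply: cvgM; [apply: cvgD; exact: E|exact: cvg_cst].
Unshelve. all: by end_near. Qed.

Lemma cosh_sqrt_convex t x y z : 0 <= t <= 1 ->
  x ^+ 2 = (1 - t) * y ^+ 2 + t * z ^+ 2 ->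
  cosh x <= (1 - t) * cosh y + t * cosh z.
Proof.
move=> t01 E; have /andP[t0 t1] := t01.
have cv : (fun n => (1 - t) * cosh_sqrt_series (y ^+ 2) n
                    + t * cosh_sqrt_series (z ^+ 2) n) @ \oo -->
    (1 - t) * cosh y + t * cosh z.
  by apply: cvgD; apply: cvgM; try exact: cosh_series; exact: cvg_cst.
apply: (ler_cvg_to (@cosh_series x) cv); apply: nearW => n.
rewrite /cosh_sqrt_series E !mulr_sumr -big_split /=; apply: ler_sum => k _.
rewrite [X in _ <= X + _]mulrA [X in _ <= _ + X]mulrA -[leRHS]mulrDl.
rewrite ler_pM2r ?invr_gt0 ?ltr0n ?fact_gt0//.
by apply: exprn_convex => //; exact: sqr_ge0.
Qed.

(** For fixed norms [a] and [b], [cosh |s + y|] is a convex function of the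
    inner product of [s] and [y], hence below the chord between the collinear
    cases. The linear part of the chord vanishes on average when [y] is a
    centred random vector. *)
Lemma cosh_add_le {d : nat} (s : 'cV[R]_d) : exists c, forall y : 'cV[R]_d,
  cosh (enorm (s + y)) <=
  cosh (enorm s) * (expR (enorm y) - enorm y) + c * dotv s y.
Proof.
set a := enorm s.
have sinh_sub b : 0 <= b -> cosh b + (sinh b - b) = expR b - b.
  by move=> _; rewrite /cosh /sinh; lra.
have [a0|a_neq0] := eqVneq a 0.
  exists 0 => y; have /eqP -> : s == 0 by rewrite -enorm_eq0 -/a a0.
  have b0 := enorm_ge0 y; rewrite add0r mul0r addr0 -(sinh_sub _ b0).
  rewrite a0 /cosh oppr0 expR0.
  by have := sinh_ge b0; rewrite /sinh; lra.
have a_gt0 : 0 < a by rewrite lt_neqAle eq_sym a_neq0 enorm_ge0.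
exists (sinh a / a) => y; set b := enorm y.
have b_ge0 : 0 <= b by exact: enorm_ge0.
have sb := sinh_ge b_ge0.
have sa : 0 <= sinh a by apply: le_trans (sinh_ge (ltW a_gt0)); exact: ltW.
have ca := sinh_le_cosh a.
have [b0|b_neq0] := eqVneq b 0.
  have /eqP -> : y == 0 by rewrite -enorm_eq0 -/b b0.
  by rewrite addr0 dotv0r mulr0 addr0 b0 expR0 subr0 mulr1.
have b_gt0 : 0 < b by rewrite lt_neqAle eq_sym b_neq0.
pose tau := dotv s y / (a * b).
have tauE : tau * (a * b) = dotv s y by rewrite divfK// gt_eqF// mulr_gt0.
have /andP[tl tu] : -1 <= tau <= 1.
  rewrite -ler_norml /tau normrM normfV ler_pdivrMr.
    by rewrite mul1r (ger0_norm (mulr_ge0 (ltW a_gt0) b_ge0)) cauchy_schwarz.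
  by rewrite normr_gt0 mulf_neq0.
have chord : cosh (enorm (s + y)) <=
    (1 - (1 + tau) / 2) * cosh (a - b) + (1 + tau) / 2 * cosh (a + b).
  apply: cosh_sqrt_convex; first by apply/andP; split; lra.
  rewrite enorm_sqr !(dotvDl, dotvDr) (dotvC y s) -!enorm_sqr -/a -/b -tauE.
  by field.
apply: le_trans chord _.
have -> : (1 - (1 + tau) / 2) * cosh (a - b) + (1 + tau) / 2 * cosh (a + b) =
    cosh a * cosh b + tau * sinh a * sinh b.
  rewrite /cosh /sinh opprB opprD !expRD. by field.
have -> : sinh a / a * dotv s y = sinh a * tau * b.
  by rewrite -tauE; field.
rewrite -(sinh_sub _ b_ge0) mulrDr -addrA lerD2l.
have : tau * sinh a * (sinh b - b) <= cosh a * (sinh b - b).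
  rewrite ler_wpM2r ?subr_ge0//; apply: le_trans ca.
  by rewrite ler_piMl.
lra.
Qed.

Lemma expR_scale_le t x : 0 <= t <= 1 -> 0 <= x ->
  expR (t * x) <= 1 - t + t * expR x.
Proof.
move=> /andP[t0 t1] x0.
have d1 (z : R) : is_derive z 1 (fun z : R => expR (t * z)) (t * expR (t * z)).
  by apply: is_derive_eq; rewrite /GRing.scale /=; lra.
have d2 (z : R) : is_derive z 1 (fun z : R => t * expR z) (t * expR z).
  by apply: is_derive_eq; rewrite /GRing.scale /=; lra.
have := increment_le x0 d1 d2; rewrite mulr0 expR0 => le.
suff : expR (t * x) - 1 <= t * expR x - t * 1 by lra.
apply: le => z /andP[z0 _]; rewrite ler_wpM2l// ler_expR.
by rewrite ler_piMl.
Qed.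

Lemma expR_scaled_remainder_le t x : 0 <= t <= 1 -> 0 <= x ->
  expR (t * x) - t * x <= 1 + t ^+ 2 * (expR x - 1).
Proof.
move=> t01 x0; have /andP[t0 t1] := t01.
have d1 (z : R) : is_derive z 1 (fun z : R => expR (t * z) - t * z)
    (t * (expR (t * z) - 1)).
  by apply: is_derive_eq; rewrite /GRing.scale /=; lra.
have d2 (z : R) : is_derive z 1 (fun z : R => t ^+ 2 * expR z) (t ^+ 2 * expR z).
  by apply: is_derive_eq; rewrite /GRing.scale /=; lra.
have := increment_le x0 d1 d2; rewrite mulr0 expR0 => le.
suff : expR (t * x) - t * x - (1 - 0) <= t ^+ 2 * expR x - t ^+ 2 * 1 by lra.
apply: le => z /andP[z0 _]; rewrite expr2 -mulrA ler_wpM2l//.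
have := expR_scale_le t01 z0; lra.
Qed.

Lemma expR_ge_quadratic x : 0 <= x -> 1 + x + x ^+ 2 / 2 <= expR x.
Proof.
move=> x0; have d1 (z : R) : is_derive z 1 (fun z : R => z + z ^+ 2 / 2) (1 + z).
  by apply: is_derive_eq; rewrite /GRing.scale /=; lra.
have := increment_le x0 d1 (fun z => is_derive_expR z).
rewrite expr0n expR0 /= => le.
suff : x + x ^+ 2 / 2 - (0 + 0 / 2) <= expR x - 1 by lra.
by apply: le => z _; exact: expR_ge1Dx.
Qed.

Lemma expRN_ge_cubic x : 0 <= x -> 1 - x + x ^+ 2 / 2 - x ^+ 3 / 6 <= expR (- x).
Proof.
have dN (z : R) : is_derive z 1 (fun z : R => - expR (- z)) (expR (- z)).
  by apply: is_derive_eq; rewrite /GRing.scale /=; lra.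
have d1 (z : R) : is_derive z 1 (fun z : R => z - z ^+ 2 / 2) (1 - z).
  by apply: is_derive_eq; rewrite /GRing.scale /=; lra.
have d2 (z : R) : is_derive z 1 (fun z : R => z - z ^+ 2 / 2 + z ^+ 3 / 6)
    (1 - z + z ^+ 2 / 2).
  by apply: is_derive_eq; rewrite /GRing.scale /=; lra.
have quadratic (z : R) : 0 <= z -> expR (- z) <= 1 - z + z ^+ 2 / 2.
  move=> z0; have := increment_le z0 d1 dN.
  rewrite expr0n oppr0 expR0 /= => le.
  suff : z - z ^+ 2 / 2 - (0 - 0 / 2) <= - expR (- z) - - 1 by lra.
  by apply: le => t _; exact: expR_ge1Dx.
move=> x0; have := increment_le x0 dN d2.
rewrite !expr0n oppr0 expR0 /= => le.
suff : - expR (- x) - - 1 <=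
    x - x ^+ 2 / 2 + x ^+ 3 / 6 - (0 - 0 / 2 + 0 / 6) by lra.
by apply: le => z /andP[z0 _]; exact: quadratic.
Qed.

Lemma ler_expn n x y : 0 <= x -> x <= y -> x ^+ n <= y ^+ n.
Proof. by move=> x0 xy; rewrite lerXn2r ?nnegrE// (le_trans x0). Qed.

(** Numerical bounds on exponentials are obtained from a Taylor bound at a
    small argument, squared repeatedly and rounded to small fractions. *)
Lemma expR_double_ge z a b : 0 <= a -> a <= expR z -> b <= a ^+ 2 ->
  b <= expR (2 * z).
Proof.
move=> a0 az ba; rewrite expRM_natl; apply: le_trans ba _; exact: ler_expn.
Qed.

Lemma expR1_le : expR 1 <= 109 / 40 :> R.
Proof.
have x0 : 0 <= 1 / 4 :> R by lra.
have q1 : 109 / 140 <= expR (- (1 / 4)) :> R.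
  by apply: le_trans (expRN_ge_cubic x0); rewrite !exprS expr0; lra.
have q2 : 20 / 33 <= expR (2 * - (1 / 4)) :> R.
  by apply: expR_double_ge q1 _; rewrite ?expr2; lra.
have q4 : 40 / 109 <= expR (2 * (2 * - (1 / 4))) :> R.
  by apply: expR_double_ge q2 _; rewrite ?expr2; lra.
have -> : expR 1 = (expR (- 1))^-1 :> R by rewrite expRN invrK.
rewrite -[leRHS]invrK.
rewrite lef_pV2 ?posrE ?expR_gt0 ?invr_gt0; last 2 first.
- by [].
- by lra.
have -> : (109 / 40)^-1 = 40 / 109 :> R by rewrite invf_div.
by apply: le_trans q4 _; rewrite ler_expR; lra.
Qed.

Lemma ln2_ge : 20 / 29 <= ln 2 :> R.
Proof.
have x0 : 0 <= 5 / 29 :> R by lra.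
have q1 : 53 / 63 <= expR (- (5 / 29)) :> R.
  by apply: le_trans (expRN_ge_cubic x0); rewrite !exprS expr0; lra.
have q2 : 29 / 41 <= expR (2 * - (5 / 29)) :> R.
  by apply: expR_double_ge q1 _; rewrite ?expr2; lra.
have q4 : 2^-1 <= expR (2 * (2 * - (5 / 29))) :> R.
  by apply: expR_double_ge q2 _; rewrite ?expr2; lra.
rewrite -ler_expR lnK; last by rewrite posrE.
have -> : expR (20 / 29) = (expR (- (20 / 29)))^-1 :> R by rewrite expRN invrK.
rewrite -[leRHS]invrK.
rewrite lef_pV2 ?posrE ?expR_gt0//.
by apply: le_trans q4 _; rewrite ler_expR; lra.
Qed.

Lemma ln2_le : ln 2 <= 7 / 10 :> R.
Proof.
have x0 : 0 <= 7 / 80 :> R by lra.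
have q1 : 12 / 11 <= expR (7 / 80) :> R.
  by apply: le_trans (expR_ge_quadratic x0); rewrite !exprS expr0; lra.
have q2 : 69 / 58 <= expR (2 * (7 / 80)) :> R.
  by apply: expR_double_ge q1 _; rewrite ?expr2; lra.
have q4 : 58 / 41 <= expR (2 * (2 * (7 / 80))) :> R.
  by apply: expR_double_ge q2 _; rewrite ?expr2; lra.
have q8 : 2 <= expR (2 * (2 * (2 * (7 / 80)))) :> R.
  by apply: expR_double_ge q4 _; rewrite ?expr2; lra.
rewrite -ler_expR lnK; last by rewrite posrE.
by apply: le_trans q8 _; rewrite ler_expR; lra.
Qed.

(** At [s = ln 2] the left-hand side is about 3.105 and the least admissible [rho]
    about 3.125: this margin dictates the accuracy of the bounds on [e] and
    [ln 2]. *)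
Lemma exponential_tail_margin (s rho : R) : ln 2 <= s -> 0 <= rho ->
  4 * (1 + 3 * s ^+ 2) <= rho ^+ 2 -> s + ln 2 + (expR 1 - 1) <= rho.
Proof.
move=> s_ge rho0 le; have l1 := ln2_ge; have l2 := ln2_le; have e := expR1_le.
have s0 : 20 / 29 <= s by lra.
apply: (@le_trans _ _ (s + 97 / 40)); first lra.
rewrite -(@ler_pXn2r _ 2) ?nnegrE//; last lra.
apply: le_trans le.
have : 0 <= (s - 20 / 29) ^+ 2 by exact: sqr_ge0.
rewrite !expr2; lra.
Qed.

End HyperbolicCosine.

(** * Concentration of sums of vectors *)

Lemma measurable_cosh {R : realType} dT (T : measurableType dT) (f : T -> R) :
  measurable_fun setT f -> measurable_fun setT (fun t => cosh (f t)).
Proof.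
move=> mf; apply: measurable_funM => //; apply: measurable_funD.
  exact: measurableT_comp (@measurable_expR R) mf.
apply: measurableT_comp (@measurable_expR R) _; exact: measurable_funN.
Qed.

Lemma measurable_sum_in {R : realType} dT (T : measurableType dT) (I : eqType)
    (s : seq I) (h : I -> T -> R) :
  (forall i, i \in s -> measurable_fun setT (h i)) ->
  measurable_fun setT (fun t => \sum_(i <- s) h i t).
Proof.
elim: s => [|i s IH] mh.
  by under eq_fun do rewrite big_nil; exact: measurable_cst.
under eq_fun do rewrite big_cons; apply: measurable_funD.
  by apply: mh; rewrite mem_head.
by apply: IH => j js; apply: mh; rewrite inE js orbT.
Qed.

Section CoshStep.
Context {R : realType} {d : nat} {d2 : measure_display} {T2 : measurableType d2}.
Context {nu : probability T2 R} {Y : T2 -> 'cV[R]_d} {G : R}.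
Hypothesis Y_meas : measurable_vec Y.
Hypothesis Y_centred : forall i, (\int[nu]_y (Y y i 0)%:E = 0)%E.
Hypothesis G_gt0 : 0 < G.
Hypothesis Y_subexp : (\int[nu]_y (expR (enorm (Y y) / G))%:E <= (expR 1)%:E)%E.

Lemma measurable_expR_enorm : measurable_fun setT (fun y => expR (enorm (Y y) / G)).
Proof.
apply: measurableT_comp; first exact: measurable_expR.
by apply: measurable_funM; [exact: measurable_enorm|exact: measurable_cst].
Qed.

Lemma integrable_expR_enorm :
  nu.-integrable setT (fun y => (expR (enorm (Y y) / G))%:E).
Proof.
apply/integrableP; split; first exact/measurable_EFinP/measurable_expR_enorm.
under eq_integral do rewrite gee0_abs ?lee_fin ?expR_ge0//.
by apply: le_lt_trans Y_subexp _; rewrite ltry.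
Qed.

Lemma integrable_subexp_coord i : nu.-integrable setT (fun y => (Y y i 0)%:E).
Proof.
apply: (le_integrable _ _ _ (integrableZl measurableT G integrable_expR_enorm)) => //.
  exact/measurable_EFinP.
move=> y _; rewrite -EFinM !abse_EFin lee_fin.
apply: le_trans (coord_le_enorm _ _) _; apply: le_trans (ler_norm _).
rewrite -ler_pdivrMl// mulrC; apply: le_trans (expR_ge1Dx _).
by rewrite lerDr.
Qed.

Lemma integral_dotv_centred (u : 'cV[R]_d) :
  nu.-integrable setT (fun y => (dotv u (Y y))%:E) /\
  (\int[nu]_y (dotv u (Y y))%:E = 0)%E.
Proof.
have E y : (dotv u (Y y))%:E = (\sum_i (u i 0)%:E * (Y y i 0)%:E)%E.
  by rewrite dotvE -sumEFin; apply: eq_bigr => i _; rewrite EFinM.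
have int i : nu.-integrable setT (fun y => ((u i 0)%:E * (Y y i 0)%:E)%E).
  exact/integrableZl/integrable_subexp_coord.
split; first by under eq_fun do rewrite E; apply: integrable_sum.
under eq_integral do rewrite E.
rewrite integral_sum// big1// => i _.
by rewrite integralZl ?Y_centred ?mule0//; exact: integrable_subexp_coord.
Qed.

Lemma cosh_step (l : R) (s : 'cV[R]_d) : 0 <= l -> l * G <= 1 ->
  (\int[nu]_y (cosh (l * enorm (s + Y y)))%:E <=
   ((1 + (l * G) ^+ 2 * (expR 1 - 1)) * cosh (l * enorm s))%:E)%E.
Proof.
move=> l0 lG; have [c cosh_le] := cosh_add_le (l *: s).
have lG0 : 0 <= l * G by rewrite mulr_ge0// ltW.
set A := cosh (l * enorm s); have A0 : 0 <= A by apply/ltW/cosh_gt0.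
pose e y := expR (enorm (Y y) / G).
pose u := (c * l) *: (l *: s).
have [int_u u0] := integral_dotv_centred u.
have le y : cosh (l * enorm (s + Y y)) <=
    A * (1 - (l * G) ^+ 2) + A * (l * G) ^+ 2 * e y + dotv u (Y y).
  have -> : l * enorm (s + Y y) = enorm (l *: s + l *: Y y).
    by rewrite -scalerDr enormZ ger0_norm.
  apply: le_trans (cosh_le _) _; rewrite !enormZ !(ger0_norm l0) -/A.
  have := expR_scaled_remainder_le (t := l * G) (x := enorm (Y y) / G).
  rewrite lG0 lG divr_ge0 ?enorm_ge0 ?(ltW G_gt0)// => /(_ isT isT).
  have -> : l * G * (enorm (Y y) / G) = l * enorm (Y y).
    by field; rewrite gt_eqF.
  move/(ler_wpM2l A0); rewrite -/(e y) /u !dotvZr !dotvZl; lra.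
have me := measurable_expR_enorm.
have mu : measurable_fun setT (fun y => dotv u (Y y)).
  by apply: measurable_dotv => // i; exact: measurable_cst.
have mA : measurable_fun setT (fun y => A * (1 - (l * G) ^+ 2) + A * (l * G) ^+ 2 * e y).
  by apply: measurable_funD => //; apply: measurable_funM.
apply: (@le_trans _ _ (\int[nu]_y
    (A * (1 - (l * G) ^+ 2) + A * (l * G) ^+ 2 * e y + dotv u (Y y))%:E)%E).
  apply: ge0_le_integral => //.
  - by move=> y _; rewrite lee_fin; apply/ltW/cosh_gt0.
  - apply/measurable_EFinP.
    apply: measurable_cosh; apply: measurable_funM => //.
    apply: measurable_enorm => i; under eq_fun do rewrite mxE.
    by apply: measurable_funD.
  - by apply/measurable_EFinP; exact: measurable_funD.
  - by move=> y _; rewrite lee_fin.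
have int1 : nu.-integrable setT (fun=> (A * (1 - (l * G) ^+ 2))%:E).
  exact: finite_measure_integrable_cst.
have int2 : nu.-integrable setT (fun y => (A * (l * G) ^+ 2)%:E * (e y)%:E)%E.
  exact/integrableZl/integrable_expR_enorm.
under eq_integral do rewrite !EFinD (EFinM (A * _)).
rewrite integralD//; last exact: integrableD.
rewrite u0 adde0 integralD// integral_cst//= probability_setT mule1.
rewrite integralZl//; last exact: integrable_expR_enorm.
apply: (@le_trans _ _ ((A * (1 - (l * G) ^+ 2))%:E +
   (A * (l * G) ^+ 2)%:E * (expR 1)%:E)%E).
  by rewrite leeD2l// lee_wpmul2l// lee_fin mulr_ge0 ?sqr_ge0.
by rewrite -EFinM -EFinD lee_fin; lra.
Qed.

End CoshStep.

(** Quantifying over every [J] that contains [J0] spares a comparison of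
    histories when draws are added to the past one at a time. *)
Definition adapted (R : realType) dO (Omega : measurableType dO)
    (I : eqType) (E : I -> set (set Omega)) d (J0 : pred I)
    (x : Omega -> 'cV[R]_d) : Prop :=
  forall J : pred I, (forall i, J0 i -> J i) ->
    @measurable_vec R d _ (history (E := E) J) x.

(** The hypotheses of [measurable_caratheodory]; the value of the constant does
    not enter any estimate, hence the existential. *)
Definition lipschitz_field (R : realType) d dX (Xi : measurableType dX)
    (phi : Xi -> 'cV[R]_d -> R) : Prop :=
  (forall x, measurable_fun setT (phi ^~ x)) /\
  exists K, forall i x y, `|phi i x - phi i y| <= K * enorm (x - y).

Section AdaptedSampling.
Context {R : realType} {dO : measure_display} {Omega : measurableType dO}.
Context {P : probability Omega R} {I : eqType} {E : I -> set (set Omega)}.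
Hypothesis sys : independent_draws P E.
Context {d : nat} {dX : measure_display} {Xi : measurableType dX}.
Context {mu : probability Xi R} {m : nat}.
Context {iota : 'I_m -> I} {xi : 'I_m -> Omega -> Xi}.
Hypothesis draw_xi : forall k, is_draw P E mu (iota k) (xi k).
Hypothesis iota_inj : injective iota.
Context {J0 : pred I} {x : Omega -> 'cV[R]_d}.
Hypothesis J0_iota : forall k, ~~ J0 (iota k).
Hypothesis x_adapted : adapted E J0 x.

Lemma measurable_field_draw (phi : Xi -> 'cV[R]_d -> R) (J : pred I) k :
  lipschitz_field phi -> (forall i, J0 i -> J i) -> J (iota k) ->
  @measurable_fun _ _ (history (E := E) J) _ setT (fun w => phi (xi k w) (x w)).
Proof.
move=> [mphi [K lip]] J0J Jk; apply: (measurable_caratheodory mphi lip).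
  exact: (measurable_draw (draw_xi k) Jk).
exact: x_adapted.
Qed.

Lemma measurable_field_pair (phi : Xi -> 'cV[R]_d -> R) (J : pred I) :
  lipschitz_field phi -> (forall i, J0 i -> J i) ->
  measurable_fun setT (fun p : history (E := E) J * Xi => phi p.2 (x p.1)).
Proof.
move=> [mphi [K lip]] J0J; apply: (measurable_caratheodory mphi lip) => //.
move=> i; exact: (measurableT_comp (x_adapted J0J i) measurable_fst).
Qed.

Section VectorField.
Context {Y : Xi -> 'cV[R]_d -> 'cV[R]_d} {G : R}.
Hypothesis Y_field : forall i, lipschitz_field (fun y z => Y y z i 0).
Hypothesis Y_centred : forall z i, (\int[mu]_y (Y y z i 0)%:E = 0)%E.
Hypothesis G_gt0 : 0 < G.
Hypothesis Y_subexp :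
  forall z, (\int[mu]_y (expR (enorm (Y y z) / G))%:E <= (expR 1)%:E)%E.

Lemma integral_cosh_sum_le (l : R) (r : seq 'I_m) : 0 <= l -> l * G <= 1 ->
  uniq r ->
  (\int[P]_w (cosh (l * enorm (\sum_(k <- r) Y (xi k w) (x w))))%:E <=
   ((1 + (l * G) ^+ 2 * (expR 1 - 1)) ^+ size r)%:E)%E.
Proof.
move=> l0 lG; set A := 1 + _.
have e1 : 1 <= expR 1 :> R by rewrite -[X in X <= _]expR0 ler_expR.
have A1 : 1 <= A by rewrite lerDl mulr_ge0 ?sqr_ge0 ?subr_ge0.
elim: r => [_|k r IH /= /andP[kr ur]].
  under eq_integral do rewrite big_nil enorm0 mulr0 /cosh oppr0 expR0 -mulr2n divff//.
  by rewrite integral_cst//= probability_setT mule1 expr0.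
pose J i := J0 i || (i \in map iota r).
have J0J i : J0 i -> J i by rewrite /J => ->.
have Jk : ~~ J (iota k) by rewrite /J negb_or J0_iota mem_map.
have Jr k' : k' \in r -> J (iota k') by move=> kr'; rewrite /J mem_map// kr' orbT.
pose S (w : Omega) := \sum_(k <- r) Y (xi k w) (x w).
have mS : @measurable_vec R d _ (history (E := E) J) S.
  move=> i; rewrite /S; under eq_fun do rewrite summxE.
  apply: measurable_sum_in => k' kr'.
  exact: (measurable_field_draw (Y_field i) J0J (Jr _ kr')).
pose Phi (p : history (E := E) J * Xi) :=
  (cosh (l * enorm (S p.1 + Y p.2 (x p.1))))%:E.
have mPhi : measurable_fun setT Phi.
  apply/measurable_EFinP; apply: measurable_cosh; apply: measurable_funM => //.
  apply: measurable_enorm => i; under eq_fun do rewrite mxE.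
  apply: measurable_funD; first exact: (measurableT_comp (mS i) measurable_fst).
  exact: (measurable_field_pair (Y_field i)).
have Phi0 p : (0 <= Phi p)%E by rewrite lee_fin; apply/ltW/cosh_gt0.
under eq_integral do rewrite big_cons addrC -/(S _).
have mcS : measurable_fun setT (fun w => cosh (l * enorm (S w))).
  apply: measurable_cosh; apply: measurable_funM => //; apply: measurable_enorm.
  by move=> i; exact: (measurable_fun_history sys (mS i)).
have IH' := IH ur.
apply: (@le_trans _ _ (\int[P]_w (A%:E * (cosh (l * enorm (S w)))%:E))%E).
  rewrite (freezing sys (draw_xi k) Jk mPhi Phi0).
  apply: ge0_le_integral => //.
  - by move=> w _; apply: integral_ge0.
  - have mF : measurable_fun setT (fubini_F mu Phi).
      exact: measurable_fun_fubini_tonelli_F.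
    exact: (measurable_fun_history sys mF).
  - by apply/measurable_EFinP; exact: measurable_funM.
  - move=> w _; rewrite -EFinM.
    have mY : measurable_vec (fun y => Y y (x w)).
      by move=> i; case: (Y_field i).
    exact: (cosh_step mY (Y_centred (x w)) G_gt0 (Y_subexp (x w)) (S w) l0 lG).
have A0 : (0 <= A%:E)%E by rewrite lee_fin (le_trans ler01).
rewrite ge0_integralZl//.
- by rewrite exprS EFinM lee_wpmul2l.
- exact/measurable_EFinP.
- by move=> w _; rewrite lee_fin; apply/ltW/cosh_gt0.
Qed.

Lemma measurable_sum_draws : measurable_vec (fun w => \sum_k Y (xi k w) (x w)).
Proof.
move=> i; under eq_fun do rewrite summxE; apply: measurable_sum => k.
have := measurable_field_draw (J := predT) (k := k) (Y_field i).
by move=> /(_ (fun _ _ => isT) isT) mY; exact: (measurable_fun_history sys mY).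
Qed.

(** The scale [1 / (G * sqrt m)] is admissible for every [m >= 1] and makes the
    moment bound the constant [exp (e - 1)]. It is exponential, not Gaussian,
    in the threshold, which is all a subexponential field allows; the numerical
    constants leave just enough room down to [s = ln 2]. *)
Lemma vector_concentration (eps s : R) : (0 < m)%N -> 0 < eps -> ln 2 <= s ->
  4 * G ^+ 2 * (1 + 3 * s ^+ 2) <= m%:R * eps ^+ 2 ->
  (P [set w | (m%:R * eps < enorm (\sum_k Y (xi k w) (x w)))%R] <=
   (expR (- s))%:E)%E.
Proof.
move=> m0 eps0 s_ge m_ge.
have mR : 0 < m%:R :> R by rewrite ltr0n.
set rm := Num.sqrt (m%:R : R).
have rm2 : rm ^+ 2 = m%:R by rewrite sqr_sqrtr// ltW.
have rm0 : 0 < rm by rewrite sqrtr_gt0.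
have rm1 : 1 <= rm by rewrite -sqrtr1 ler_wsqrtr// ler1n.
pose l := (G * rm)^-1.
have l0 : 0 <= l by rewrite invr_ge0 mulr_ge0// ltW.
have lGE : l * G = rm^-1 by rewrite /l invfM mulrAC mulVf ?mul1r// gt_eqF.
have lG : l * G <= 1 by rewrite lGE invf_le1.
have := integral_cosh_sum_le l0 lG (enum_uniq 'I_m).
rewrite size_enum_ord lGE exprVn rm2.
set A := (_ ^+ m)%:E => moment.
pose S w := \sum_k Y (xi k w) (x w).
have SE w : \sum_(k <- enum 'I_m) Y (xi k w) (x w) = S w by rewrite big_enum.
have mS : measurable_fun setT (fun w => enorm (S w)).
  by apply: measurable_enorm; exact: measurable_sum_draws.
have mc : measurable_fun setT (fun w => cosh (l * enorm (S w))).
  by apply: measurable_cosh; exact: measurable_funM.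
have le_A : (A <= (expR (expR 1 - 1))%:E)%E.
  have -> : expR 1 - 1 = m%:R * (m%:R^-1 * (expR 1 - 1)) :> R.
    by rewrite mulrA mulfV ?mul1r// gt_eqF.
  have e1 : 1 <= expR 1 :> R by rewrite -[X in X <= _]expR0 ler_expR.
  rewrite lee_fin expRM_natl; apply: ler_expn; last exact: expR_ge1Dx.
  by rewrite addr_ge0// mulr_ge0 ?invr_ge0 ?(ltW mR)// subr_ge0.
pose c := cosh (l * (m%:R * eps)).
have c0 : 0 < c by exact: cosh_gt0.
set B := [set w | _].
have mB : measurable B by apply: measurable_lt_set.
have markov : (c%:E * P B <= A)%E.
  apply: le_trans moment.
  under eq_integral do rewrite SE.
  rewrite -integral_cst//.
  apply: (@le_trans _ _ (\int[P]_(w in B) (cosh (l * enorm (S w)))%:E)%E).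
    apply: ge0_le_integral => //.
    - by move=> w _; rewrite lee_fin ltW.
    - apply/measurable_EFinP; exact: measurable_funTS.
    - move=> w Bw; rewrite lee_fin; apply: le_cosh.
      apply/andP; split; first by rewrite mulr_ge0// mulr_ge0// ltW.
      by rewrite ler_wpM2l// ltW.
  apply: ge0_subset_integral => //; first exact/measurable_EFinP.
  by move=> w _; rewrite lee_fin; apply/ltW/cosh_gt0.
have fB : P B \is a fin_num by exact: fin_num_measure.
have /fineK <- := fB; rewrite lee_fin.
have {}markov : c * fine (P B) <= expR (expR 1 - 1).
  by rewrite -lee_fin EFinM fineK// (le_trans markov).
pose rho := l * (m%:R * eps).
have rho0 : 0 <= rho by rewrite mulr_ge0// mulr_ge0// ltW.
have rhoE : rho ^+ 2 = m%:R * eps ^+ 2 / G ^+ 2.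
  rewrite /rho /l -rm2; field; rewrite !gt_eqF//.
have margin : s + ln 2 + (expR 1 - 1) <= rho.
  apply: exponential_tail_margin => //.
  by rewrite rhoE ler_pdivlMr ?exprn_gt0// mulrAC -mulrA mulrA.
have half : expR (s + (expR 1 - 1)) <= c.
  apply: le_trans (cosh_ge _); rewrite ler_pdivlMr//.
  rewrite -[X in _ * X <= _](@lnK R 2) ?posrE// -expRD ler_expR -/rho.
  by move: margin; lra.
have PB0 : 0 <= fine (P B) by rewrite fine_ge0.
have := le_trans (ler_wpM2r PB0 half) markov.
rewrite expRD -mulrA mulrCA ger_pMr ?expR_gt0//.
by rewrite expRN -ler_pdivlMl ?expR_gt0// mulr1.
Qed.

End VectorField.
End AdaptedSampling.

(** * Bounded random variables and moments *)

Section BoundedExpectation.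
Context {R : realType} {dT : measure_display} {T : measurableType dT}.
Context {P : probability T R}.
Implicit Types (X Y : T -> R).

Definition bounded_rv X : Prop :=
  measurable_fun setT X /\ exists M, forall w, `|X w| <= M.

Lemma bounded_rv_integrable X : bounded_rv X -> P.-integrable setT (EFin \o X).
Proof.
move=> [mX [M XM]]; apply: measurable_bounded_integrable => //.
  by rewrite ltey_eq fin_num_measure.
exists M; split; first exact: num_real.
by move=> x Mx w _; apply: le_trans (XM w) (ltW Mx).
Qed.

Lemma bounded_rv_cst (c : R) : bounded_rv (fun=> c).
Proof. by split; [exact: measurable_cst|exists `|c|]. Qed.

Lemma bounded_rvD X Y : bounded_rv X -> bounded_rv Y ->
  bounded_rv (fun w => X w + Y w).
Proof.
move=> [mX [M XM]] [mY [N YN]]; split; first exact: measurable_funD.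
by exists (M + N) => w; rewrite (le_trans (ler_normD _ _))// lerD.
Qed.

Lemma bounded_rvM X Y : bounded_rv X -> bounded_rv Y ->
  bounded_rv (fun w => X w * Y w).
Proof.
move=> [mX [M XM]] [mY [N YN]]; split; first exact: measurable_funM.
by exists (M * N) => w; rewrite normrM ler_pM.
Qed.

Lemma bounded_rvB X Y : bounded_rv X -> bounded_rv Y ->
  bounded_rv (fun w => X w - Y w).
Proof.
move=> bX bY; under eq_fun do rewrite -mulN1r.
by apply: bounded_rvD => //; apply: bounded_rvM => //; exact: bounded_rv_cst.
Qed.

Lemma bounded_rv_sum (J : Type) (r : seq J) (Q : pred J) (X : J -> T -> R) :
  (forall j, bounded_rv (X j)) ->
  bounded_rv (fun w => \sum_(j <- r | Q j) X j w).
Proof.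
move=> bX; under eq_fun do rewrite -big_filter.
elim: [seq j <- r | Q j] => [|j s IH].
  by under eq_fun do rewrite big_nil; exact: bounded_rv_cst.
by under eq_fun do rewrite big_cons; exact: bounded_rvD.
Qed.

Lemma expectation_sum_bounded (J : Type) (r : seq J) (Q : pred J) (X : J -> T -> R) :
  (forall j, bounded_rv (X j)) ->
  \int[P]_w (\sum_(j <- r | Q j) X j w) = \sum_(j <- r | Q j) \int[P]_w X j w.
Proof.
move=> bX; under eq_Rintegral do rewrite -big_filter.
rewrite -[RHS]big_filter; elim: [seq j <- r | Q j] => [|j s IH].
  under eq_Rintegral do rewrite big_nil.
  by rewrite big_nil Rintegral_cst// mul0r.
under eq_Rintegral do rewrite big_cons.
by rewrite big_cons RintegralD ?IH//; apply: bounded_rv_integrable => //; exact: bounded_rv_sum.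
Qed.

Lemma expectation_le_bounded X Y : bounded_rv X -> bounded_rv Y ->
  (forall w, X w <= Y w) -> \int[P]_w X w <= \int[P]_w Y w.
Proof.
by move=> bX bY XY; apply: le_Rintegral => //; exact: bounded_rv_integrable.
Qed.

Lemma expectation_cst_bounded (c : R) : \int[P]_w (cst c w) = c.
Proof. by rewrite Rintegral_cst//= probability_setT mulr1. Qed.

End BoundedExpectation.

Section BoundedMatrices.
Context {R : realType} {dT : measure_display} {T : measurableType dT} {d : nat}.
Implicit Types (A B : T -> 'M[R]_d).

Definition bounded_mx A : Prop := forall i j, bounded_rv (fun w => A w i j).

Lemma bounded_mxM A B : bounded_mx A -> bounded_mx B ->
  bounded_mx (fun w => A w * B w).
Proof.
move=> bA bB i j; under eq_fun do rewrite -mulmxE mxE.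
by apply: bounded_rv_sum => k; exact: bounded_rvM.
Qed.

Lemma bounded_mxX A n : bounded_mx A -> bounded_mx (fun w => A w ^+ n).
Proof.
move=> bA; elim: n => [|n IH].
  by move=> i j; under eq_fun do rewrite expr0; exact: bounded_rv_cst.
by under eq_fun do rewrite exprS; exact: bounded_mxM.
Qed.

Lemma bounded_mx_sum (J : finType) (Q : pred J) (A : J -> T -> 'M[R]_d) :
  (forall j, bounded_mx (A j)) -> bounded_mx (fun w => \sum_(j | Q j) A j w).
Proof.
move=> bA i j; under eq_fun do rewrite summxE.
by apply: bounded_rv_sum => k; exact: bA.
Qed.

Lemma bounded_mxtrace A : bounded_mx A -> bounded_rv (fun w => \tr (A w)).
Proof. by move=> bA; rewrite /mxtrace; apply: bounded_rv_sum => i; exact: bA. Qed.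

End BoundedMatrices.

Section MomentArithmetic.
Context {R : realType}.

(** The number of perfect matchings of [2p] points, which is the [2p]-th moment
    of a standard Gaussian. *)
Definition odd_factorial (p : nat) : R := \prod_(q < p) q.*2.+1%:R.

Lemma odd_factorialS p : odd_factorial p.+1 = p.*2.+1%:R * odd_factorial p.
Proof. by rewrite /odd_factorial big_ord_recr /= mulrC. Qed.

Lemma odd_factorial_ge0 p : 0 <= odd_factorial p.
Proof. by apply: prodr_ge0 => i _; exact: ler0n. Qed.

Lemma bernoulli (x : R) n : 0 <= x -> 1 + n%:R * x <= (1 + x) ^+ n.
Proof.
move=> x0; elim: n => [|n IH]; first by rewrite mul0r addr0 expr0.
have x1 : 0 <= 1 + x by rewrite addr_ge0.
rewrite exprS; apply: le_trans (ler_wpM2l x1 IH).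
have : 0 <= n%:R * x ^+ 2 by rewrite mulr_ge0 ?sqr_ge0.
by rewrite -natr1; lra.
Qed.

Lemma odd_factorial_le p : odd_factorial p <= p%:R ^+ p.
Proof.
elim: p => [|p IH]; first by rewrite /odd_factorial big_ord0 expr0.
rewrite odd_factorialS; apply: le_trans (ler_wpM2l (ler0n _ _) IH) _.
case: p {IH} => [|p]; first by rewrite double0 !expr1 expr0 mulr1.
have p0 : 0 < p.+1%:R :> R by rewrite ltr0n.
rewrite [leRHS]exprS.
have le2 : 2 * p.+1%:R ^+ p.+1 <= p.+2%:R ^+ p.+1 :> R.
  have := @bernoulli (p.+1%:R^-1) p.+1; rewrite invr_ge0 ltW// => /(_ isT).
  rewrite mulfV ?gt_eqF// => le.
  have -> : p.+2%:R = (1 + p.+1%:R^-1) * p.+1%:R :> R.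
    by rewrite mulrDl mulVf ?gt_eqF// mul1r -natr1 addrC.
  rewrite exprMn ler_wpM2r ?exprn_ge0//.
apply: (@le_trans _ _ (p.+2%:R * (2 * p.+1%:R ^+ p.+1))); last first.
  by rewrite ler_wpM2l.
rewrite mulrA ler_wpM2r ?exprn_ge0// -natrM ler_nat; lia.
Qed.

(** With [p] the integer part of [l], the factor [4 ^+ p] makes up for [expR l] in
    Markov's inequality at order [2p]. *)
Lemma moment_order_exists (l : R) : 1 <= l -> exists p : nat,
  (0 < p)%N /\ odd_factorial p <= 2 * expR (- l) * (4 * l) ^+ p.
Proof.
move=> l1; exists (Num.truncn l).
have /andP[pl lp] : (Num.truncn l)%:R <= l < (Num.truncn l).+1%:R.
  by apply: truncn_itv; rewrite (le_trans ler01).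
set p := Num.truncn l in pl lp *.
have p0 : (0 < p)%N by rewrite /p truncn_gt0.
clearbody p.
split=> //; apply: le_trans (odd_factorial_le p) _.
have l0 : 0 <= l by rewrite (le_trans ler01).
rewrite exprMn mulrA; apply: (@le_trans _ _ (1 * l ^+ p)).
  by rewrite mul1r ler_expn.
rewrite ler_wpM2r ?exprn_ge0//.
have e0 := expR_gt0 (1 : R); have e_le := @expR1_le R.
have four : expR p.+1%:R <= 2 * 4 ^+ p :> R.
  case: p p0 {pl lp} => // p _; elim: p => [|p IH].
    rewrite (_ : expR _ = expR 1 * expR 1) ?expr1; last by rewrite -expRD -natr1.
    apply: (@le_trans _ _ (109 / 40 * (109 / 40))); last lra.
    by apply: ler_pM => //; exact: ltW.
  rewrite -natr1 expRD exprS mulrCA mulrC; apply: ler_pM => //; try exact: expR_ge0.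
  by apply: le_trans e_le _; lra.
have := expR_gt0 l => el0.
rewrite mulrAC expRN ler_pdivlMr// mul1r.
by apply: le_trans four; rewrite ler_expR ltW.
Qed.

End MomentArithmetic.

(** * Concentration of sums of matrices *)

Section MatrixField.
Context {R : realType} {dO : measure_display} {Omega : measurableType dO}.
Context {P : probability Omega R} {I : eqType} {E : I -> set (set Omega)}.
Hypothesis sys : independent_draws P E.
Context {d : nat} {dX : measure_display} {Xi : measurableType dX}.
Context {mu : probability Xi R} {m : nat}.
Context {iota : 'I_m -> I} {xi : 'I_m -> Omega -> Xi}.
Hypothesis draw_xi : forall k, is_draw P E mu (iota k) (xi k).
Hypothesis iota_inj : injective iota.
Context {J0 : pred I} {x : Omega -> 'cV[R]_d}.
Hypothesis J0_iota : forall k, ~~ J0 (iota k).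
Hypothesis x_adapted : adapted E J0 x.

Lemma freezing_centred (J : pred I) k (Psi : history (E := E) J * Xi -> R) :
  ~~ J (iota k) -> bounded_rv Psi ->
  (forall w, (\int[mu]_y (Psi (w, y))%:E = 0)%E) ->
  \int[P]_w Psi (to_history J w, xi k w) = 0.
Proof.
move=> Jk [mPsi [M PsiM]] Psi0.
have M0 p : 0 <= Psi p + M by have := PsiM p; rewrite ler_norml; lra.
have mPhi : measurable_fun setT (fun p => (Psi p + M)%:E).
  by apply/measurable_EFinP; apply: measurable_funD.
have := freezing sys (draw_xi k) Jk mPhi (fun p => M0 p).
have bxi : bounded_rv (fun w => Psi (to_history J w, xi k w)).
  split; last by exists M => w; exact: PsiM.
  apply: (measurableT_comp mPsi); apply: measurable_fun_pair.
    exact: (measurable_to_history sys).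
  by case: (draw_xi k).
have intP : P.-integrable setT (fun w => (Psi (to_history J w, xi k w))%:E).
  exact: bounded_rv_integrable.
have inner w : (\int[mu]_y (Psi (w, y) + M)%:E = M%:E)%E.
  have bw : bounded_rv (fun y => Psi (w, y)).
    split; last by exists M => y; exact: PsiM.
    exact: (measurable_fun_pair2 _ mPsi).
  under eq_integral do rewrite EFinD.
  have iPsi : mu.-integrable setT (fun y => (Psi (w, y))%:E).
    exact: (bounded_rv_integrable bw).
  rewrite integralD//; last exact: finite_measure_integrable_cst.
  by rewrite Psi0 add0e integral_cst//= probability_setT mule1.
under [in RHS]eq_integral do rewrite inner.
rewrite integral_cst//= probability_setT mule1.
under eq_integral do rewrite EFinD.
rewrite integralD//; last exact: finite_measure_integrable_cst.
rewrite integral_cst//= probability_setT mule1.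
have fa := integrable_fin_num measurableT intP.
rewrite -(fineK fa) -EFinD => -[]; rewrite /Rintegral; lra.
Qed.

Context {X : Xi -> 'cV[R]_d -> 'M[R]_d} {K : R}.
Hypothesis X_field : forall i j, lipschitz_field (fun y z => X y z i j).
Hypothesis X_centred : forall z i j, (\int[mu]_y (X y z i j)%:E = 0)%E.
Hypothesis X_sym : forall y z, (X y z)^T = X y z.
Hypothesis X_bound : forall y z v, enorm (X y z *m v) <= K * enorm v.

Let XK y z i j : `|X y z i j| <= K.
Proof.
have -> : X y z i j = (X y z *m (delta_mx j 0 : 'cV_d)) i 0 by rewrite -colE mxE.
by rewrite (le_trans (coord_le_enorm _ _))// (le_trans (X_bound _ _ _))//
   enorm_delta mulr1.
Qed.

Definition draw_mx (k : 'I_m) (w : Omega) : 'M[R]_d := X (xi k w) (x w).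

Definition partial_sum (A : {set 'I_m}) (w : Omega) : 'M[R]_d :=
  \sum_(k in A) draw_mx k w.

Lemma partial_sum_sym A w : (partial_sum A w)^T = partial_sum A w.
Proof. by rewrite /partial_sum linear_sum; apply: eq_bigr => k _; exact: X_sym. Qed.

Lemma bounded_draw_mx (J : pred I) k : (forall i, J0 i -> J i) -> J (iota k) ->
  @bounded_mx R _ (history (E := E) J) d (draw_mx k).
Proof.
move=> J0J Jk i j; split; last by exists K => w; exact: XK.
exact: (measurable_field_draw draw_xi x_adapted (X_field i j) J0J Jk).
Qed.

Lemma bounded_mx_history (J : pred I) (A : Omega -> 'M[R]_d) :
  @bounded_mx R _ (history (E := E) J) d A -> bounded_mx A.
Proof.
move=> bA i j; have [mA [M AM]] := bA i j.
by split; [exact: (measurable_fun_history sys mA)|exists M].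
Qed.

Lemma bounded_draw_mxT k : bounded_mx (draw_mx k).
Proof. by apply: (@bounded_mx_history predT); exact: bounded_draw_mx. Qed.

Lemma bounded_partial_sum A : bounded_mx (partial_sum A).
Proof. by apply: bounded_mx_sum => k; exact: bounded_draw_mxT. Qed.

Lemma expectation_trace_draw_power (A : {set 'I_m}) k n : k \notin A ->
  \int[P]_w \tr (draw_mx k w * partial_sum A w ^+ n) = 0.
Proof.
move=> kA; pose J i := J0 i || [exists l in A, iota l == i].
have J0J i : J0 i -> J i by rewrite /J => ->.
have Jk : ~~ J (iota k).
  rewrite /J negb_or J0_iota; apply/existsP => -[l /andP[lA /eqP/iota_inj E1]].
  by rewrite -E1 lA in kA.
have JA l : l \in A -> J (iota l).
  move=> lA; rewrite /J; apply/orP; right.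
  by apply/existsP; exists l; rewrite lA eqxx.
have bS : @bounded_mx R _ (history (E := E) J) d (partial_sum A).
  move=> i j; rewrite /partial_sum; split.
    under eq_fun do rewrite summxE -big_filter.
    apply: measurable_sum_in => l; rewrite mem_filter => /andP[lA _].
    by case: (bounded_draw_mx J0J (JA l lA) i j).
  by case: (bounded_partial_sum A i j).
have bSn := bounded_mxX n bS.
pose Psi (p : history (E := E) J * Xi) :=
  \tr (X p.2 (x p.1) * partial_sum A p.1 ^+ n).
apply: (freezing_centred (Psi := Psi) Jk).
  apply: bounded_mxtrace; apply: bounded_mxM => i j.
    split; last by exists K => p; exact: XK.
    exact: (measurable_field_pair x_adapted (X_field i j) J0J).
  have [mS [M SM]] := bSn i j.
  split; last by exists M => p; exact: SM.
  exact: (measurableT_comp mS measurable_fst).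
move=> w; rewrite /Psi /=.
set S := partial_sum A w ^+ n.
have E1 y : (\tr (X y (x w) * S))%:E =
    (\sum_i \sum_j (S j i)%:E * (X y (x w) i j)%:E)%E.
  rewrite /mxtrace -sumEFin; apply: eq_bigr => i _.
  rewrite -mulmxE mxE -sumEFin; apply: eq_bigr => j _.
  by rewrite -EFinM mulrC.
have iX i j : mu.-integrable setT (fun y => (X y (x w) i j)%:E).
  apply: bounded_rv_integrable; split; last by exists K => y; exact: XK.
  by case: (X_field i j).
under eq_integral do rewrite E1.
rewrite integral_sum//; last first.
  by move=> i; apply: integrable_sum => // j _; exact: integrableZl.
rewrite big1// => i _; rewrite integral_sum//; last first.
  by move=> j; exact: integrableZl.
by rewrite big1// => j _; rewrite integralZl// X_centred mule0.
Qed.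

(** The recursion on [p]: expand one factor of [\tr (S ^+ 2p)] into the
    independent summands, subtract from each the term in which that summand is
    removed from the power, which vanishes on average, and apply
    [mxtrace_increment_le] to the difference. *)
Lemma expectation_trace_power_le (A : {set 'I_m}) p :
  \int[P]_w \tr (partial_sum A w ^+ p.*2) <=
  d%:R * odd_factorial p * (K ^+ 2 * #|A|%:R) ^+ p.
Proof.
elim: p A => [|p IH] A.
  under eq_Rintegral do rewrite double0 expr0 mxtrace1.
  rewrite (expectation_cst_bounded (P := P)).
  by rewrite /odd_factorial big_ord0 !mulr1.
pose C n := d%:R * odd_factorial p * (K ^+ 2 * n%:R) ^+ p : R.
have K2 : 0 <= K ^+ 2 by exact: sqr_ge0.
have C_mono a b : (a <= b)%N -> C a <= C b.
  move=> ab; rewrite ler_wpM2l ?mulr_ge0 ?odd_factorial_ge0//.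
  by apply: ler_expn; [rewrite mulr_ge0|rewrite ler_wpM2l// ler_nat].
have bS := bounded_partial_sum.
have bt B n : bounded_rv (fun w => \tr (partial_sum B w ^+ n)).
  by apply: bounded_mxtrace; exact: bounded_mxX.
have bXt k B n : bounded_rv (fun w => \tr (draw_mx k w * partial_sum B w ^+ n)).
  apply: bounded_mxtrace; apply: bounded_mxM; first exact: bounded_draw_mxT.
  exact: bounded_mxX.
have E1 w : \tr (partial_sum A w ^+ p.+1.*2) =
    \sum_(k in A) \tr (draw_mx k w * partial_sum A w ^+ p.*2.+1).
  rewrite doubleS exprS {1}/partial_sum mulr_suml.
  exact: raddf_sum.
under eq_Rintegral do rewrite E1.
rewrite expectation_sum_bounded//.
have term k : k \in A ->
    \int[P]_w \tr (draw_mx k w * partial_sum A w ^+ p.*2.+1) <=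
    p.*2.+1%:R * (K ^+ 2 * C #|A|).
  move=> kA; pose B := A :\ k.
  have SB w : partial_sum A w - partial_sum B w = draw_mx k w.
    rewrite /partial_sum (big_setD1 k)//= addrK//.
  have kB : k \notin B by rewrite !inE eqxx.
  have zero := expectation_trace_draw_power p.*2.+1 kB.
  have step w : \tr (draw_mx k w * partial_sum A w ^+ p.*2.+1)
      - \tr (draw_mx k w * partial_sum B w ^+ p.*2.+1) <=
      p.*2.+1%:R * K ^+ 2 / 2 * (\tr (partial_sum A w ^+ p.*2)
                               + \tr (partial_sum B w ^+ p.*2)).
    have := mxtrace_increment_le p (partial_sum_sym A w) (partial_sum_sym B w).
    by rewrite SB => /(_ K (X_bound _ _)); lra.
  rewrite -[leLHS]subr0 -zero -RintegralB//; [|exact: bounded_rv_integrable..].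
  apply: (@le_trans _ _ (\int[P]_w (p.*2.+1%:R * K ^+ 2 / 2 *
     (\tr (partial_sum A w ^+ p.*2) + \tr (partial_sum B w ^+ p.*2))))).
    apply: expectation_le_bounded => //; first exact: bounded_rvB.
    by apply: bounded_rvM; [exact: bounded_rv_cst|exact: bounded_rvD].
  rewrite RintegralZl//; last by apply: bounded_rv_integrable; exact: bounded_rvD.
  rewrite RintegralD//; [|exact: bounded_rv_integrable..].
  have cAB : (#|B| <= #|A|)%N by rewrite subset_leq_card ?subD1set.
  have := lerD (IH A) (le_trans (IH B) (C_mono _ _ cAB)).
  rewrite -/(C _) => le; apply: (le_trans (ler_wpM2l _ le)); last by lra.
  by rewrite divr_ge0// mulr_ge0.
apply: le_trans (ler_sum _ term) _.
rewrite sumr_const odd_factorialS [X in _ <= _ * X]exprS /C -[leLHS]mulr_natl.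
rewrite le_eqVlt; apply/orP; left; apply/eqP; ring.
Qed.

(** The trace of an even power dominates that power of the quadratic form on the
    whole unit sphere, so that Markov's inequality for the trace controls all
    directions at once, at the price of the factor [d]. *)
Lemma matrix_concentration (t l : R) : (0 < m)%N -> (0 < d)%N ->
  0 < K -> 0 < t -> 1 <= l -> 4 * K ^+ 2 * l <= m%:R * t ^+ 2 ->
  exists B, [/\ measurable B, (P B <= (2 * d%:R * expR (- l))%:E)%E &
    forall w v, ~ B w -> enorm v = 1 ->
      `|quadf (\sum_k draw_mx k w) v| <= m%:R * t].
Proof.
move=> m0 d0 K0 t0 l1 m_ge.
have mR : 0 < m%:R :> R by rewrite ltr0n.
have l0 : 0 < l by rewrite (lt_le_trans ltr01).
have [p [p0 p_le]] := moment_order_exists l1.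
pose S w := partial_sum [set: 'I_m] w.
have SE w : \sum_k draw_mx k w = S w.
  by rewrite /S /partial_sum; apply: eq_bigl => k; rewrite inE.
pose tS w := \tr (S w ^+ p.*2).
have btS : bounded_rv tS.
  by apply: bounded_mxtrace; apply: bounded_mxX; exact: bounded_partial_sum.
have tS0 w : 0 <= tS w by apply: mxtrace_even_ge0; exact: partial_sum_sym.
pose c := (m%:R * t) ^+ p.*2.
have c0 : 0 < c by rewrite exprn_gt0// mulr_gt0.
pose B := [set w | c < tS w].
have mtS : measurable_fun setT tS by case: btS.
have mB : measurable B by apply: measurable_lt_set.
exists B; split=> // [|w v Bw v1]; last first.
  rewrite SE; move/negP: Bw; rewrite -leNgt => le.
  have := le_trans (quadf_pow_le_mxtrace p (partial_sum_sym _ w) v1) le.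
  rewrite /c -!mul2n !exprM -[quadf _ _ ^+ 2]real_normK ?num_real//.
  rewrite -!exprM mul2n ler_pXn2r ?nnegrE ?double_gt0//.
  by rewrite mulr_ge0// ltW.
have fB : P B \is a fin_num by exact: fin_num_measure.
have markov : c * fine (P B) <= \int[P]_w tS w.
  have iS : P.-integrable setT (EFin \o tS) by exact: bounded_rv_integrable.
  rewrite /Rintegral -lee_fin EFinM fineK// fineK; last first.
    exact: integrable_fin_num.
  rewrite -integral_cst//.
  apply: (@le_trans _ _ (\int[P]_(w in B) (tS w)%:E)%E).
    apply: ge0_le_integral => //.
    - by move=> w _; rewrite lee_fin ltW.
    - by apply/measurable_EFinP; exact: measurable_funTS.
    - by move=> w Bw; rewrite lee_fin ltW.
  apply: ge0_subset_integral => //; first exact/measurable_EFinP.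
  by move=> w _; rewrite lee_fin.
have moment := expectation_trace_power_le [set: 'I_m] p.
rewrite cardsT card_ord in moment.
have {}markov := le_trans markov moment.
rewrite -[P B]fineK// lee_fin -(ler_pM2l c0); apply: le_trans markov _.
have le1 : d%:R * odd_factorial p * (K ^+ 2 * m%:R) ^+ p <=
    d%:R * (2 * expR (- l) * (4 * l) ^+ p) * (K ^+ 2 * m%:R) ^+ p.
  apply: ler_wpM2r; last exact: ler_wpM2l.
  by rewrite exprn_ge0// mulr_ge0 ?sqr_ge0.
apply: le_trans le1 _.
have le2 : (4 * l * (K ^+ 2 * m%:R)) ^+ p <= c.
  rewrite /c -mul2n exprM; apply: ler_expn.
    by rewrite !mulr_ge0 ?sqr_ge0// ltW.
  rewrite (_ : (m%:R * t) ^+ 2 = m%:R * (m%:R * t ^+ 2)); last by ring.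
  rewrite (_ : 4 * l * (K ^+ 2 * m%:R) = m%:R * (4 * K ^+ 2 * l)); last by ring.
  by rewrite ler_wpM2l// ltW.
rewrite (_ : _ * (K ^+ 2 * m%:R) ^+ p = 2 * d%:R * expR (- l)
    * (4 * l * (K ^+ 2 * m%:R)) ^+ p); last by rewrite [in RHS]exprMn; ring.
rewrite [leRHS]mulrC ler_wpM2l// !mulr_ge0// expR_ge0.
Qed.

End MatrixField.

(** * Differentiation under the expectation *)

Section ExpectedDerivatives.
Context {R : realType} {dX : measure_display} {Xi : measurableType dX}.
Context {mu : probability Xi R} {d : nat}.
Implicit Types (x u v w z : 'cV[R]_d).

Definition integrable_rv (Z : Xi -> R) : Prop := mu.-integrable setT (EFin \o Z).

Lemma integrable_rvB Z1 Z2 : integrable_rv Z1 -> integrable_rv Z2 ->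
  integrable_rv (fun y => Z1 y - Z2 y).
Proof. by move=> i1 i2; exact: (integrableB measurableT i1 i2). Qed.

Lemma integrable_rvD Z1 Z2 : integrable_rv Z1 -> integrable_rv Z2 ->
  integrable_rv (fun y => Z1 y + Z2 y).
Proof. by move=> i1 i2; exact: (integrableD measurableT i1 i2). Qed.

Lemma integrable_rv_norm Z : integrable_rv Z -> integrable_rv (fun y => `|Z y|).
Proof. by move=> i; exact: (integrable_abse i). Qed.

Lemma integrable_rvZ c Z : integrable_rv Z -> integrable_rv (fun y => c * Z y).
Proof. by move=> i; exact: (integrableZl measurableT c i). Qed.

Lemma integrable_rv_cst c : integrable_rv (fun=> c).
Proof. exact: finite_measure_integrable_cst. Qed.

Lemma integrable_rv_sum (I : finType) (Z : I -> Xi -> R) :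
  (forall i, integrable_rv (Z i)) -> integrable_rv (fun y => \sum_i Z i y).
Proof.
move=> iZ; rewrite /integrable_rv (_ : EFin \o _ =
    (fun y => (\sum_i (Z i y)%:E)%E)); last first.
  by apply/funext => y /=; rewrite sumEFin.
by apply: integrable_sum => // i _; exact: iZ.
Qed.

Lemma expectation_sum_integrable (I : finType) (Z : I -> Xi -> R) :
  (forall i, integrable_rv (Z i)) ->
  \int[mu]_y (\sum_i Z i y) = \sum_i \int[mu]_y Z i y.
Proof.
move=> iZ; rewrite /Rintegral.
under eq_integral do rewrite -sumEFin.
rewrite integral_sum// sum_fine// => i _.
exact: (integrable_fin_num measurableT (iZ i)).
Qed.

Lemma expectation_dotv (V : Xi -> 'cV[R]_d) w :
  (forall i, integrable_rv (fun y => V y i 0)) ->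
  integrable_rv (fun y => dotv w (V y)) /\
  \int[mu]_y dotv w (V y) = dotv w (\col_i \int[mu]_y V y i 0).
Proof.
move=> iV; have iw i : integrable_rv (fun y => w i 0 * V y i 0).
  exact: integrable_rvZ.
split; first by under eq_fun do rewrite dotvE; exact: integrable_rv_sum.
under eq_Rintegral do rewrite dotvE.
rewrite expectation_sum_integrable// dotvE; apply: eq_bigr => i _.
by rewrite mxE RintegralZl//; exact: iV.
Qed.

(** A first-order expansion with a quadratic remainder that is uniform in the
    sample integrates to an expansion of the expectation, whose linear term is
    therefore the expected derivative. *)
Lemma derive_expectation (Phi : Xi -> 'cV[R]_d -> R) (g : 'cV[R]_d -> R)
    (psi : Xi -> R) (C : R) x e :
  (forall z, integrable_rv (Phi ^~ z)) ->
  (forall z, \int[mu]_y Phi y z = g z) ->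
  (forall y t, `|Phi y (x + t *: e) - Phi y x - t * psi y| <= C * t ^+ 2) ->
  integrable_rv psi /\ 'D_e g x = \int[mu]_y psi y.
Proof.
move=> iPhi gE expansion.
have mPhi z : measurable_fun setT (Phi ^~ z).
  by have /integrableP[/measurable_EFinP] := iPhi z.
have mpsi : measurable_fun setT psi.
  apply: (@measurable_fun_cvg _ _ _ _
    (fun n y => n.+1%:R * (Phi y (x + n.+1%:R^-1 *: e) - Phi y x))) => [n|y _].
    by apply: measurable_funM => //; exact: measurable_funB.
  apply/cvgrPdist_le => eps eps0; near=> n.
  have n0 : 0 < n.+1%:R :> R by rewrite ltr0n.
  set r : R := n.+1%:R in n0 *.
  have r0 : r != 0 by rewrite gt_eqF.
  have -> : psi y - r * (Phi y (x + r^-1 *: e) - Phi y x) =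
      - (r * (Phi y (x + r^-1 *: e) - Phi y x - r^-1 * psi y)) by field.
  rewrite normrN normrM (gtr0_norm n0).
  apply: le_trans (ler_wpM2l (ltW n0) (expansion y r^-1)) _.
  have -> : r * (C * r^-1 ^+ 2) = C / r by field.
  rewrite ler_pdivrMr// -ler_pdivrMl// mulrC.
  apply: (@le_trans _ _ n%:R); last by rewrite ler_nat.
  near: n; exact: nbhs_infty_ger.
have ipsi : integrable_rv psi.
  have ib : integrable_rv (fun y => `|Phi y (x + 1 *: e) - Phi y x| + C).
    apply: integrable_rvD; last exact: integrable_rv_cst.
    by apply: integrable_rv_norm; exact: integrable_rvB.
  apply: (le_integrable measurableT _ _ ib); first exact/measurable_EFinP.
  move=> y _ /=; rewrite lee_fin; apply: le_trans (ler_norm _).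
  have := expansion y 1; rewrite mul1r expr1n mulr1 => le.
  have := ler_normB (Phi y (x + 1 *: e) - Phi y x)
    (Phi y (x + 1 *: e) - Phi y x - psi y).
  by rewrite opprB addrC subrK; lra.
split=> //; set a := \int[mu]_y psi y.
have gt t : `|g (x + t *: e) - g x - t * a| <= C * t ^+ 2.
  have iD := integrable_rvB (iPhi (x + t *: e)) (iPhi x).
  have iq := integrable_rvB iD (integrable_rvZ t ipsi).
  have -> : g (x + t *: e) - g x - t * a =
      \int[mu]_y (Phi y (x + t *: e) - Phi y x - t * psi y).
    rewrite (RintegralB measurableT iD (integrable_rvZ t ipsi)).
    by rewrite (RintegralB measurableT (iPhi _) (iPhi _)) RintegralZl// !gE.
  apply: le_trans (le_normr_Rintegral measurableT iq) _.
  rewrite -[leRHS](expectation_cst_bounded (P := mu)).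
  apply: le_Rintegral => //; first exact: integrable_rv_norm.
  exact: integrable_rv_cst.
apply/cvg_lim => //; apply/cvgrPdist_le => eps eps0.
pose C' := 1 + `|C|; have C0 : 0 < C' by rewrite ltr_pwDl.
near=> h.
have h0 : h != 0 by near: h; exact: nbhs_dnbhs_neq.
rewrite /= (addrC (h *: e)).
have -> : a - h^-1 *: (g (x + h *: e) - g x) =
    - (h^-1 * (g (x + h *: e) - g x - h * a)).
  by rewrite [_ *: _]/(_ * _) mulrBr mulrA mulVf// mul1r opprB.
rewrite normrN normrM normfV.
have hn : 0 < `|h| by rewrite normr_gt0.
rewrite mulrC ler_pdivrMr//; apply: le_trans (gt h) _.
rewrite -real_normK ?num_real// expr2 mulrA ler_pM2r//.
apply: (@le_trans _ _ (C' * `|h|)).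
  by rewrite ler_wpM2r// /C' (le_trans (ler_norm C))// lerDr.
rewrite -ler_pdivlMl//; near: h.
by apply: dnbhs0_le; rewrite mulr_gt0 ?invr_gt0.
Unshelve. all: by end_near. Qed.

Section ExpectedLoss.
Context {L1 L2 : R} {F : Xi -> 'cV[R]_d -> R} {f : 'cV[R]_d -> R}.
Hypotheses (L1_gt0 : 0 < L1) (L2_gt0 : 0 < L2).
Hypothesis F_smooth : forall y, smooth_component L1 L2 (F y).
Hypothesis F_integrable : forall z, integrable_rv (F ^~ z).
Hypothesis F_mean : forall z, \int[mu]_y F y z = f z.

Let L1_ge0 : 0 <= L1 := ltW L1_gt0.
Let L2_ge0 : 0 <= L2 := ltW L2_gt0.

Lemma expectation_grad z i : integrable_rv (fun y => grad (F y) z i 0) /\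
  \int[mu]_y grad (F y) z i 0 = grad f z i 0.
Proof.
have expansion y t : `|F y (z + t *: delta_mx i 0) - F y z - t * grad (F y) z i 0|
    <= L1 / 2 * t ^+ 2.
  have := smooth_taylor1 (F_smooth y) z (t *: delta_mx i 0).
  by rewrite dotvZr dotvC dotv_delta enormZ enorm_delta mulr1 real_normK ?num_real.
have [iG E] := derive_expectation F_integrable F_mean expansion.
by split=> //; rewrite -E mxE.
Qed.

Lemma expectation_hess z i j : integrable_rv (fun y => hess (F y) z i j) /\
  \int[mu]_y hess (F y) z i j = hess f z i j.
Proof.
have expansion y t : `|grad (F y) (z + t *: delta_mx j 0) i 0 - grad (F y) z i 0
    - t * hess (F y) z i j| <= L2 / 2 * t ^+ 2.
  have := smooth_taylor_grad (F_smooth y) L2_ge0 z (t *: delta_mx j 0).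
  rewrite enormZ enorm_delta mulr1 real_normK ?num_real//; apply: le_trans.
  by apply: le_trans (coord_le_enorm _ i); rewrite -scalemxAr -colE !mxE.
have [iH E] := derive_expectation (fun z => (expectation_grad z i).1)
  (fun z => (expectation_grad z i).2) expansion.
by split=> //; rewrite -E mxE.
Qed.

Lemma expectation_dotv_grad z w :
  integrable_rv (fun y => dotv w (grad (F y) z)) /\
  \int[mu]_y dotv w (grad (F y) z) = dotv w (grad f z).
Proof.
have [iw ->] := expectation_dotv w (fun i => (expectation_grad z i).1).
split=> //; congr dotv; apply/colP => i.
by rewrite [LHS]mxE (expectation_grad z i).2.
Qed.

Lemma expectation_dotv_hess z v w :
  integrable_rv (fun y => dotv w (hess (F y) z *m v)) /\
  \int[mu]_y dotv w (hess (F y) z *m v) = dotv w (hess f z *m v).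
Proof.
have iHv i : integrable_rv (fun y => (hess (F y) z *m v) i 0) /\
    \int[mu]_y (hess (F y) z *m v) i 0 = (hess f z *m v) i 0.
  have row_dotv (A : 'M[R]_d) : (A *m v) i 0 = dotv v (\col_j A i j).
    by rewrite mxE dotvE; apply: eq_bigr => j _; rewrite mxE mulrC.
  under eq_fun do rewrite row_dotv.
  have iH j : integrable_rv (fun y => (\col_j hess (F y) z i j : 'cV_d) j 0).
    by under eq_fun do rewrite mxE; exact: (expectation_hess z i j).1.
  have [iw E] := expectation_dotv v iH.
  split=> //; rewrite E row_dotv; congr dotv; apply/colP => j; rewrite [LHS]mxE [RHS]mxE.
  by under eq_Rintegral do rewrite mxE; exact: (expectation_hess z i j).2.
have [iw ->] := expectation_dotv w (fun i => (iHv i).1).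
split=> //; congr dotv; apply/colP => i.
by rewrite [LHS]mxE (iHv i).2.
Qed.

Lemma expectation_taylor1 z u :
  f (z + u) <= f z + dotv (grad f z) u + L1 / 2 * enorm u ^+ 2.
Proof.
have [ig gE] := expectation_dotv_grad z u.
have iD := integrable_rvB (integrable_rvB (F_integrable (z + u)) (F_integrable z)) ig.
have : \int[mu]_y (F y (z + u) - F y z - dotv u (grad (F y) z)) <=
    \int[mu]_y (cst (L1 / 2 * enorm u ^+ 2) y).
  apply: le_Rintegral => //; first exact: integrable_rv_cst.
  move=> y _; have := smooth_taylor1 (F_smooth y) z u.
  by rewrite dotvC; apply: le_trans; exact: ler_norm.
rewrite expectation_cst_bounded.
rewrite (RintegralB measurableT (integrable_rvB (F_integrable _) (F_integrable _)) ig).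
rewrite (RintegralB measurableT (F_integrable _) (F_integrable _)) !F_mean gE dotvC.
lra.
Qed.

Lemma expectation_taylor2 z u :
  f (z + u) <= f z + dotv (grad f z) u + quadf (hess f z) u / 2
               + L2 / 6 * enorm u ^+ 3.
Proof.
have [ig gE] := expectation_dotv_grad z u.
have [ih hE] := expectation_dotv_hess z u u.
have i1 := integrable_rvB (F_integrable (z + u)) (F_integrable z).
have i2 := integrable_rvB i1 ig.
have i3 := integrable_rvB i2 (integrable_rvZ 2^-1 ih).
have : \int[mu]_y (F y (z + u) - F y z - dotv u (grad (F y) z)
      - 2^-1 * dotv u (hess (F y) z *m u)) <=
    \int[mu]_y (cst (L2 / 6 * enorm u ^+ 3) y).
  apply: le_Rintegral => //; first exact: integrable_rv_cst.
  move=> y _; have := smooth_taylor2 (F_smooth y) z u.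
  by rewrite dotvC (mulrC 2^-1); apply: le_trans; exact: ler_norm.
rewrite expectation_cst_bounded (RintegralB measurableT i2 (integrable_rvZ 2^-1 ih)).
rewrite (RintegralB measurableT i1 ig).
rewrite (RintegralB measurableT (F_integrable _) (F_integrable _)) !F_mean gE.
rewrite RintegralZl// hE dotvC /quadf; lra.
Qed.

Lemma expectation_le_norm (Z1 Z2 : Xi -> R) (K : R) :
  integrable_rv Z1 -> integrable_rv Z2 -> (forall y, `|Z1 y - Z2 y| <= K) ->
  `|\int[mu]_y Z1 y - \int[mu]_y Z2 y| <= K.
Proof.
move=> i1 i2 le; rewrite -RintegralB//.
have iB := integrable_rvB i1 i2.
apply: le_trans (le_normr_Rintegral measurableT iB) _.
rewrite -[leRHS](expectation_cst_bounded (P := mu)).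
apply: le_Rintegral => //; first exact: integrable_rv_norm.
exact: integrable_rv_cst.
Qed.

Lemma expectation_grad_coord_lip x z i :
  `|grad f x i 0 - grad f z i 0| <= L1 * enorm (x - z).
Proof.
have [i1 <-] := expectation_grad x i; have [i2 <-] := expectation_grad z i.
by apply: expectation_le_norm => // y; exact: smooth_grad_coord_lip.
Qed.

Lemma expectation_hess_coord_lip x z i j :
  `|hess f x i j - hess f z i j| <= L2 * enorm (x - z).
Proof.
have [i1 <-] := expectation_hess x i j; have [i2 <-] := expectation_hess z i j.
by apply: expectation_le_norm => // y; exact: smooth_hess_coord_lip.
Qed.

Lemma expectation_hess_sym x : (hess f x)^T = hess f x.
Proof.
apply/matrixP => i j; rewrite mxE -(expectation_hess x j i).2.
rewrite -(expectation_hess x i j).2; apply: eq_Rintegral => y _.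
have /matrixP/(_ i j) := smooth_hess_sym (F_smooth y) L2_ge0 x.
by rewrite [(_^T) i j]mxE.
Qed.

Lemma expectation_hess_bound x v : enorm (hess f x *m v) <= L1 * enorm v.
Proof.
apply: enorm_le_of_dotv => [w w1|]; last by rewrite mulr_ge0// enorm_ge0.
have [iw E] := expectation_dotv_hess x v w.
rewrite dotvC -E -[leRHS](expectation_cst_bounded (P := mu)).
apply: le_Rintegral => //; first exact: integrable_rv_cst.
move=> y _; apply: le_trans (dotv_le _ _) _.
by rewrite w1 mul1r (smooth_hess_bound (F_smooth y) L2_ge0).
Qed.

End ExpectedLoss.
End ExpectedDerivatives.

(** * Decrease of the objective in one step *)

Section Descent.
Context {R : realType} {d : nat} {L1 L2 eps1 eps2 : R} {f : 'cV[R]_d -> R}.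
Hypotheses (L1_gt0 : 0 < L1) (L2_gt0 : 0 < L2).
Hypotheses (eps1_gt0 : 0 < eps1) (eps2_gt0 : 0 < eps2).
Hypothesis taylor1 : forall z u,
  f (z + u) <= f z + dotv (grad f z) u + L1 / 2 * enorm u ^+ 2.
Hypothesis taylor2 : forall z u,
  f (z + u) <= f z + dotv (grad f z) u + quadf (hess f z) u / 2
               + L2 / 6 * enorm u ^+ 3.

Lemma sign_norm (t : R) : `|sign t| = 1.
Proof. by rewrite /sign; case: ifP; rewrite ?normrN normr1. Qed.

Lemma sign_mul (t : R) : sign t * t = `|t|.
Proof.
rewrite /sign; case: ifPn => [t0|]; first by rewrite mul1r ger0_norm.
by rewrite -ltNge => t0; rewrite mulN1r ltr0_norm.
Qed.

Definition curvature_gain (q : R) : R :=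
  - (eps2 ^+ 2 / (2 * L2 ^+ 2)) * q - 11 * eps2 ^+ 3 / (48 * L2 ^+ 2).

Definition gradient_gain (n : R) : R := n ^+ 2 / (4 * L1) - eps1 ^+ 2 / (8 * L1).

(** The constant 11/48 is 1/24 + 1/48 + 1/6: the errors of the sampled gradient
    and Hessian, and the third-order Taylor remainder. *)
Lemma curvature_step (x g v : 'cV[R]_d) (H : 'M[R]_d) : enorm v = 1 ->
  enorm (g - grad f x) <= eps2 ^+ 2 / (24 * L2) ->
  `|quadf (H - hess f x) v| <= eps2 / 24 ->
  f (x - (eps2 / L2 * sign (dotv v g)) *: v) <= f x - curvature_gain (quadf H v).
Proof.
move=> v1 g_err H_err; set s := sign _.
have L2n : L2 != 0 by rewrite gt_eqF.
have e0 : 0 < eps2 / L2 by rewrite divr_gt0.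
have s2 : s ^+ 2 = 1 by rewrite -real_normK ?num_real// /s sign_norm expr1n.
have := taylor2 x (- ((eps2 / L2 * s) *: v)).
rewrite -scaleNr dotvZr quadfZ enormZ v1 mulr1 normrN normrM (gtr0_norm e0).
rewrite /s sign_norm mulr1 -/s sqrrN [(eps2 / L2 * s) ^+ 2]exprMn s2 mulr1.
move/le_trans; apply; rewrite /curvature_gain.
have sg : s * dotv (grad f x) v >= - (eps2 ^+ 2 / (24 * L2)).
  have : s * dotv v g - s * dotv (grad f x) v <= eps2 ^+ 2 / (24 * L2).
    rewrite (dotvC _ v) -mulrBr -dotvBr; apply: le_trans (ler_norm _) _.
    rewrite normrM /s sign_norm mul1r; apply: le_trans (cauchy_schwarz _ _) _.
    by rewrite v1 mul1r.
  by have := normr_ge0 (dotv v g); rewrite -(sign_mul (dotv v g)) -/s; lra.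
have {}sg := ler_wpM2l (ltW e0) sg.
have qH : quadf (hess f x) v <= quadf H v + eps2 / 24.
  by move: H_err; rewrite quadfBl ler_norml; lra.
have {}qH := ler_wpM2l (sqr_ge0 (eps2 / L2)) qH.
have e1 : eps2 / L2 * - (eps2 ^+ 2 / (24 * L2)) = - (eps2 ^+ 3 / L2 ^+ 2 / 24).
  by field.
have e2 : (eps2 / L2) ^+ 2 * (quadf H v + eps2 / 24) =
    (eps2 ^+ 2 / L2 ^+ 2) * quadf H v + eps2 ^+ 3 / L2 ^+ 2 / 24 by field.
have e3 : L2 / 6 * (eps2 / L2) ^+ 3 = eps2 ^+ 3 / L2 ^+ 2 / 6 by field.
have e4 : - (eps2 ^+ 2 / (2 * L2 ^+ 2)) * quadf H v =
    - ((eps2 ^+ 2 / L2 ^+ 2) * quadf H v / 2) by field.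
have e5 : 11 * eps2 ^+ 3 / (48 * L2 ^+ 2) = eps2 ^+ 3 / L2 ^+ 2 * (11 / 48).
  by field.
by move: sg qH; rewrite e1 e2 e3 e4 e5; lra.
Qed.

Lemma gradient_step (x g : 'cV[R]_d) :
  enorm (g - grad f x) ^+ 2 <= eps1 ^+ 2 / 8 ->
  f (x - L1^-1 *: g) <= f x - gradient_gain (enorm g).
Proof.
move=> g_err; have L1n : L1 != 0 by rewrite gt_eqF.
have Li : 0 < L1^-1 by rewrite invr_gt0.
have := taylor1 x (- (L1^-1 *: g)).
rewrite -scaleNr dotvZr enormZ normrN (gtr0_norm Li) => /le_trans; apply.
have expand : dotv (grad f x) g = enorm g ^+ 2 - dotv (g - grad f x) g.
  by rewrite dotvBl enorm_sqr; lra.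
have amgm : dotv (g - grad f x) g <= enorm (g - grad f x) ^+ 2 + enorm g ^+ 2 / 4.
  apply: le_trans (dotv_le _ _) _; rewrite -subr_ge0.
  set a := enorm _; set b := enorm g.
  rewrite (_ : _ - _ = (a - b / 2) ^+ 2) ?sqr_ge0//; by field.
rewrite expand exprMn /gradient_gain.
have {}amgm := ler_wpM2l (ltW Li) (le_trans amgm (lerD g_err (lexx _))).
have e1 : L1 / 2 * (L1^-1 ^+ 2 * enorm g ^+ 2) = L1^-1 * (enorm g ^+ 2 / 2).
  by field.
have e2 : enorm g ^+ 2 / (4 * L1) - eps1 ^+ 2 / (8 * L1) =
   L1^-1 * (enorm g ^+ 2 / 4 - eps1 ^+ 2 / 8) by field.
by rewrite e1 e2; move: amgm; lra.
Qed.

(** Whichever step is chosen gains the larger of the two guaranteed decreases,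
    and one of these is at least [1 / sncg_rate] unless both termination
    conditions hold. *)
Lemma step_gain (x g v : 'cV[R]_d) (H : 'M[R]_d) : enorm v = 1 ->
  enorm (g - grad f x) <= eps2 ^+ 2 / (24 * L2) ->
  enorm (g - grad f x) ^+ 2 <= eps1 ^+ 2 / 8 ->
  `|quadf (H - hess f x) v| <= eps2 / 24 ->
  ~~ ((quadf H v > - (eps2 / 2)) && (enorm g <= eps1)) ->
  f (if curvature_gain (quadf H v) > gradient_gain (enorm g)
     then x - (eps2 / L2 * sign (dotv v g)) *: v else x - L1^-1 *: g)
    <= f x - (sncg_rate L1 L2 eps1 eps2)^-1.
Proof.
move=> v1 ge1 ge2 He; rewrite negb_and -leNgt -ltNge => notest.
have c_step := curvature_step v1 ge1 He; have g_step := gradient_step ge2.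
set c := curvature_gain _ in c_step *; set h := gradient_gain _ in g_step *.
have a0 : 0 < 48 * L2 ^+ 2 / eps2 ^+ 3 by rewrite divr_gt0 ?mulr_gt0 ?exprn_gt0.
have b0 : 0 < 8 * L1 / eps1 ^+ 2 by rewrite divr_gt0 ?mulr_gt0 ?exprn_gt0.
have L2n : L2 != 0 by rewrite gt_eqF.
have L1n : L1 != 0 by rewrite gt_eqF.
have e2n : eps2 != 0 by rewrite gt_eqF.
have e1n : eps1 != 0 by rewrite gt_eqF.
have rate_c : (sncg_rate L1 L2 eps1 eps2)^-1 <= eps2 ^+ 3 / (48 * L2 ^+ 2).
  rewrite -invf_div lef_pV2 ?posrE ?lt_max ?a0//.
  by rewrite /sncg_rate le_max lexx.
have rate_g : (sncg_rate L1 L2 eps1 eps2)^-1 <= eps1 ^+ 2 / (8 * L1).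
  rewrite -invf_div lef_pV2 ?posrE ?lt_max ?b0 ?orbT//.
  by rewrite /sncg_rate le_max lexx orbT.
have gain : (sncg_rate L1 L2 eps1 eps2)^-1 <= Num.max c h.
  case/orP: notest => [q_le|n_gt].
    apply: le_trans rate_c _; rewrite le_max; apply/orP; left.
    rewrite /c /curvature_gain -subr_ge0.
    have p0 : 0 <= eps2 ^+ 2 / (2 * L2 ^+ 2).
      by rewrite divr_ge0 ?sqr_ge0// mulr_ge0// sqr_ge0.
    have := ler_wpM2l p0 q_le.
    have -> : eps2 ^+ 2 / (2 * L2 ^+ 2) * - (eps2 / 2) =
       - (12 * (eps2 ^+ 3 / (48 * L2 ^+ 2))) by field.
    have -> : 11 * eps2 ^+ 3 / (48 * L2 ^+ 2) = 11 * (eps2 ^+ 3 / (48 * L2 ^+ 2)).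
      by rewrite mulrA.
    by lra.
  apply: le_trans rate_g _; rewrite le_max; apply/orP; right.
  have : eps1 ^+ 2 <= enorm g ^+ 2.
    by apply: ler_expn; exact: ltW.
  rewrite /h /gradient_gain -subr_ge0 => le; rewrite -subr_ge0.
  have -> : enorm g ^+ 2 / (4 * L1) - eps1 ^+ 2 / (8 * L1) - eps1 ^+ 2 / (8 * L1)
      = (enorm g ^+ 2 - eps1 ^+ 2) / (4 * L1) by field.
  by rewrite divr_ge0// mulr_ge0// ltW.
case: ifPn => [hc|].
  by apply: le_trans c_step _; rewrite lerD2l lerN2; move: gain; rewrite max_l// ltW.
rewrite -leNgt => ch.
by apply: le_trans g_step _; rewrite lerD2l lerN2; move: gain; rewrite max_r.
Qed.

End Descent.

(** * Estimates along the run *)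

Lemma lipschitz_fieldB {R : realType} {d} {dX} {Xi : measurableType dX}
    (phi : Xi -> 'cV[R]_d -> R) (g : 'cV[R]_d -> R) (K : R) :
  lipschitz_field phi -> (forall z z', `|g z - g z'| <= K * enorm (z - z')) ->
  lipschitz_field (fun y z => phi y z - g z).
Proof.
move=> [mphi [K' lip]] gK; split.
  by move=> z; apply: measurable_funB; [exact: mphi|exact: measurable_cst].
exists (K' + K) => y z z'; rewrite mulrDl.
rewrite (_ : _ - _ = (phi y z - phi y z') - (g z - g z')); last by ring.
by apply: le_trans (ler_normB _ _) _; apply: lerD.
Qed.

Lemma integral_centred {R : realType} {dX} {Xi : measurableType dX}
    {mu : probability Xi R} (Z : Xi -> R) (c : R) :
  integrable_rv (mu := mu) Z -> \int[mu]_y Z y = c ->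
  (\int[mu]_y (Z y - c)%:E = 0)%E.
Proof.
move=> iZ <-; under eq_integral do rewrite EFinB.
have fZ := integrable_fin_num measurableT iZ.
rewrite integralB//; last exact: integrable_rv_cst.
by rewrite integral_cst//= probability_setT mule1 /Rintegral fineK ?subee.
Qed.

Lemma trmx_symB {R : realType} d (B C : 'M[R]_d) :
  B^T = B -> C^T = C -> (B - C)^T = B - C.
Proof. by move=> BT CT; rewrite raddfB /= BT CT. Qed.

Lemma sum_subr_mean {R : realType} m p q (Z : 'I_m -> 'M[R]_(p, q)) c :
  0 < m%:R :> R ->
  \sum_k (Z k - c) = m%:R *: (m%:R^-1 *: (\sum_k Z k) - c).
Proof.
move=> m0; rewrite sumrB sumr_const card_ord scalerBr scalerA.
by rewrite mulfV ?gt_eqF// scale1r scaler_nat.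
Qed.

(** Conditionally on the history, a fresh draw fails with probability at most
    [delta]; integrating over the history preserves the bound. *)
Lemma fresh_failure {R : realType} {dO} {Omega : measurableType dO}
    {P : probability Omega R} {I : eqType} {E : I -> set (set Omega)}
    {dS} {S : measurableType dS} {PS : probability S R} {s : Omega -> S}
    {J : pred I} {i : I} (delta : R) (good : set (history (E := E) J * S)) :
  independent_draws P E -> is_draw P E PS i s -> ~~ J i -> measurable good ->
  (forall t, ((1 - delta)%:E <= PS (xsection good t))%E) ->
  (P [set w | ~ good (to_history J w, s w)] <= delta%:E)%E.
Proof.
move=> sys ds Ji mgood PSgood.
have mC := measurableC mgood.
have mI : measurable_fun setT (fun p => (\1_(~` good) p)%:E : \bar R).
  by apply/measurable_EFinP; exact: measurable_indic.
have I0 p : (0 <= (\1_(~` good) p)%:E :> \bar R)%E by rewrite lee_fin.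
have mB : measurable [set w | ~ good (to_history J w, s w)].
  have mp := measurable_fun_pair (measurable_to_history (J := J) sys)
    (let: And3 ms _ _ := ds in ms).
  exact: (measurable_funT_preimage mp mC).
have -> : P [set w | ~ good (to_history J w, s w)] =
    (\int[P]_w (\1_(~` good) (to_history J w, s w))%:E)%E.
  rewrite -[X in P X]setIT -integral_indic//.
rewrite (freezing sys ds Ji mI I0).
have -> : (\int[P]_w \int[PS]_y (\1_(~` good) (to_history J w, y))%:E =
           \int[P]_w PS (xsection (~` good) (to_history J w)))%E.
  apply: eq_integral => w _.
  exact: (congr1 (fun h => h (to_history J w)) (indic_fubini_tonelli_FE PS mC)).
apply: (@le_trans _ _ (\int[P]_w (cst delta%:E w))%E); last first.
  by rewrite integral_cst//= probability_setT mule1.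
apply: ge0_le_integral => //.
- have mF := measurable_fun_xsection PS mC.
  exact: (measurable_fun_history sys mF).
move=> w _ /=.
have -> : xsection (~` good) (to_history J w) = ~` xsection good (to_history J w).
  by apply/seteqP; split=> y; rewrite /xsection /= !inE.
rewrite probability_setC; last exact: measurable_xsection.
have fg : PS (xsection good (to_history J w)) \is a fin_num.
  by apply: fin_num_measure; exact: measurable_xsection.
move: (PSgood (to_history J w)); rewrite -(fineK fg) -EFinB !lee_fin.
by rewrite lerBlDr addrC -lerBlDr.
Qed.

Lemma ceil_le_nat {R : realType} (x : R) n : (`|Num.ceil x| <= n)%N -> x <= n%:R.
Proof.
rewrite -(ler_nat R) => le; apply: le_trans le.
by rewrite natr_absz intr_norm; apply: le_trans (ceil_ge x) (ler_norm _).
Qed.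

(** The two terms of the maximum in the sample size correspond to the two
    accuracies that the descent and the termination require. *)
Lemma size_S1_accuracy {R : realType} (G L2 eps1 eps2 delta' : R) m :
  0 < L2 -> 0 < eps1 -> 0 < eps2 ->
  (size_S1 G L2 eps1 eps2 delta' <= m)%N ->
  exists e, [/\ 0 < e, e <= eps2 ^+ 2 / (24 * L2), e ^+ 2 <= eps1 ^+ 2 / 8 &
    4 * G ^+ 2 * (1 + 3 * ln (2 / delta') ^+ 2) <= m%:R * e ^+ 2].
Proof.
move=> L20 e10 e20 /ceil_le_nat size_le.
have L2n : L2 != 0 by rewrite gt_eqF.
have e1n : eps1 != 0 by rewrite gt_eqF.
have e2n : eps2 != 0 by rewrite gt_eqF.
set s := ln _ ^+ 2 in size_le *.
have s0 : 0 <= 1 + 3 * s by rewrite addr_ge0// mulr_ge0// sqr_ge0.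
pose a := Num.sqrt (eps1 ^+ 2 / 8); pose b := eps2 ^+ 2 / (24 * L2).
have a2 : a ^+ 2 = eps1 ^+ 2 / 8 by rewrite sqr_sqrtr// divr_ge0// sqr_ge0.
have a0 : 0 < a by rewrite sqrtr_gt0 divr_gt0// exprn_gt0.
have b0 : 0 < b by rewrite divr_gt0 ?mulr_gt0// exprn_gt0.
exists (Num.min a b); split.
- by rewrite lt_min a0.
- by rewrite ge_min lexx orbT.
- by rewrite -a2; apply: ler_expn; [rewrite le_min !ltW|rewrite ge_min lexx].
have [_|_] := leP a b.
  have E : 32 * G ^+ 2 / eps1 ^+ 2 * a ^+ 2 = 4 * G ^+ 2 by rewrite a2; field.
  rewrite -E mulrAC ler_wpM2r ?sqr_ge0//; apply: le_trans size_le.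
  by apply: ler_wpM2r => //; rewrite le_max lexx.
have E : 2304 * G ^+ 2 * L2 ^+ 2 / eps2 ^+ 4 * b ^+ 2 = 4 * G ^+ 2.
  by rewrite /b; field; rewrite ?e2n ?L2n.
rewrite -E mulrAC ler_wpM2r ?sqr_ge0//; apply: le_trans size_le.
by apply: ler_wpM2r => //; rewrite le_max lexx orbT.
Qed.

Lemma size_S2_accuracy {R : realType} (L1 eps2 delta' : R) d m : 0 < eps2 ->
  (size_S2 L1 eps2 d delta' <= m)%N ->
  16 * L1 ^+ 2 * ln (4 * d%:R / delta') <= m%:R * (eps2 / 24) ^+ 2.
Proof.
move=> e20 /ceil_le_nat size_le.
have e2n : eps2 != 0 by rewrite gt_eqF.
have E : 9216 * L1 ^+ 2 / eps2 ^+ 2 * (eps2 / 24) ^+ 2 = 16 * L1 ^+ 2 by field.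
by rewrite -E mulrAC ler_wpM2r ?sqr_ge0.
Qed.

Lemma union_bound {R : realType} {dO} {Omega : measurableType dO}
    {P : probability Omega R} (Q : nat -> Omega -> Prop) (delta : R) K :
  (forall j, exists B, [/\ measurable B, (P B <= delta%:E)%E &
     forall w, ~ B w -> Q j w]) ->
  exists B, [/\ measurable B, (P B <= (K%:R * delta)%:E)%E &
     forall w, ~ B w -> forall j, (0 < j <= K)%N -> Q j w].
Proof.
move=> fail; elim: K => [|K [C [mC PC CQ]]].
  exists set0; split=> //; first by rewrite measure0 mul0r.
  by move=> w _ [].
have [B [mB PB BQ]] := fail K.+1.
exists (C `|` B); split; first exact: measurableU.
  apply: le_trans (measureU2 _ mC mB) _.
  by rewrite -natr1 mulrDl mul1r EFinD; apply: leeD.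
move=> w /not_orP[nC nB] j /andP[j0]; rewrite leq_eqVlt => /orP[/eqP->|jK].
  exact: BQ.
by apply: CQ => //; rewrite j0.
Qed.

Lemma probability_of_failure {R : realType} {dO} {Omega : measurableType dO}
    {P : probability Omega R} (B Q : set Omega) (delta : R) :
  measurable B -> measurable Q -> (P B <= delta%:E)%E ->
  (forall w, ~ B w -> Q w) -> ((1 - delta)%:E <= P Q)%E.
Proof.
move=> mB mQ PB BQ; apply: (@le_trans _ _ (P (~` B))).
  rewrite probability_setC//.
  have fB : P B \is a fin_num by exact: fin_num_measure.
  by move: PB; rewrite -(fineK fB) -EFinB !lee_fin lerD2l lerN2.
by apply: le_measure; rewrite ?inE//; exact: measurableC.
Qed.

Lemma expR_ln_half {R : realType} (x : R) : 0 < x ->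
  expR (- ln (2 / x)) = x / 2.
Proof. by move=> x0; rewrite expRN lnK ?invf_div// posrE divr_gt0. Qed.

(** The test loses at most [eps / 2], the oracle [eps / 2] and sampling
    [eps / 24]. *)
Lemma eigenvalue_margin {R : realType} (eps lf qu lH qv : R) : 0 < eps ->
  qu - lf <= eps / 24 -> lH <= qu -> qv - eps / 2 <= lH -> - (eps / 2) < qv ->
  - (2 * eps) <= lf.
Proof. by lra. Qed.

Section Run.
Context {R : realType} {dS : measure_display} {S : measurableType dS}.
Context {PS : probability S R} {A : pca_algorithm R S}.
Context {dX : measure_display} {Xi : measurableType dX} {mu : probability Xi R}.
Context {d : nat} {F : Xi -> 'cV[R]_d -> R} {f : 'cV[R]_d -> R}.
Context {L1 L2 G eps1 alpha eps2 delta' : R} {x0 : 'cV[R]_d}.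
Context {dO : measure_display} {Omega : measurableType dO}.
Context {P : probability Omega R} {m1 m2 : nat}.
Context {xi1 : nat -> 'I_m1 -> Omega -> Xi} {xi2 : nat -> 'I_m2 -> Omega -> Xi}.
Context {seed : nat -> Omega -> S}.

Let M : sampling_model R := Expectation mu.
Hypothesis draws : @fresh_draws R M dS S PS dO Omega P m1 m2 xi1 xi2 seed.
Hypothesis A_pca : approximate_pca L1 PS A.
Hypotheses (d_gt0 : (0 < d)%N) (m1_gt0 : (0 < m1)%N) (m2_gt0 : (0 < m2)%N).
Hypotheses (L1_gt0 : 0 < L1) (L2_gt0 : 0 < L2) (G_gt0 : 0 < G).
Hypotheses (eps1_gt0 : 0 < eps1) (eps2_gt0 : 0 < eps2).
Hypothesis delta'_01 : 0 < delta' < 1.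
Hypothesis F_smooth : forall y, smooth_component L1 L2 (F y).
Hypothesis F_integrable : forall z, integrable_rv (mu := mu) (F ^~ z).
Hypothesis F_mean : forall z, \int[mu]_y F y z = f z.
Hypothesis F_subexp : forall z,
  (\int[mu]_y (expR (enorm (grad (F y) z - grad f z) / G))%:E <= (expR 1)%:E)%E.

Let L1_ge0 : 0 <= L1 := ltW L1_gt0.
Let L2_ge0 : 0 <= L2 := ltW L2_gt0.

Notation index := ((nat * 'I_m1 + nat * 'I_m2) + nat)%type.
Notation E := (@draw_events R M dS S Omega m1 m2 xi1 xi2 seed).

Lemma draws_independent : independent_draws P E.
Proof.
case: draws => l1 l2 l3 ind; split=> //.
- by move=> [[[j k]|[j k]]|j] _ [B mB <-]; rewrite setTI;
    [exact: (l1 j k B mB).1|exact: (l2 j k B mB).1|exact: (l3 j B mB).1].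
- by move=> [[[j k]|[j k]]|j]; exists setT; rewrite ?setTI//=; exact: measurableT.
- move=> [[[j k]|[j k]]|j] _ _ [B mB <-] [C mC <-]; exists (B `&` C);
    rewrite ?setTI//; exact: measurableI.
Qed.

Lemma is_draw1 j k : is_draw P E mu (inl (inl (j, k))) (xi1 j k).
Proof.
case: draws => /(_ j k) l1 _ _ _; split.
- by move=> _ B mB; rewrite setTI; exact: (l1 B mB).1.
- by move=> B mB; exact: (l1 B mB).2.
- by move=> B mB; exists B; rewrite ?setTI.
Qed.

Lemma is_draw2 j k : is_draw P E mu (inl (inr (j, k))) (xi2 j k).
Proof.
case: draws => _ /(_ j k) l2 _ _; split.
- by move=> _ B mB; rewrite setTI; exact: (l2 B mB).1.
- by move=> B mB; exact: (l2 B mB).2.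
- by move=> B mB; exists B; rewrite ?setTI.
Qed.

Lemma is_draw_seed j : is_draw P E PS (inr j) (seed j).
Proof.
case: draws => _ _ /(_ j) l3 _; split.
- by move=> _ B mB; rewrite setTI; exact: (l3 B mB).1.
- by move=> B mB; exact: (l3 B mB).2.
- by move=> B mB; exists B; rewrite ?setTI.
Qed.

Definition iteration (i : index) : nat :=
  match i with inl (inl (j, _)) | inl (inr (j, _)) | inr j => j end.

Definition past (j : nat) : pred index := fun i => (iteration i < j)%N.

Definition run_x (j : nat) (w : Omega) : 'cV[R]_d :=
  sncg_x A L1 L2 eps1 alpha eps2 delta' F x0
    (fun j k => xi1 j k w) (fun j k => xi2 j k w) (fun j => seed j w) j.
Definition run_v (j : nat) (w : Omega) : 'cV[R]_d :=
  sncg_v A L1 L2 eps1 alpha eps2 delta' F x0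
    (fun j k => xi1 j k w) (fun j k => xi2 j k w) (fun j => seed j w) j.
Definition run_g (j : nat) (w : Omega) : 'cV[R]_d :=
  sub_grad F (fun k => xi1 j k w) (run_x j w).
Definition run_H (j : nat) (w : Omega) : 'M[R]_d :=
  sub_hess F (fun k => xi2 j k w) (run_x j w).
Definition run_acc (j : nat) (w : Omega) : R := sncg_accuracy alpha eps2 (run_g j w).
Definition run_Hs (j : nat) (w : Omega) (k : 'I_m2) : 'M[R]_d :=
  hess (F (xi2 j k w)) (run_x j w).

Lemma run_xS j w : run_x j.+2 w =
  if curvature_gain (L2 := L2) (eps2 := eps2) (quadf (run_H j.+1 w) (run_v j.+1 w)) >
     gradient_gain (L1 := L1) (eps1 := eps1) (enorm (run_g j.+1 w))
  then run_x j.+1 w - (eps2 / L2 * sign (dotv (run_v j.+1 w) (run_g j.+1 w)))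
                      *: run_v j.+1 w
  else run_x j.+1 w - L1^-1 *: run_g j.+1 w.
Proof. by []. Qed.

Lemma grad_field i : lipschitz_field (fun y z => grad (F y) z i 0).
Proof.
split; last by exists L1 => y x z; exact: smooth_grad_coord_lip.
move=> z; have [/integrableP[/measurable_EFinP]] :=
  expectation_grad F_smooth F_integrable F_mean z i.
by [].
Qed.

Lemma hess_field i j : lipschitz_field (fun y z => hess (F y) z i j).
Proof.
split; last by exists L2 => y x z; exact: smooth_hess_coord_lip.
move=> z; have [/integrableP[/measurable_EFinP]] :=
  expectation_hess L2_gt0 F_smooth F_integrable F_mean z i j.
by [].
Qed.

Lemma accuracy_gt0 (g : 'cV[R]_d) : 0 < sncg_accuracy alpha eps2 g.
Proof. by rewrite divr_gt0// lt_max eps2_gt0. Qed.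

Lemma run_pca_input j w : pca_input L1 (run_Hs j w) (run_acc j w) delta'.
Proof.
split=> //; last exact: accuracy_gt0.
move=> k; split; first exact: (smooth_hess_sym (F_smooth _) L2_ge0).
exact: (smooth_spectral_norm_hess (F_smooth _) L1_ge0 L2_ge0).
Qed.

Lemma run_v_unit j w : enorm (run_v j w) = 1.
Proof.
have [_ /(_ d m2 _ _ _ (run_pca_input j w))[+ _]] := A_pca.
by move=> /(_ (seed j w)).
Qed.

Section History.
Context {J : pred index} {j : nat}.
Hypothesis x_meas : @measurable_vec R d _ (history (E := E) J) (run_x j).

Lemma measurable_run_field T (phi : Xi -> 'cV[R]_d -> R)
    (xi : T -> Omega -> Xi) (k : T) (iota : T -> index) :
  lipschitz_field phi -> is_draw P E mu (iota k) (xi k) -> J (iota k) ->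
  @measurable_fun _ _ (history (E := E) J) _ setT (fun w => phi (xi k w) (run_x j w)).
Proof.
move=> [mphi [K lip]] dk Jk; apply: (measurable_caratheodory mphi lip) => //.
exact: (measurable_draw dk Jk).
Qed.

Hypothesis J1 : forall k, J (inl (inl (j, k))).
Hypothesis J2 : forall k, J (inl (inr (j, k))).

Lemma measurable_run_g : @measurable_vec R d _ (history (E := E) J) (run_g j).
Proof.
move=> i; rewrite /run_g /sub_grad.
under eq_fun do rewrite mxE summxE.
apply: measurable_funM => //; apply: measurable_sum => k.
exact: (measurable_run_field (xi := xi1 j) (iota := fun k => inl (inl (j, k)))
  (grad_field i) (is_draw1 j k) (J1 k)).
Qed.

Lemma measurable_run_Hs k : @measurable_mx R d _ (history (E := E) J)
  (fun w => run_Hs j w k).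
Proof.
move=> i i'.
exact: (measurable_run_field (xi := xi2 j) (iota := fun k => inl (inr (j, k)))
  (hess_field i i') (is_draw2 j k) (J2 k)).
Qed.

Lemma measurable_run_H : @measurable_mx R d _ (history (E := E) J) (run_H j).
Proof.
move=> i i'; rewrite /run_H /sub_hess /mean_mx.
under eq_fun do rewrite mxE summxE.
apply: measurable_funM => //; apply: measurable_sum => k.
exact: measurable_run_Hs.
Qed.

Lemma measurable_run_acc :
  @measurable_fun _ _ (history (E := E) J) _ setT (run_acc j).
Proof.
have mg := measurable_enorm measurable_run_g.
apply: measurable_funM => //; apply: measurable_maxr => //.
exact: (measurableT_comp (@measurable_powR R alpha) mg).
Qed.

Definition oracle (p : history (E := E) J * S) : 'cV[R]_d :=
  A (run_Hs j p.1) (run_acc j p.1) delta' p.2.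

Lemma measurable_oracle : measurable_vec oracle.
Proof.
have [mA _] := A_pca => i.
apply: (mA d m2 delta' _ (history (E := E) J) (run_Hs j) (run_acc j)).
- by move=> w; exact: run_pca_input.
- by move=> k i' j'; exact: measurable_run_Hs.
- exact: measurable_run_acc.
Qed.

Hypothesis J3 : J (inr j).

Lemma measurable_run_v : @measurable_vec R d _ (history (E := E) J) (run_v j).
Proof.
move=> i; have mp : measurable_fun setT
    (fun w : history (E := E) J => (w, seed j w) : history (E := E) J * S).
  by apply: measurable_fun_pair => //; exact: (measurable_draw (is_draw_seed j) J3).
exact: (measurableT_comp (measurable_oracle i) mp).
Qed.

End History.

Lemma run_x_adapted j : adapted E (past j) (run_x j).
Proof.
case: j => [|j]; first by move=> J _ i; exact: measurable_cst.
elim: j => [|j IH] J pastJ; first by move=> i; exact: measurable_cst.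
have Jj i : (iteration i <= j.+1)%N -> J i by move=> ij; exact: pastJ.
have mx : @measurable_vec R d _ (history (E := E) J) (run_x j.+1).
  by apply: IH => i ij; apply: Jj; exact: ltnW.
have J1 k : J (inl (inl (j.+1, k))) by exact: Jj.
have J2 k : J (inl (inr (j.+1, k))) by exact: Jj.
have J3 : J (inr j.+1) by exact: Jj.
have mg := measurable_run_g mx J1.
have mH := measurable_run_H mx J2.
have mv := measurable_run_v mx J1 J2 J3.
have mq := measurable_quadf mH mv.
have mn := measurable_enorm mg.
have md := measurable_dotv mv mg.
move=> i; under eq_fun do rewrite run_xS (fun_if (fun u : 'cV_d => u i 0)).
apply: measurable_fun_ifT.
- apply: measurable_fun_ltr.
    by apply: measurable_funB => //; apply: measurable_funM => //; exact: measurable_funX.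
  by apply: measurable_funB => //; exact: measurable_funM.
- apply: (measurable_vecB mx); apply: measurable_vecZ => //.
  apply: measurable_funM => //; rewrite /sign.
  by apply: measurable_fun_ifT => //; exact: measurable_fun_ler.
- by apply: (measurable_vecB mx); exact: measurable_vecZ.
Qed.

Lemma run_x_measurable j : @measurable_vec R d _ (history (E := E) predT) (run_x j).
Proof. exact: (@run_x_adapted j predT). Qed.

Lemma gradient_failure j (e s : R) : 0 < e -> ln 2 <= s ->
  4 * G ^+ 2 * (1 + 3 * s ^+ 2) <= m1%:R * e ^+ 2 ->
  exists B, [/\ measurable B, (P B <= (expR (- s))%:E)%E &
    forall w, ~ B w -> enorm (run_g j w - grad f (run_x j w)) <= e].
Proof.
move=> e0 s2 m1_ge.
pose Y y z := grad (F y) z - grad f z.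
have YE y z i : Y y z i 0 = grad (F y) z i 0 - grad f z i 0.
  by rewrite /Y [LHS]mxE [(- grad f z) i 0]mxE.
have Y_field i : lipschitz_field (fun y z => Y y z i 0).
  have -> : (fun y z => Y y z i 0) = (fun y z => grad (F y) z i 0 - grad f z i 0).
    by apply/funext => y; apply/funext => z; exact: YE.
  apply: (lipschitz_fieldB (g := fun z => grad f z i 0) (K := L1) (grad_field i)).
  move=> z z'.
  exact: (expectation_grad_coord_lip F_smooth F_integrable F_mean z z' i).
have Y_centred z i : (\int[mu]_y (Y y z i 0)%:E = 0)%E.
  have [ig gE] := expectation_grad F_smooth F_integrable F_mean z i.
  under eq_integral do rewrite YE.
  exact: (integral_centred ig gE).
have iota_inj : injective (fun k : 'I_m1 => inl (inl (j, k)) : index).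
  by move=> k k' [].
have J0 k : ~~ past j (inl (inl (j, k)) : index) by rewrite /past /= ltnn.
have sys := draws_independent.
pose B := [set w | m1%:R * e < enorm (\sum_k Y (xi1 j k w) (run_x j w))].
have mB : measurable B.
  apply: measurable_lt_set => //; apply: measurable_enorm.
  exact: (measurable_sum_draws sys (is_draw1 j) (@run_x_adapted j) Y_field).
exists B; split=> //.
  exact: (vector_concentration sys (is_draw1 j) iota_inj J0 (@run_x_adapted j)
    Y_field Y_centred G_gt0 F_subexp m1_gt0 e0 s2 m1_ge).
move=> w /negP; rewrite -leNgt.
have mR : 0 < m1%:R :> R by rewrite ltr0n.
have -> : \sum_k Y (xi1 j k w) (run_x j w) =
    m1%:R *: (run_g j w - grad f (run_x j w)).
  exact: (sum_subr_mean (fun k => grad (F (xi1 j k w)) (run_x j w))).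
by rewrite enormZ gtr0_norm// ler_pM2l.
Qed.

Lemma hessian_failure j (t l : R) : 0 < t -> 1 <= l ->
  16 * L1 ^+ 2 * l <= m2%:R * t ^+ 2 ->
  exists B, [/\ measurable B, (P B <= (2 * d%:R * expR (- l))%:E)%E &
    forall w v, ~ B w -> enorm v = 1 ->
      `|quadf (run_H j w - hess f (run_x j w)) v| <= t].
Proof.
move=> t0 l1 m2_ge.
pose X y z := hess (F y) z - hess f z.
have XE y z i i' : X y z i i' = hess (F y) z i i' - hess f z i i'.
  by rewrite /X [LHS]mxE [(- hess f z) i i']mxE.
have X_field i i' : lipschitz_field (fun y z => X y z i i').
  have -> : (fun y z => X y z i i') = (fun y z => hess (F y) z i i' - hess f z i i').
    by apply/funext => y; apply/funext => z; exact: XE.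
  apply: (lipschitz_fieldB (g := fun z => hess f z i i') (K := L2) (hess_field i i')).
  move=> z z'.
  exact: (expectation_hess_coord_lip L2_gt0 F_smooth F_integrable F_mean z z' i i').
have X_centred z i i' : (\int[mu]_y (X y z i i')%:E = 0)%E.
  have [ih hE] := expectation_hess L2_gt0 F_smooth F_integrable F_mean z i i'.
  under eq_integral do rewrite XE.
  exact: (integral_centred ih hE).
have X_sym y z : (X y z)^T = X y z.
  apply: trmx_symB; first exact: (smooth_hess_sym (F_smooth y) L2_ge0).
  exact: (expectation_hess_sym L2_gt0 F_smooth F_integrable F_mean).
have X_bound y z v : enorm (X y z *m v) <= 2 * L1 * enorm v.
  rewrite /X mulmxBl; apply: le_trans (ler_enormD _ _) _; rewrite enormN.
  have h1 := smooth_hess_bound (F_smooth y) L2_ge0 z v.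
  have h2 := expectation_hess_bound L1_gt0 L2_gt0 F_smooth F_integrable F_mean z v.
  by apply: le_trans (lerD h1 h2) _; rewrite -mulrA mulr_natl.
have iota_inj : injective (fun k : 'I_m2 => inl (inr (j, k)) : index).
  by move=> k k' [].
have J0 k : ~~ past j (inl (inr (j, k)) : index) by rewrite /past /= ltnn.
have K0 : 0 < 2 * L1 by rewrite mulr_gt0.
have m2_ge' : 4 * (2 * L1) ^+ 2 * l <= m2%:R * t ^+ 2.
  by apply: le_trans m2_ge; rewrite !expr2; lra.
have [B [mB PB HB]] := matrix_concentration draws_independent (is_draw2 j)
  iota_inj J0 (@run_x_adapted j) X_field X_centred X_sym X_bound
  m2_gt0 d_gt0 K0 t0 l1 m2_ge'.
exists B; split=> // w v Bw v1.
have : `|quadf (\sum_k X (xi2 j k w) (run_x j w)) v| <= m2%:R * t.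
  exact: (HB w v Bw v1).
have mR : 0 < m2%:R :> R by rewrite ltr0n.
have -> : \sum_k X (xi2 j k w) (run_x j w) = m2%:R *: (run_H j w - hess f (run_x j w)).
  exact: (sum_subr_mean (fun k => hess (F (xi2 j k w)) (run_x j w))).
by rewrite /quadf -scalemxAl dotvZr normrM gtr0_norm// ler_pM2l.
Qed.

Lemma run_H_sym j w : (run_H j w)^T = run_H j w.
Proof.
rewrite /run_H /sub_hess /mean_mx linearZ /= linear_sum /=; congr (_ *: _).
by apply: eq_bigr => k _; exact: (smooth_hess_sym (F_smooth _) L2_ge0).
Qed.

Lemma oracle_failure j : exists B, [/\ measurable B, (P B <= delta'%:E)%E &
  forall w, ~ B w ->
    quadf (run_H j w) (run_v j w) - run_acc j w <= lambda_min (run_H j w)].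
Proof.
(* The input of the oracle depends on the past and on the samples of this
   iteration, that is, on draws other than its seed. *)
pose J : pred index := fun i => i != inr j.
have Js : ~~ J (inr j) by rewrite /J eqxx.
have mx : @measurable_vec R d _ (history (E := E) J) (run_x j).
  apply: run_x_adapted => i; rewrite /past /J.
  by apply: contraTneq => ->; rewrite /= ltnn.
have J1 k : J (inl (inl (j, k))) by [].
have J2 k : J (inl (inr (j, k))) by [].
have mH := measurable_run_H mx J2.
have macc := measurable_run_acc mx J1.
have mo := measurable_oracle mx J1 J2.
pose good := [set p : history (E := E) J * S |
  quadf (run_H j p.1) (oracle (j := j) p) - run_acc j p.1 <= lambda_min (run_H j p.1)].
have mgood : measurable good.
  have mH1 : measurable_mx (fun p : history (E := E) J * S => run_H j p.1).
    by move=> i i'; exact: (measurableT_comp (mH i i') measurable_fst).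
  have mc : measurable_fun setT (fun p : history (E := E) J * S =>
      quadf (run_H j p.1) (oracle (j := j) p) - run_acc j p.1).
    apply: measurable_funB; last exact: (measurableT_comp macc measurable_fst).
    exact: (measurable_quadf mH1 mo).
  exact: (measurable_lambda_min_ge d_gt0 mH1 (fun p => run_H_sym j p.1) mc).
pose B : set Omega := [set w | ~ good (to_history J w, seed j w)].
have mpair : measurable_fun setT
    (fun w => (to_history J w, seed j w) : history (E := E) J * S).
  apply: measurable_fun_pair; first exact: (measurable_to_history draws_independent).
  by case: (is_draw_seed j).
have mB : measurable B.
  exact: (measurable_funT_preimage mpair (measurableC mgood)).
exists B; split=> //; last by move=> w /contrapT.
apply: (fresh_failure draws_independent (is_draw_seed j) Js mgood) => t.
have [_ /(_ d m2 _ _ _ (run_pca_input j t))[_ le]] := A_pca.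
have -> : xsection good t = [set y | good (t, y)].
  by apply/seteqP; split=> y; rewrite /xsection /= inE.
exact: le.
Qed.

Definition run_test (j : nat) (w : Omega) : bool :=
  (quadf (run_H j w) (run_v j w) > - (eps2 / 2)) && (enorm (run_g j w) <= eps1).

Definition run_stops (j : nat) (w : Omega) : Prop :=
  [/\ (0 < j)%N, run_test j w & forall i, (0 < i < j)%N -> ~~ run_test i w].

Definition accurate_sampling (j : nat) (w : Omega) : Prop :=
  [/\ enorm (run_g j w - grad f (run_x j w)) <= eps2 ^+ 2 / (24 * L2),
      enorm (run_g j w - grad f (run_x j w)) ^+ 2 <= eps1 ^+ 2 / 8 &
      forall v, enorm v = 1 ->
        `|quadf (run_H j w - hess f (run_x j w)) v| <= eps2 / 24].

Notation rate := (sncg_rate L1 L2 eps1 eps2).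

Lemma rate_gt0 : 0 < rate.
Proof.
rewrite /sncg_rate lt_max; apply/orP; left.
by rewrite divr_gt0 ?mulr_gt0 ?exprn_gt0.
Qed.

Lemma run_descent w K :
  (forall j, (0 < j <= K)%N -> accurate_sampling j w) ->
  (forall j, (0 < j <= K)%N -> ~~ run_test j w) ->
  f (run_x K.+1 w) <= f x0 - K%:R / rate.
Proof.
elim: K => [|K IH] acc notest; first by rewrite mul0r subr0.
have lt j : (0 < j <= K)%N -> (0 < j <= K.+1)%N by case/andP=> -> /leqW.
have {}IH := IH (fun j jK => acc j (lt j jK)) (fun j jK => notest j (lt j jK)).
have KK : (0 < K.+1 <= K.+1)%N by rewrite /=.
have [g1 g2 hH] := acc K.+1 KK.
have v1 := run_v_unit K.+1 w.
rewrite run_xS.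
apply: le_trans (step_gain L1_gt0 L2_gt0 eps1_gt0 eps2_gt0
  (expectation_taylor1 F_smooth F_integrable F_mean)
  (expectation_taylor2 L2_gt0 F_smooth F_integrable F_mean)
  v1 g1 g2 (hH _ v1) (notest K.+1 KK)) _.
by rewrite -natr1 mulrDl mul1r opprD addrA lerD2r.
Qed.

(** Otherwise the objective would fall below its minimum. *)
Lemma run_stops_by w K (fmin : R) : (forall z, fmin <= f z) ->
  f x0 - fmin < K%:R / rate ->
  (forall j, (0 < j <= K)%N -> accurate_sampling j w) ->
  exists2 j, run_stops j w & (j <= K)%N.
Proof.
move=> f_min K_gt acc.
have [ex|nex] := pselect (exists j, (0 < j <= K)%N && run_test j w).
  have [m /andP[/andP[m0 mK] mtest] m_min] := ex_minnP ex.
  exists m => //; split=> // i /andP[i0 im]; apply/negP => ti.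
  have iK : (0 < i <= K)%N by rewrite i0 (leq_trans (ltnW im) mK).
  by have := m_min i; rewrite iK ti => /(_ isT); rewrite leqNgt im.
have notest j : (0 < j <= K)%N -> ~~ run_test j w.
  by move=> jK; apply/negP => tj; apply: nex; exists j; rewrite jK.
have := run_descent acc notest; have := f_min (run_x K.+1 w).
by move: K_gt; lra.
Qed.

Hypothesis alpha_ge0 : 0 <= alpha.
Hypothesis eps2E : eps2 = eps1 `^ alpha.

(** At termination the accuracy asked from the oracle is [eps2 / 2], since the
    sampled gradient is at most [eps1]. *)
Lemma run_stop_quality w j : accurate_sampling j w -> run_test j w ->
  quadf (run_H j w) (run_v j w) - run_acc j w <= lambda_min (run_H j w) ->
  enorm (grad f (run_x j w)) <= 2 * eps1 /\
  - (2 * eps2) <= lambda_min (hess f (run_x j w)).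
Proof.
move=> [_ g2 hH] /andP[q_gt g_le] oracle_ok.
split.
  have e_le : enorm (run_g j w - grad f (run_x j w)) <= eps1.
    rewrite -ler_sqr ?nnegrE ?enorm_ge0 ?(ltW eps1_gt0)//.
    apply: le_trans g2 _.
    by have := sqr_ge0 eps1; lra.
  have := ler_enormD (run_g j w) (- (run_g j w - grad f (run_x j w))).
  rewrite enormN opprB addrC subrK => le.
  by apply: le_trans le _; lra.
have acc_eq : run_acc j w = eps2 / 2.
  rewrite /run_acc /sncg_accuracy max_l// eps2E.
  by apply: ge0_ler_powR; rewrite ?nnegrE ?enorm_ge0// ltW.
have hT := expectation_hess_sym L2_gt0 F_smooth F_integrable F_mean (run_x j w).
have [[u u1 hu] _ _] := lambda_min_attained d_gt0 hT.
have [_ _ /(_ u) Hu] := lambda_min_attained d_gt0 (run_H_sym j w).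
have := hH u u1; rewrite quadfBl hu ler_norml => /andP[_ lf].
move: Hu; rewrite -enorm_sqr u1 expr1n mulr1 => Hu.
by apply: (eigenvalue_margin eps2_gt0 lf Hu _ q_gt); rewrite -acc_eq.
Qed.

Lemma measurable_run_test j : measurable [set w | run_test j w].
Proof.
have mx := run_x_measurable j.
have mg := measurable_enorm (measurable_run_g mx (fun=> isT)).
have mH := measurable_run_H mx (fun=> isT).
have mv := measurable_run_v mx (fun=> isT) (fun=> isT) isT.
have mq := measurable_quadf mH mv.
have {}mq : measurable_fun setT (fun w => quadf (run_H j w) (run_v j w)).
  exact: (measurable_fun_history draws_independent mq).
have {}mg : measurable_fun setT (fun w => enorm (run_g j w)).
  exact: (measurable_fun_history draws_independent mg).
apply: measurable_bool_set; apply: measurable_and.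
  exact: (measurable_fun_ltr (measurable_cst _) mq).
exact: (measurable_fun_ler mg (measurable_cst _)).
Qed.

Lemma measurable_run_stops j : measurable [set w | run_stops j w].
Proof.
have -> : [set w | run_stops j w] = [set w | (0 < j)%N /\ run_test j w] `&`
    [set w | forall i, (0 < i < j)%N -> ~~ run_test i w].
  by apply/seteqP; split=> w /=; [case|case=> -[]].
apply: measurableI.
  have [j0|] := boolP (0 < j)%N; last first.
    by move/negP => nj; rewrite (_ : [set w | _] = set0)//; apply/seteqP; split=> w [].
  rewrite (_ : [set w | _] = [set w | run_test j w]); first exact: measurable_run_test.
  by apply/seteqP; split=> w // [].
apply: measurable_forall => i; have [ij|ij] := boolP (0 < i < j)%N.
  rewrite (_ : [set w | _] = ~` [set w | run_test i w]).
    exact: measurableC (measurable_run_test i).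
  by apply/seteqP; split=> w /=; [move=> /(_ isT)/negP|move=> /negP].
by rewrite (_ : [set w | _] = setT)//; apply/seteqP; split.
Qed.

Lemma measurable_run_quality j : measurable
  [set w | enorm (grad f (run_x j w)) <= 2 * eps1 /\
           - (2 * eps2) <= lambda_min (hess f (run_x j w))].
Proof.
have mx : measurable_vec (fun w : Omega => run_x j w).
  move=> i; exact: (measurable_fun_history draws_independent (run_x_measurable j i)).
have mg : measurable_vec (fun w => grad f (run_x j w)).
  move=> i; apply: (measurable_caratheodory (phi := fun (_ : Omega) x => grad f x i 0)
    (K := L1) (z := id) _ _ (@measurable_id _ _ _) mx) => [x|_ x y].
    exact: measurable_cst.
  exact: (expectation_grad_coord_lip F_smooth F_integrable F_mean x y i).
have mh : measurable_mx (fun w => hess f (run_x j w)).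
  move=> i i'; apply: (measurable_caratheodory
    (phi := fun (_ : Omega) x => hess f x i i')
    (K := L2) (z := id) _ _ (@measurable_id _ _ _) mx) => [x|_ x y].
    exact: measurable_cst.
  exact: (expectation_hess_coord_lip L2_gt0 F_smooth F_integrable F_mean x y i i').
have hT w := expectation_hess_sym L2_gt0 F_smooth F_integrable F_mean (run_x j w).
apply: measurableI.
  by apply: measurable_le_set; [exact: measurable_enorm|exact: measurable_cst].
exact: (measurable_lambda_min_ge d_gt0 mh hT (measurable_cst _)).
Qed.

Hypothesis size1 : (size_S1 G L2 eps1 eps2 delta' <= m1)%N.
Hypothesis size2 : (size_S2 L1 eps2 d delta' <= m2)%N.

Lemma sampling_failure j : exists B, [/\ measurable B, (P B <= delta'%:E)%E &
  forall w, ~ B w -> accurate_sampling j w].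
Proof.
have /andP[dl0 dl1] := delta'_01.
have [e [e0 e_le e2_le m1_ge]] := size_S1_accuracy L2_gt0 eps1_gt0 eps2_gt0 size1.
have m2_ge := size_S2_accuracy eps2_gt0 size2.
have s_ge : ln 2 <= ln (2 / delta').
  by rewrite ler_ln ?posrE ?divr_gt0// ler_pdivlMr// ler_piMr// ltW.
have d1 : 1 <= d%:R :> R by rewrite ler1n.
have l_ge : 1 <= ln (4 * d%:R / delta').
  have le4 : 4 <= 4 * d%:R / delta'.
    rewrite ler_pdivlMr//; apply: (@le_trans _ _ (4 * 1)).
      by rewrite ler_wpM2l// ltW.
    by rewrite ler_wpM2l.
  apply: (@le_trans _ _ (ln 4)); last by rewrite ler_ln// posrE// (lt_le_trans _ le4).
  have -> : 4 = 2 * 2 :> R by ring.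
  by rewrite lnM ?posrE//; have := @ln2_ge R; lra.
have t0 : 0 < eps2 / 24 by rewrite divr_gt0.
have [B [mB PB HB]] := gradient_failure j e0 s_ge m1_ge.
have [C [mC PC HC]] := hessian_failure j t0 l_ge m2_ge.
exists (B `|` C); split; first exact: measurableU.
  apply: le_trans (measureU2 _ mB mC) _.
  have -> : delta' = delta' / 2 + delta' / 2 by field.
  rewrite EFinD; apply: leeD.
    by apply: le_trans PB _; rewrite lee_fin expR_ln_half.
  apply: le_trans PC _; rewrite lee_fin expRN lnK ?posrE; last first.
    by rewrite divr_gt0// mulr_gt0// ltr0n.
  have dn : d%:R != 0 :> R by rewrite pnatr_eq0 -lt0n.
  have dln : delta' != 0 by rewrite gt_eqF.
  rewrite (_ : 2 * d%:R * _ = delta' / 2)//; field.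
  by rewrite ?dn ?dln.
move=> w /not_orP[nB nC]; have g_le := HB w nB.
split; first exact: le_trans g_le e_le.
  by apply: le_trans e2_le; apply: ler_expn => //; exact: enorm_ge0.
by move=> v v1; exact: HC.
Qed.

Context {Delta delta fmin : R}.
Hypothesis f_min : forall z, fmin <= f z.
Hypothesis f_gap : f x0 - fmin <= Delta.
Notation N := (1 + rate * Delta).
Hypothesis delta'E : delta' * N = delta.

(* The least number of iterations whose total decrease would exceed [Delta]. *)
Let K : nat := (Num.truncn (rate * Delta)).+1.

Let rateDelta_ge0 : 0 <= rate * Delta.
Proof.
rewrite mulr_ge0 ?(ltW rate_gt0)//; apply: le_trans f_gap.
by rewrite subr_ge0.
Qed.

Let K_le : K%:R <= N.
Proof. by rewrite /K -natr1 addrC lerD2l truncn_le. Qed.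

Let K_gt : f x0 - fmin < K%:R / rate.
Proof.
rewrite ltr_pdivlMr ?rate_gt0// mulrC; apply: le_lt_trans (truncnS_gt _).
by rewrite ler_pM2l ?rate_gt0.
Qed.

Let K_delta' : K%:R * delta' <= delta.
Proof.
have /andP[dl0 _] := delta'_01.
by rewrite -delta'E mulrC; apply: ler_wpM2l => //; exact: ltW.
Qed.

(** Only inaccurate sampling can delay termination: the objective decreases
    whichever unit vector the oracle returns. *)
Lemma run_terminates_whp :
  ((1 - delta)%:E <= P [set w | exists j, run_stops j w /\ (j%:R <= N)%R])%E.
Proof.
have [B [mB PB acc]] := union_bound K sampling_failure.
apply: (probability_of_failure mB).
- have -> : [set w | exists j, run_stops j w /\ j%:R <= N] =
      \bigcup_j [set w | run_stops j w /\ j%:R <= N].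
    by apply/seteqP; split=> w; [move=> [j]; exists j|move=> [j _]; exists j].
  apply: bigcupT_measurable => j.
  have [jN|jN] := boolP (j%:R <= N).
    rewrite (_ : [set w | _] = [set w | run_stops j w]).
      exact: measurable_run_stops.
    by apply/seteqP; split=> w // [].
  rewrite (_ : [set w | _] = set0)//.
  by apply/seteqP; split=> w // [_] jN'; case/negP: jN.
- by apply: le_trans PB _; rewrite lee_fin.
move=> w /acc{}acc; have [j stop jK] := run_stops_by f_min K_gt acc.
by exists j; split=> //; apply: le_trans K_le; rewrite ler_nat.
Qed.

Lemma run_quality_whp :
  ((1 - 3 * delta)%:E <= P [set w | exists j,
    [/\ run_stops j w, (enorm (grad f (run_x j w)) <= 2 * eps1)%R &
        (lambda_min (hess f (run_x j w)) >= - (2 * eps2))%R]])%E.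
Proof.
have /andP[dl0 _] := delta'_01.
have [B [mB PB acc]] := union_bound K sampling_failure.
have [C [mC PC orc]] := union_bound K oracle_failure.
have mBC := measurableU _ _ mB mC.
apply: (probability_of_failure mBC).
- rewrite (_ : [set w | _] = \bigcup_j ([set w | run_stops j w] `&`
      [set w | enorm (grad f (run_x j w)) <= 2 * eps1 /\
           - (2 * eps2) <= lambda_min (hess f (run_x j w))])).
    apply: bigcupT_measurable => j; apply: measurableI.
      exact: measurable_run_stops.
    exact: measurable_run_quality.
  by apply/seteqP; split=> w; [move=> [j [a b c]]; exists j|move=> [j _ [a [b c]]]; exists j].
- apply: le_trans (measureU2 _ mB mC) _.
  apply: le_trans (leeD PB PC) _; rewrite -EFinD lee_fin.
  have : 0 <= K%:R * delta' by rewrite mulr_ge0// ltW.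
  by move: K_delta'; lra.
move=> w /not_orP[/acc{}acc /orc{}orc].
have [j stop jK] := run_stops_by f_min K_gt acc.
have [j0 test _] := stop; have j0K : (0 < j <= K)%N by rewrite j0.
have [q1 q2] := run_stop_quality (acc j j0K) test (orc j j0K).
by exists j.
Qed.

End Run.

(** * Running time *)

Lemma ceil_le_succ {R : realType} (x : R) : 0 <= x -> `|Num.ceil x|%N%:R <= 1 + x.
Proof.
move=> x0; have c0 : 0 <= Num.ceil x by rewrite ceil_ge0 (lt_le_trans _ x0)// ltrN10.
rewrite natr_absz ger0_norm// addrC -lerBlDr.
by have /andP[+ _] := ceil_itv x; move/ltW; rewrite intrB.
Qed.

(** Weighted arithmetic-geometric mean: with [z = m `^ (1 / 4)], the product
    [z ^+ 3 * y] is at most [z ^+ 4] or [y ^+ 4]. *)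
Lemma powR_young {R : realType} (m y : R) : 0 <= m -> 0 <= y ->
  m `^ (3 / 4) * y <= m + y ^+ 4.
Proof.
move=> m0 y0; pose z := m `^ (1 / 4); have z0 : 0 <= z by exact: powR_ge0.
have z3 : m `^ (3 / 4) = z ^+ 3.
  by rewrite /z -powR_mulrn// -powRrM; congr (_ `^ _); field.
have z4 : m = z ^+ 4.
  rewrite /z -powR_mulrn// -powRrM (_ : 1 / 4 * 4%:R = 1) ?powRr1//; by field.
rewrite z3 [leRHS](_ : _ = z ^+ 4 + y ^+ 4); last by rewrite -z4.
have [yz|/ltW zy] := leP y z.
  apply: (@le_trans _ _ (z ^+ 4)); last by rewrite lerDl exprn_ge0.
  by rewrite [leRHS]exprSr ler_wpM2l// exprn_ge0.
apply: (@le_trans _ _ (y ^+ 4)); last by rewrite lerDr exprn_ge0.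
by rewrite [leRHS]exprSr ler_wpM2r//; exact: ler_expn.
Qed.

Lemma max_mul_le {R : realType} (c e x y : R) :
  0 <= c -> 0 <= e -> 0 <= x -> 0 <= y ->
  Num.max (c * x) (e * y) <= (c + e) * Num.max x y.
Proof.
move=> c0 e0 x0 y0; have m0 : 0 <= Num.max x y by rewrite le_max x0.
rewrite mulrDl ge_max; apply/andP; split.
  apply: (@le_trans _ _ (c * Num.max x y)); last by rewrite lerDl mulr_ge0.
  by rewrite ler_wpM2l// le_max lexx.
apply: (@le_trans _ _ (e * Num.max x y)); last by rewrite lerDr mulr_ge0.
by rewrite ler_wpM2l// le_max lexx orbT.
Qed.

Lemma div1rX {R : realType} (x : R) n : 1 / x ^+ n = x^-1 ^+ n.
Proof. by rewrite div1r exprVn. Qed.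

Lemma div1rXM {R : realType} (x y : R) n k :
  1 / (x ^+ n * y ^+ k) = x^-1 ^+ n * y^-1 ^+ k.
Proof. by rewrite div1r invfM !exprVn. Qed.

Section Time.
Context {R : realType} {L1 L2 G Delta CA : R} {pA : nat}.
Hypotheses (L1_gt0 : 0 < L1) (Delta_ge0 : 0 <= Delta).
Context {d : nat} {delta eps1 eps2 : R}.
Hypothesis d_gt0 : (0 < d)%N.
Hypothesis delta_01 : 0 < delta < 1.
Hypotheses (eps1_01 : 0 < eps1 < 1) (eps2_01 : 0 < eps2 < 1).

Let eps1_gt0 : 0 < eps1. Proof. by case/andP: eps1_01. Qed.
Let eps2_gt0 : 0 < eps2. Proof. by case/andP: eps2_01. Qed.
Let delta_gt0 : 0 < delta. Proof. by case/andP: delta_01. Qed.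

Notation N := (1 + sncg_rate L1 L2 eps1 eps2 * Delta).
Notation delta' := (delta / N).
Notation m1 := (size_S1 G L2 eps1 eps2 delta').
Notation m2 := (size_S2 L1 eps2 d delta').
Notation Lambda := (1 + ln d%:R + ln delta^-1 + ln eps1^-1 + ln eps2^-1).

Definition rate_coef : R := 48 * L2 ^+ 2 + 8 * L1.
Definition iter_coef : R := 1 + rate_coef * Delta.
Definition log_coef : R := iter_coef + 7.
Definition grad_coef : R := (32 * G ^+ 2 + 2304 * G ^+ 2 * L2 ^+ 2) * (1 + 3 * log_coef ^+ 2).
Definition hess_coef : R := 9216 * L1 ^+ 2 * log_coef.
Definition iterations : R := Num.max (eps2^-1 ^+ 3) (eps1^-1 ^+ 2).

Lemma inv_ge1 (x : R) : 0 < x < 1 -> 1 <= x^-1.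
Proof. by case/andP=> x0 x1; rewrite invf_ge1// ltW. Qed.

Let eps1V_ge1 : 1 <= eps1^-1 := inv_ge1 eps1_01.
Let eps2V_ge1 : 1 <= eps2^-1 := inv_ge1 eps2_01.
Let deltaV_ge1 : 1 <= delta^-1 := inv_ge1 delta_01.
Let eps1V_ge0 : 0 <= eps1^-1 := le_trans ler01 eps1V_ge1.
Let eps2V_ge0 : 0 <= eps2^-1 := le_trans ler01 eps2V_ge1.

Let ln_d_ge0 : 0 <= ln d%:R :> R. Proof. by rewrite ln_ge0// ler1n. Qed.
Let ln_delta_ge0 : 0 <= ln delta^-1. Proof. exact: ln_ge0. Qed.
Let ln_eps1_ge0 : 0 <= ln eps1^-1. Proof. exact: ln_ge0. Qed.
Let ln_eps2_ge0 : 0 <= ln eps2^-1. Proof. exact: ln_ge0. Qed.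

Lemma Lambda_ge1 : 1 <= Lambda.
Proof. by move: ln_d_ge0 ln_delta_ge0 ln_eps1_ge0 ln_eps2_ge0; lra. Qed.

Let rate_coef_ge0 : 0 <= rate_coef.
Proof.
by rewrite addr_ge0// mulr_ge0// ?sqr_ge0// ltW.
Qed.

Let iter_coef_ge1 : 1 <= iter_coef.
Proof. by rewrite lerDl mulr_ge0. Qed.

Let iterations_ge1 : 1 <= iterations.
Proof. by rewrite le_max exprn_ege1. Qed.

Lemma rate_le : sncg_rate L1 L2 eps1 eps2 <= rate_coef * iterations.
Proof.
rewrite /sncg_rate -!exprVn; apply: max_mul_le.
- by rewrite mulr_ge0// sqr_ge0.
- by rewrite mulr_ge0// ltW.
- exact: exprn_ge0.
- exact: exprn_ge0.
Qed.

Lemma rate_ge0 : 0 <= sncg_rate L1 L2 eps1 eps2.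
Proof.
rewrite /sncg_rate le_max; apply/orP; right.
by rewrite divr_ge0// ?exprn_ge0// ?mulr_ge0// ltW.
Qed.

Lemma N_ge1 : 1 <= N.
Proof. by rewrite lerDl mulr_ge0// rate_ge0. Qed.

Let N_gt0 : 0 < N := lt_le_trans ltr01 N_ge1.

Lemma N_le : N <= iter_coef * iterations.
Proof.
rewrite mulrDl mul1r; apply: lerD => //.
by rewrite mulrAC; apply: ler_wpM2r => //; exact: rate_le.
Qed.

Lemma delta'_gt0 : 0 < delta'. Proof. exact: divr_gt0. Qed.

Lemma delta'_lt1 : delta' < 1.
Proof.
case/andP: delta_01 => _ d1.
by rewrite ltr_pdivrMr// mul1r (lt_le_trans d1)// N_ge1.
Qed.

Lemma ln_le_self (x : R) : 0 < x -> ln x <= x.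
Proof. by move=> x0; apply: le_trans (ltW (ln_sublinear x0)) _. Qed.

(** The failure probability [delta'] is polynomial in the other parameters, so
    its logarithm is absorbed in the soft-O. *)
Lemma ln_delta'_le : ln delta'^-1 <= (iter_coef + 3) * Lambda.
Proof.
have P3 : 0 < eps2^-1 ^+ 3 by rewrite exprn_gt0// invr_gt0.
have P2 : 0 < eps1^-1 ^+ 2 by rewrite exprn_gt0// invr_gt0.
have c0 : 0 < iter_coef by exact: lt_le_trans iter_coef_ge1.
have le : N <= iter_coef * (eps2^-1 ^+ 3 * eps1^-1 ^+ 2).
  apply: le_trans N_le _; apply: ler_wpM2l; first exact: ltW.
  rewrite ge_max ler_peMr ?ler_peMl ?exprn_ege1//; exact: ltW.
rewrite invf_div lnM ?posrE ?invr_gt0//.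
have lnN : ln N <= iter_coef + (3 * ln eps2^-1 + 2 * ln eps1^-1).
  apply: (@le_trans _ _ (ln (iter_coef * (eps2^-1 ^+ 3 * eps1^-1 ^+ 2)))).
    have PP := mulr_gt0 c0 (mulr_gt0 P3 P2).
    by rewrite (ler_ln N_gt0 PP).
  rewrite (lnM c0 (mulr_gt0 P3 P2)) (lnM P3 P2) !lnXn ?invr_gt0//.
  rewrite -[ln eps2^-1 *+ 3]mulr_natl -[ln eps1^-1 *+ 2]mulr_natl lerD2r.
  exact: ln_le_self.
have cL : iter_coef <= iter_coef * Lambda by rewrite ler_peMr ?Lambda_ge1// ltW.
apply: le_trans (lerD lnN (lexx _)) _; rewrite [leRHS]mulrDl.
by move: cL ln_d_ge0 ln_delta_ge0 ln_eps1_ge0 ln_eps2_ge0; lra.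
Qed.

Let log_le (x : R) : 0 < x -> x <= 4 * d%:R / delta' -> ln x <= log_coef * Lambda.
Proof.
move=> x0 x_le; have dR : 0 < d%:R :> R by rewrite ltr0n.
have L := Lambda_ge1; have := ln_delta'_le.
have : ln x <= ln 4 + ln d%:R + ln delta'^-1.
  rewrite -lnM ?posrE// -lnM ?posrE ?invr_gt0 ?delta'_gt0 ?mulr_gt0//.
  by rewrite ler_ln ?posrE// (lt_le_trans x0).
have : ln 4 <= 4 :> R by exact: ln_le_self.
have -> : log_coef * Lambda = (iter_coef + 3) * Lambda + 4 * Lambda.
  by rewrite /log_coef; ring.
by move: L ln_d_ge0 ln_delta_ge0 ln_eps1_ge0 ln_eps2_ge0; lra.
Qed.

Let log_coef_ge0 : 0 <= log_coef.
Proof. by rewrite addr_ge0// (le_trans ler01). Qed.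

Lemma size_S1_le : m1%:R <=
  (1 + grad_coef) * Num.max (eps1^-1 ^+ 2) (eps2^-1 ^+ 4) * Lambda ^+ 2.
Proof.
have L := Lambda_ge1; have L0 : 0 <= Lambda := le_trans ler01 L.
have L2_ge1 : 1 <= Lambda ^+ 2 by exact: exprn_ege1.
have d1 : 1 <= d%:R :> R by rewrite ler1n.
have dp := delta'_gt0; have dp1 := ltW delta'_lt1.
have log_ge0 : 0 <= ln (2 / delta').
  by rewrite ln_ge0// ler_pdivlMr// mul1r; lra.
have log_sq : 1 + 3 * ln (2 / delta') ^+ 2 <= (1 + 3 * log_coef ^+ 2) * Lambda ^+ 2.
  have : ln (2 / delta') ^+ 2 <= (log_coef * Lambda) ^+ 2.
    apply: ler_expn => //; apply: log_le; first by rewrite divr_gt0.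
    by rewrite ler_pM2r ?invr_gt0//; lra.
  by rewrite exprMn mulrDl mul1r -mulrA; move: L2_ge1; lra.
pose c := 32 * G ^+ 2; pose e := 2304 * G ^+ 2 * L2 ^+ 2.
have c0 : 0 <= c by rewrite mulr_ge0// sqr_ge0.
have e0 : 0 <= e.
  by apply: mulr_ge0 (sqr_ge0 L2); apply: mulr_ge0 (sqr_ge0 G); exact: ler0n.
set u := Num.max (eps1^-1 ^+ 2) _.
have u1 : 1 <= u by rewrite le_max exprn_ege1.
have u0 : 0 <= u by exact: le_trans u1.
have max_le : Num.max (c / eps1 ^+ 2) (e / eps2 ^+ 4) <= (c + e) * u.
  by rewrite -!exprVn; apply: max_mul_le => //; exact: exprn_ge0.
have s0 : 0 <= 1 + 3 * ln (2 / delta') ^+ 2 by rewrite addr_ge0// mulr_ge0// sqr_ge0.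
have max0 : 0 <= Num.max (c / eps1 ^+ 2) (e / eps2 ^+ 4).
  by rewrite le_max divr_ge0// sqr_ge0.
apply: le_trans (ceil_le_succ _) _; first exact: mulr_ge0.
rewrite -[leRHS]mulrA [leRHS]mulrDl mul1r; apply: lerD.
  by rewrite -[leLHS]mulr1; apply: ler_pM.
apply: le_trans (ler_pM max0 s0 max_le log_sq) _.
by rewrite /grad_coef -/c -/e le_eqVlt; apply/orP; left; apply/eqP; ring.
Qed.

Lemma size_S2_le : m2%:R <= (1 + hess_coef) * eps2^-1 ^+ 2 * Lambda.
Proof.
have L := Lambda_ge1; have dp := delta'_gt0; have dp1 := ltW delta'_lt1.
have d1 : 1 <= d%:R :> R by rewrite ler1n.
pose c := 9216 * L1 ^+ 2.
have c0 : 0 <= c by apply: mulr_ge0 (sqr_ge0 L1); exact: ler0n.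
have a0 : 0 < 4 * d%:R / delta' by rewrite divr_gt0// mulr_gt0// ltr0n.
have log_ge0 : 0 <= ln (4 * d%:R / delta').
  by rewrite ln_ge0// ler_pdivlMr// mul1r; lra.
have x0 : 0 <= c / eps2 ^+ 2 * ln (4 * d%:R / delta').
  by apply: mulr_ge0 log_ge0; exact: divr_ge0 c0 (sqr_ge0 _).
apply: le_trans (ceil_le_succ x0) _.
rewrite -[leRHS]mulrA [leRHS]mulrDl mul1r; apply: lerD.
  by rewrite -[leLHS]mulr1; apply: ler_pM => //; exact: exprn_ege1.
rewrite -exprVn -/c /hess_coef -/c -[leLHS]mulrA -[leRHS]mulrA; apply: ler_wpM2l => //.
rewrite mulrCA; apply: ler_wpM2l; first exact: exprn_ge0.
exact: log_le.
Qed.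

Lemma size_S2_gt0 : (0 < m2)%N.
Proof.
have d1 : 1 <= d%:R :> R by rewrite ler1n.
have log_gt0 : 0 < ln (4 * d%:R / delta').
  rewrite ln_gt0// ltr_pdivlMr ?delta'_gt0// mul1r.
  by move: delta'_lt1; lra.
have c0 : 0 < 9216 * L1 ^+ 2 / eps2 ^+ 2.
  apply: divr_gt0; last exact: exprn_gt0.
  by apply: mulr_gt0; [exact: ltr0Sn|exact: exprn_gt0].
rewrite /size_S2 absz_gt0; apply: lt0r_neq0; rewrite ceil_gt0.
exact: mulr_gt0 c0 log_gt0.
Qed.

(** By [powR_young] the second argument of the maximum is at most
    [m2 + (L1 / acc) ^+ 2], and both terms are of order [eps2 ^- 2]. *)
Lemma oracle_time_le (acc : R) : eps2 / 2 <= acc ->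
  (1 + ln d%:R + ln delta'^-1 + Num.max 0 (ln acc^-1)) ^+ pA *
  Num.max m2%:R (m2%:R `^ (3 / 4) * Num.sqrt (L1 / acc)) <=
  log_coef ^+ pA * (1 + hess_coef + 4 * L1 ^+ 2) *
    (eps2^-1 ^+ 2 * Lambda ^+ pA.+1).
Proof.
move=> acc_ge; have L := Lambda_ge1.
have L0 : 0 <= Lambda := le_trans ler01 L.
have acc0 : 0 < acc by apply: lt_le_trans acc_ge; rewrite divr_gt0.
have accV : acc^-1 <= 2 * eps2^-1.
  by rewrite -[leRHS]invf_div ?lef_pV2 ?posrE ?divr_gt0// invrK mulrC.
have log_acc : Num.max 0 (ln acc^-1) <= 2 + ln eps2^-1.
  rewrite ge_max addr_ge0//=.
  apply: (@le_trans _ _ (ln (2 * eps2^-1))).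
    by rewrite ler_ln ?posrE ?invr_gt0 ?mulr_gt0 ?invr_gt0.
  by rewrite lnM ?posrE ?invr_gt0// lerD2r; exact: ln_le_self.
have polylog : 1 + ln d%:R + ln delta'^-1 + Num.max 0 (ln acc^-1) <= log_coef * Lambda.
  have -> : log_coef * Lambda = (iter_coef + 3) * Lambda + 4 * Lambda.
    by rewrite /log_coef; ring.
  have := ln_delta'_le.
  by move: L log_acc ln_d_ge0 ln_delta_ge0 ln_eps1_ge0 ln_eps2_ge0; lra.
have polylog0 : 0 <= 1 + ln d%:R + ln delta'^-1 + Num.max 0 (ln acc^-1).
  have : 0 <= ln delta'^-1.
    by rewrite ln_ge0// invf_ge1 ?delta'_gt0// ltW// delta'_lt1.
  have : 0 <= Num.max 0 (ln acc^-1) by rewrite le_max lexx.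
  by move: ln_d_ge0; lra.
have e2 : 0 <= eps2^-1 ^+ 2 by exact: exprn_ge0.
have y4 : Num.sqrt (L1 / acc) ^+ 4 <= 4 * L1 ^+ 2 * eps2^-1 ^+ 2.
  have q0 : 0 <= L1 / acc by rewrite divr_ge0// ltW.
  rewrite (exprM _ 2 2) sqr_sqrtr// (_ : 4 * _ * _ = (L1 * (2 * eps2^-1)) ^+ 2).
    by apply: ler_expn => //; rewrite ler_wpM2l// ltW.
  by ring.
have max_le : Num.max m2%:R (m2%:R `^ (3 / 4) * Num.sqrt (L1 / acc)) <=
    (1 + hess_coef + 4 * L1 ^+ 2) * (eps2^-1 ^+ 2 * Lambda).
  have young := powR_young (ler0n R m2) (sqrtr_ge0 (L1 / acc)).
  have sum_le : m2%:R + Num.sqrt (L1 / acc) ^+ 4 <=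
      (1 + hess_coef + 4 * L1 ^+ 2) * (eps2^-1 ^+ 2 * Lambda).
    rewrite [leRHS]mulrDl; apply: lerD.
      by rewrite mulrA; exact: size_S2_le.
    apply: le_trans y4 _; apply: ler_wpM2l; last by rewrite ler_peMr.
    by rewrite mulr_ge0// sqr_ge0.
  rewrite ge_max; apply/andP; split; last exact: le_trans young sum_le.
  by apply: le_trans sum_le; rewrite lerDl exprn_ge0// sqrtr_ge0.
have max0 : 0 <= Num.max m2%:R (m2%:R `^ (3 / 4) * Num.sqrt (L1 / acc)).
  by rewrite le_max ler0n.
have pow_le := ler_expn pA polylog0 polylog.
apply: le_trans (ler_pM (exprn_ge0 _ polylog0) max0 pow_le max_le) _.
rewrite [(log_coef * Lambda) ^+ pA]exprMn [Lambda ^+ pA.+1]exprS.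
by rewrite le_eqVlt; apply/orP; left; apply/eqP; ring.
Qed.

Definition oracle_coef : R := log_coef ^+ pA * (1 + hess_coef + 4 * L1 ^+ 2).
Definition step_coef : R := 2 + grad_coef + hess_coef + `|CA| * oracle_coef.

Let grad_coef_ge0 : 0 <= grad_coef.
Proof.
apply: mulr_ge0; last by rewrite addr_ge0// mulr_ge0// sqr_ge0.
apply: addr_ge0; first by apply: mulr_ge0 (sqr_ge0 _).
by apply: mulr_ge0 (sqr_ge0 L2); apply: mulr_ge0 (sqr_ge0 G); exact: ler0n.
Qed.

Let hess_coef_ge0 : 0 <= hess_coef.
Proof.
by apply: mulr_ge0 log_coef_ge0; apply: mulr_ge0 (sqr_ge0 L1); exact: ler0n.
Qed.

Let oracle_coef_ge0 : 0 <= oracle_coef.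
Proof. by rewrite mulr_ge0 ?exprn_ge0// !addr_ge0// mulr_ge0// sqr_ge0. Qed.

Let step_coef_ge0 : 0 <= step_coef.
Proof. by rewrite !addr_ge0// mulr_ge0. Qed.

Lemma iterations_grad : iterations * Num.max (eps1^-1 ^+ 2) (eps2^-1 ^+ 4) <=
  Num.max (Num.max (1 / eps1 ^+ 4) (1 / (eps1 ^+ 2 * eps2 ^+ 3)))
          (Num.max (1 / eps2 ^+ 7) (1 / (eps1 ^+ 2 * eps2 ^+ 4))).
Proof.
rewrite !div1rXM !div1rX /iterations.
set a := eps1^-1; set b := eps2^-1.
have -> : a ^+ 4 = a ^+ 2 * a ^+ 2 by ring.
have -> : b ^+ 7 = b ^+ 3 * b ^+ 4 by ring.
have [_|_] := leP (b ^+ 3) (a ^+ 2); have [_|_] := leP (a ^+ 2) (b ^+ 4);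
  by rewrite !le_max 1?[b ^+ 3 * a ^+ 2]mulrC lexx ?orbT.
Qed.

Lemma iterations_hess : iterations * eps2^-1 ^+ 2 <=
  Num.max (1 / (eps1 ^+ 2 * eps2 ^+ 2)) (1 / eps2 ^+ 5).
Proof.
rewrite !div1rXM !div1rX /iterations.
set a := eps1^-1; set b := eps2^-1.
have -> : b ^+ 5 = b ^+ 3 * b ^+ 2 by ring.
by have [_|_] := leP (b ^+ 3) (a ^+ 2); rewrite !le_max lexx ?orbT.
Qed.

Context {S : Type} {A : pca_algorithm R S} {tA : pca_runtime R S}.
Hypothesis tA_le : pca_time_bound L1 tA CA pA.
Context {X : Type} {F : X -> 'cV[R]_d -> R} {x0 : 'cV[R]_d} {alpha Tg Th : R}.
Hypotheses (L2_gt0 : 0 < L2) (Tg_ge0 : 0 <= Tg) (Th_ge0 : 0 <= Th).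
Hypothesis F_smooth : forall y, smooth_component L1 L2 (F y).

Lemma step_time_le (z2 : 'I_m2 -> X) (g x : 'cV[R]_d) s :
  m1%:R * Tg +
  tA Th (fun k => hess (F (z2 k)) x) (sncg_accuracy alpha eps2 g) delta' s +
  m2%:R * Th <=
  step_coef * Lambda ^+ pA.+2 *
  (Th * eps2^-1 ^+ 2 + Tg * Num.max (eps1^-1 ^+ 2) (eps2^-1 ^+ 4)).
Proof.
set acc := sncg_accuracy _ _ _.
have acc_ge : eps2 / 2 <= acc.
  by rewrite /acc /sncg_accuracy ler_pM2r ?invr_gt0// le_max lexx.
have input : pca_input L1 (fun k => hess (F (z2 k)) x) acc delta'.
  split=> //.
  - exact: size_S2_gt0.
  - move=> k; split; first exact: (smooth_hess_sym (F_smooth _) (ltW L2_gt0)).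
    exact: (smooth_spectral_norm_hess (F_smooth _) (ltW L1_gt0) (ltW L2_gt0)).
  - by apply: lt_le_trans acc_ge; rewrite divr_gt0.
  - by rewrite delta'_gt0 delta'_lt1.
have tA_step := tA_le s Th_ge0 input.
have L := Lambda_ge1; have L0 := le_trans ler01 L.
set u := Num.max (eps1^-1 ^+ 2) _; set h := eps2^-1 ^+ 2.
have u0 : 0 <= u by rewrite le_max sqr_ge0.
have h0 : 0 <= h by exact: sqr_ge0.
have oracle : tA Th (fun k => hess (F (z2 k)) x) acc delta' s <=
    `|CA| * oracle_coef * (Lambda ^+ pA.+2 * (Th * h)).
  apply: le_trans tA_step _.
  rewrite -mulrA; apply: le_trans (_ : `|CA| * (Th * (oracle_coef * (h * Lambda ^+ pA.+1))) <= _).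
    have le := oracle_time_le acc_ge.
    have := ler_wpM2l Th_ge0 le; rewrite mulrCA => {}le.
    apply: le_trans (ler_wpM2l (normr_ge0 CA) le).
    apply: ler_wpM2r; last exact: ler_norm.
    rewrite mulr_ge0 ?exprn_ge0//; last by rewrite mulr_ge0// le_max ler0n.
    have : 0 <= ln delta'^-1.
      by rewrite ln_ge0// invf_ge1 ?delta'_gt0// ltW// delta'_lt1.
    have : 0 <= Num.max 0 (ln acc^-1) by rewrite le_max lexx.
    by move: ln_d_ge0; lra.
  rewrite -[leRHS]mulrA; apply: ler_wpM2l => //.
  rewrite [leRHS](_ : _ = Th * (oracle_coef * (h * Lambda ^+ pA.+2))); last by ring.
  do 3 apply: ler_wpM2l => //.
  by rewrite [leRHS]exprS ler_peMl// exprn_ge0.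
have LpA n : (n <= 2)%N -> Lambda ^+ n <= Lambda ^+ pA.+2.
  by move=> n2; apply: ler_weXn2l => //; exact: leq_trans n2 _.
have grad_part : m1%:R * Tg <= (1 + grad_coef) * (Lambda ^+ pA.+2 * (Tg * u)).
  apply: le_trans (ler_wpM2r Tg_ge0 size_S1_le) _; rewrite -/u.
  rewrite [leLHS](_ : _ = (1 + grad_coef) * (Lambda ^+ 2 * (Tg * u))); last by ring.
  apply: ler_wpM2l; first by rewrite addr_ge0.
  by apply: ler_wpM2r; [rewrite mulr_ge0|exact: LpA].
have hess_part : m2%:R * Th <= (1 + hess_coef) * (Lambda ^+ pA.+2 * (Th * h)).
  apply: le_trans (ler_wpM2r Th_ge0 size_S2_le) _; rewrite -/h.
  rewrite [leLHS](_ : _ = (1 + hess_coef) * (Lambda ^+ 1 * (Th * h))); last first.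
    by rewrite expr1; ring.
  apply: ler_wpM2l; first by rewrite addr_ge0.
  by apply: ler_wpM2r; [rewrite mulr_ge0|exact: LpA].
set U := Lambda ^+ pA.+2 * (Tg * u) in grad_part.
set V := Lambda ^+ pA.+2 * (Th * h) in oracle hess_part.
have P0 : 0 <= Lambda ^+ pA.+2 by exact: exprn_ge0.
have U0 : 0 <= U by rewrite mulr_ge0// mulr_ge0.
have V0 : 0 <= V by rewrite mulr_ge0// mulr_ge0.
apply: le_trans (lerD (lerD grad_part oracle) hess_part) _.
have c0 : 0 <= `|CA| * oracle_coef by exact: mulr_ge0.
rewrite -[leRHS]mulrA mulrDr -/U -/V -subr_ge0.
rewrite /step_coef [leRHS](_ : _ = (1 + hess_coef + `|CA| * oracle_coef) * U
  + (1 + grad_coef) * V); last by ring.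
by apply: addr_ge0; apply: mulr_ge0 => //; rewrite !addr_ge0.
Qed.

Lemma sncg_time_le z1 (z2 : nat -> 'I_m2 -> X) s j : j%:R <= N ->
  sncg_time (m1 := m1) A tA Tg Th L1 L2 eps1 alpha eps2 delta' F x0 z1 z2 s j <=
  iter_coef * step_coef * Lambda ^+ pA.+2 *
  (Th * Num.max (1 / (eps1 ^+ 2 * eps2 ^+ 2)) (1 / eps2 ^+ 5) +
   Tg * Num.max (Num.max (1 / eps1 ^+ 4) (1 / (eps1 ^+ 2 * eps2 ^+ 3)))
                (Num.max (1 / eps2 ^+ 7) (1 / (eps1 ^+ 2 * eps2 ^+ 4)))).
Proof.
move=> jN; rewrite /sncg_time.
pose Q := Th * eps2^-1 ^+ 2 + Tg * Num.max (eps1^-1 ^+ 2) (eps2^-1 ^+ 4).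
have step i := step_time_le (z2 i)
  (sub_grad F (z1 i) (sncg_x A L1 L2 eps1 alpha eps2 delta' F x0 z1 z2 s i))
  (sncg_x A L1 L2 eps1 alpha eps2 delta' F x0 z1 z2 s i) (s i).
have L0 : 0 <= Lambda := le_trans ler01 Lambda_ge1.
pose c := step_coef * Lambda ^+ pA.+2.
have c0 : 0 <= c by rewrite mulr_ge0// exprn_ge0.
have Q0 : 0 <= Q.
  apply: addr_ge0; first exact: mulr_ge0 Th_ge0 (sqr_ge0 _).
  by apply: mulr_ge0 Tg_ge0 _; rewrite le_max sqr_ge0.
have ic0 : 0 <= iter_coef := le_trans ler01 iter_coef_ge1.
apply: (@le_trans _ _ (\sum_(1 <= i < j.+1) c * Q)).
  by apply: ler_sum => i _; exact: step.
rewrite sumr_const_nat subn1 -[leLHS]mulr_natl /=.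
apply: (@le_trans _ _ (iter_coef * iterations * (c * Q))).
  by apply: ler_wpM2r; [exact: mulr_ge0|exact: le_trans jN N_le].
rewrite [leLHS](_ : _ = iter_coef * c * (iterations * Q)); last by ring.
rewrite [iter_coef * step_coef * _](_ : _ = iter_coef * c); last by rewrite /c; ring.
apply: ler_wpM2l; first exact: mulr_ge0.
rewrite mulrDr; apply: lerD; rewrite mulrCA; apply: ler_wpM2l => //.
  exact: iterations_hess.
exact: iterations_grad.
Qed.

End Time.

(** * The uniform law on a finite index set *)

Definition discrete_index (n : nat) : Type := 'I_n.+1.

HB.instance Definition _ n := Choice.on (discrete_index n).
HB.instance Definition _ n := isPointed.Build (discrete_index n) ord0.
HB.instance Definition _ n := @isMeasurable.Build default_measure_display
  (discrete_index n) discrete_measurable discrete_measurable0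
  discrete_measurableC discrete_measurableU.

Section UniformLaw.
Context {R : realType} {n : nat}.
Notation T := (discrete_index n).

Let weight_ge0 : 0 <= n.+1%:R^-1 :> R. Proof. by rewrite invr_ge0. Qed.

Definition uniform_law : set T -> \bar R :=
  msum (fun k => mscale (NngNum weight_ge0) (dirac (inord k : T))) n.+1.

HB.instance Definition _ := Measure.on uniform_law.

Lemma uniform_lawE (B : set T) :
  uniform_law B = (\sum_(i < n.+1 | i \in B) n.+1%:R^-1)%:E.
Proof.
rewrite /uniform_law /msum [in RHS]big_mkcond /= -sumEFin.
apply: eq_bigr => i _; rewrite /mscale /= diracE inord_val.
by case: (i \in B); rewrite /= ?mule1 ?mule0.
Qed.

Let uniform_law_setT : uniform_law setT = 1%E.
Proof.
rewrite uniform_lawE (eq_bigl xpredT) => [|i]; last by rewrite in_setT.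
by rewrite sumr_const card_ord -[X in X%:E]mulr_natr mulVf ?pnatr_eq0.
Qed.

HB.instance Definition _ :=
  Measure_isProbability.Build _ _ _ uniform_law uniform_law_setT.

Lemma bounded_rv_discrete (h : T -> R) : bounded_rv h.
Proof.
split; first by [].
exists (\sum_(i : 'I_n.+1) `|h i|) => w.
by rewrite (bigD1 (w : 'I_n.+1))//= lerDl sumr_ge0.
Qed.

Lemma uniform_integral (h : T -> R) :
  \int[uniform_law]_y h y = n.+1%:R^-1 * \sum_(i : 'I_n.+1) h i.
Proof.
have hE y : h y = \sum_(i : 'I_n.+1) h i * \1_[set (i : T)] y.
  rewrite (bigD1 (y : 'I_n.+1))//= indicE in_set1 eqxx mulr1 big1 ?addr0// => i iy.
  by rewrite indicE in_set1 eq_sym (negbTE iy) mulr0.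
under eq_Rintegral do rewrite hE.
rewrite expectation_sum_bounded; last by move=> i; exact: bounded_rv_discrete.
rewrite mulr_sumr; apply: eq_bigr => i _.
rewrite RintegralZl//; last first.
  by apply: bounded_rv_integrable; exact: bounded_rv_discrete.
rewrite mulrC; congr (_ * _).
rewrite /Rintegral integral_indic// setIT.
rewrite -[X in fine X]/(uniform_law [set (i : T)]) uniform_lawE.
rewrite (eq_bigl (pred1 i)) => [|k]; last by rewrite in_set1.
by rewrite big_pred1_eq.
Qed.

Lemma uniform_integralE (h : T -> R) :
  (\int[uniform_law]_y (h y)%:E = (n.+1%:R^-1 * \sum_(i : 'I_n.+1) h i)%:E)%E.
Proof.
rewrite -uniform_integral /Rintegral fineK//.
apply: (@integrable_fin_num _ _ _ uniform_law setT measurableT (EFin \o h)).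
by apply: bounded_rv_integrable; exact: bounded_rv_discrete.
Qed.

End UniformLaw.

Lemma size_S1_gt0 {R : realType} (G L2 eps1 eps2 delta' : R) :
  0 < G -> 0 < eps1 -> (0 < size_S1 G L2 eps1 eps2 delta')%N.
Proof.
move=> G0 e0; rewrite /size_S1 absz_gt0; apply: lt0r_neq0; rewrite ceil_gt0.
apply: mulr_gt0; last by rewrite ltr_pwDl// mulr_ge0// sqr_ge0.
rewrite lt_max; apply/orP; left; apply: divr_gt0; last exact: exprn_gt0.
by apply: mulr_gt0 => //; exact: exprn_gt0.
Qed.

Lemma in01_powR {R : realType} (x a : R) : 0 < x < 1 -> 0 < a -> 0 < x `^ a < 1.
Proof.
case/andP=> x0 x1 a0; rewrite powR_gt0//=.
have -> : 1 = 1 `^ a :> R by rewrite powR1.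
by apply: gt0_ltr_powR; rewrite ?nnegrE// ltW.
Qed.

(** * The guarantees *)

Section Guarantees.
Context {R : realType} {L1 L2 G Delta : R}.
Context {dS : measure_display} {S : measurableType dS} {PS : probability S R}.
Context {A : pca_algorithm R S} {d : nat} {f : 'cV[R]_d -> R}.
Context {x0 xstar : 'cV[R]_d} {delta eps1 alpha : R}.
Hypotheses (L1_gt0 : 0 < L1) (L2_gt0 : 0 < L2) (G_gt0 : 0 < G).
Hypotheses (A_pca : approximate_pca L1 PS A) (d_gt0 : (0 < d)%N).
Hypotheses (xstar_min : forall x, f xstar <= f x) (f_gap : f x0 - f xstar <= Delta).
Hypotheses (delta_01 : 0 < delta < 1) (eps1_01 : 0 < eps1 < 1).
Hypothesis alpha_01 : 0 < alpha <= 1.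

Let eps2 := eps1 `^ alpha.
Let N := 1 + sncg_rate L1 L2 eps1 eps2 * Delta.
Let delta' := delta / N.
Let m1 := size_S1 G L2 eps1 eps2 delta'.
Let m2 := size_S2 L1 eps2 d delta'.

Context {dO : measure_display} {Omega : measurableType dO}.
Context {P : probability Omega R}.

Definition sncg_guarantees (X : Type) (F : X -> 'cV[R]_d -> R)
    (xi1 : nat -> 'I_m1 -> Omega -> X) (xi2 : nat -> 'I_m2 -> Omega -> X)
    (seed : nat -> Omega -> S) : Prop :=
  let x_ w := sncg_x A L1 L2 eps1 alpha eps2 delta' F x0
    (fun j k => xi1 j k w) (fun j k => xi2 j k w) (fun j => seed j w) in
  let stops w := sncg_stops A L1 L2 eps1 alpha eps2 delta' F x0
    (fun j k => xi1 j k w) (fun j k => xi2 j k w) (fun j => seed j w) in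
  ((1 - delta)%:E <=
     P [set w | exists j : nat, stops w j /\ (j%:R <= N)%R])%E /\
  ((1 - 3 * delta)%:E <=
     P [set w | exists j : nat,
       [/\ stops w j, (enorm (grad f (x_ w j)) <= 2 * eps1)%R &
           (lambda_min (hess f (x_ w j)) >= - (2 * eps2))%R]])%E.

Let Delta_ge0 : 0 <= Delta.
Proof. by apply: le_trans f_gap; rewrite subr_ge0. Qed.

Let eps1_gt0 : 0 < eps1. Proof. by case/andP: eps1_01. Qed.
Let eps2_01 : 0 < eps2 < 1.
Proof. by case/andP: alpha_01 => a0 _; exact: in01_powR. Qed.

Lemma sncg_guarantees_law (dX : measure_display) (Xi : measurableType dX)
    (mu : probability Xi R) (F : Xi -> 'cV[R]_d -> R)
    (xi1 : nat -> 'I_m1 -> Omega -> Xi) (xi2 : nat -> 'I_m2 -> Omega -> Xi)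
    (seed : nat -> Omega -> S) :
  @fresh_draws R (Expectation mu) dS S PS dO Omega P m1 m2 xi1 xi2 seed ->
  (forall y, smooth_component L1 L2 (F y)) ->
  (forall z, integrable_rv (mu := mu) (F ^~ z)) ->
  (forall z, \int[mu]_y F y z = f z) ->
  (forall z, (\int[mu]_y (expR (enorm (grad (F y) z - grad f z) / G))%:E
              <= (expR 1)%:E)%E) ->
  sncg_guarantees F xi1 xi2 seed.
Proof.
move=> draws F_smooth F_int F_mean F_subexp.
have /andP[eps2_gt0 _] := eps2_01; have /andP[alpha_gt0 _] := alpha_01.
have dl01 : 0 < delta' < 1.
  apply/andP; split; first exact: (delta'_gt0 L1_gt0 Delta_ge0 delta_01 eps1_01).
  exact: (delta'_lt1 L1_gt0 Delta_ge0 delta_01 eps1_01).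
have m1_gt0 : (0 < m1)%N by exact: size_S1_gt0.
have m2_gt0 : (0 < m2)%N.
  exact: (size_S2_gt0 L1_gt0 Delta_ge0 d_gt0 delta_01 eps1_01 eps2_01).
have N_ge : 1 <= N by exact: (N_ge1 L1_gt0 Delta_ge0 eps1_01).
have dE : delta' * N = delta.
  by rewrite /delta' mulfVK// gt_eqF// (lt_le_trans ltr01).
split.
- exact: (run_terminates_whp (alpha := alpha) draws A_pca d_gt0 m1_gt0 m2_gt0 L1_gt0 L2_gt0
    G_gt0 eps1_gt0 eps2_gt0 dl01 F_smooth F_int F_mean F_subexp (leqnn _)
    (leqnn _) xstar_min f_gap dE).
- exact: (run_quality_whp (alpha := alpha) draws A_pca d_gt0 m1_gt0 m2_gt0 L1_gt0 L2_gt0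
    G_gt0 eps1_gt0 eps2_gt0 dl01 F_smooth F_int F_mean F_subexp
    (ltW alpha_gt0) erefl (leqnn _) (leqnn _) xstar_min f_gap dE).
Qed.

(** Sampling from a finite sum is sampling from the uniform law on a discrete
    space, where every function is measurable and integrable. *)
Lemma sncg_guarantees_model (M : sampling_model R) (F : sample M -> 'cV[R]_d -> R)
    (xi1 : nat -> 'I_m1 -> Omega -> sample M)
    (xi2 : nat -> 'I_m2 -> Omega -> sample M) (seed : nat -> Omega -> S) :
  fresh_draws PS P xi1 xi2 seed ->
  (forall i, smooth_component L1 L2 (F i)) ->
  (forall x, mean_exists (fun i => F i x)) ->
  (forall x, mean (fun i => F i x) = (f x)%:E) ->
  (forall x, mean (fun i => expR (enorm (grad (F i) x - grad f x)%R / G)%R)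
               <= (expR 1)%:E)%E ->
  sncg_guarantees F xi1 xi2 seed.
Proof.
case: M F xi1 xi2 => [[//|n] n_gt0|dX Xi mu] F xi1 xi2 draws F_smooth F_ex F_mean F_exp.
  apply: (@sncg_guarantees_law _ (discrete_index n) uniform_law F) => //.
  - case: draws => law1 law2 law_seed ind; split=> //.
    + move=> j k B _; have [mB PB] := law1 j k B I; split=> //.
      by rewrite PB; exact/esym/uniform_lawE.
    + move=> j k B _; have [mB PB] := law2 j k B I; split=> //.
      by rewrite PB; exact/esym/uniform_lawE.
  - by move=> z; apply: bounded_rv_integrable; exact: bounded_rv_discrete.
  - by move=> z; rewrite uniform_integral; have [] := F_mean z.
  - by move=> z; rewrite uniform_integralE; exact: F_exp.
apply: (@sncg_guarantees_law _ Xi mu F) => // z.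
- have := F_mean z; rewrite /mean unlock => E.
  by rewrite /Rintegral E.
- by have := F_exp z; rewrite /mean unlock.
Qed.

End Guarantees.

Theorem corollary1 (R : realType) (L1 L2 G Delta CA : R) (pA : nat) :
  0 < L1 -> 0 < L2 -> 0 < G ->
  exists (C : R) (p : nat),
  forall (dS : measure_display) (S : measurableType dS) (PS : probability S R)
    (A : pca_algorithm R S) (tA : pca_runtime R S),
  approximate_pca L1 PS A -> pca_time_bound L1 tA CA pA ->
  forall (d : nat) (M : sampling_model R) (F : sample M -> 'cV[R]_d -> R)
    (f : 'cV[R]_d -> R) (x0 xstar : 'cV[R]_d)
    (delta eps1 alpha Tg Th : R),
  (0 < d)%N ->
  (forall x, mean_exists (fun i => F i x)) ->
  (forall x, mean (fun i => F i x) = (f x)%:E) ->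
  (forall i, smooth_component L1 L2 (F i)) ->
  (forall x, f xstar <= f x) -> f x0 - f xstar <= Delta ->
  (forall x, mean (fun i => expR (enorm (grad (F i) x - grad f x)%R / G)%R)
               <= (expR 1)%:E)%E ->
  0 < delta < 1 -> 0 < eps1 < 1 -> 0 < alpha <= 1 ->
  0 <= Tg -> 0 <= Th ->
  let eps2 := eps1 `^ alpha in
  let N := 1 + sncg_rate L1 L2 eps1 eps2 * Delta in
  let delta' := delta / N in
  let m1 := size_S1 G L2 eps1 eps2 delta' in
  let m2 := size_S2 L1 eps2 d delta' in
  forall (dO : measure_display) (Omega : measurableType dO)
    (P : probability Omega R)
    (xi1 : nat -> 'I_m1 -> Omega -> sample M)
    (xi2 : nat -> 'I_m2 -> Omega -> sample M)
    (seed : nat -> Omega -> S),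
  fresh_draws PS P xi1 xi2 seed ->
  let x_ w := sncg_x A L1 L2 eps1 alpha eps2 delta' F x0
    (fun j k => xi1 j k w) (fun j k => xi2 j k w) (fun j => seed j w) in
  let stops w := sncg_stops A L1 L2 eps1 alpha eps2 delta' F x0
    (fun j k => xi1 j k w) (fun j k => xi2 j k w) (fun j => seed j w) in
  let time w := sncg_time A tA Tg Th L1 L2 eps1 alpha eps2 delta' F x0
    (fun j k => xi1 j k w) (fun j k => xi2 j k w) (fun j => seed j w) in
  [/\ ((1 - delta)%:E <=
        P [set w | exists j : nat, stops w j /\ (j%:R <= N)%R])%E,
      ((1 - 3 * delta)%:E <=
        P [set w | exists j : nat,
             [/\ stops w j, (enorm (grad f (x_ w j)) <= 2 * eps1)%R &
                 (lambda_min (hess f (x_ w j)) >= - (2 * eps2))%R]])%E &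
      forall (w : Omega) (j : nat), stops w j -> j%:R <= N ->
        time w j <=
          C * (1 + ln d%:R + ln delta^-1 + ln eps1^-1 + ln eps2^-1) ^+ p *
          (Th * Num.max (1 / (eps1 ^+ 2 * eps2 ^+ 2)) (1 / eps2 ^+ 5) +
           Tg * Num.max (Num.max (1 / eps1 ^+ 4) (1 / (eps1 ^+ 2 * eps2 ^+ 3)))
                        (Num.max (1 / eps2 ^+ 7)
                                 (1 / (eps1 ^+ 2 * eps2 ^+ 4))))].
Proof.
move=> L1_gt0 L2_gt0 G_gt0.
exists (iter_coef (L1 := L1) (L2 := L2) (Delta := Delta) *
  step_coef (L1 := L1) (L2 := L2) (G := G) (Delta := Delta) (CA := CA) (pA := pA)).
exists pA.+2.
move=> dS S PS A tA A_pca tA_le d M F f x0 xstar delta eps1 alpha Tg Th d_gt0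
  F_ex F_mean F_smooth xstar_min f_gap F_exp delta_01 eps1_01 alpha_01
  Tg_ge0 Th_ge0 eps2 N delta' m1 m2 dO Omega P xi1 xi2 seed draws x_ stops time.
have [terminates quality] := sncg_guarantees_model L1_gt0 L2_gt0 G_gt0 A_pca d_gt0
  xstar_min f_gap delta_01 eps1_01 alpha_01 draws F_smooth F_ex F_mean F_exp.
split; [exact: terminates|exact: quality|].
move=> w j _ jN.
have Delta_ge0 : 0 <= Delta by apply: le_trans f_gap; rewrite subr_ge0.
have eps2_01 : 0 < eps2 < 1 by case/andP: alpha_01 => a0 _; exact: in01_powR.
exact: (sncg_time_le L1_gt0 Delta_ge0 d_gt0 delta_01 eps1_01 eps2_01 tA_le
  L2_gt0 Tg_ge0 Th_ge0 F_smooth).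
Qed.
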